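(* There is a polynomial parameter transformation from AND-3SAT$[k]$ to Scheduling Weighted Tardy Jobs$[\log(d_{\max}+w_{\max})]$.
   Context: A parameterized problem is a set $P\subseteq\Sigma^*\times\mathbb{N}$ of instances $(I,k)$. A polynomial parameter transformation (PPT) from $P$ to $Q$ is a polynomial-time algorithm that maps each instance $(I,k)$ of $P$ to an instance $(I',k')$ of $Q$ such that $(I,k)\in P\iff(I',k')\in Q$ and $k'\le p(k)$ for a fixed polynomial $p$. AND-3SAT$[k]$: an instance is a sequence of $n$ 3-CNF formulas, each on at most $k$ variables; it is a yes-instance iff all formulas are satisfiable; the parameter is $k$. Scheduling Weighted Tardy Jobs: given jobs $(p_j,w_j,d_j)$, $j\in[n]$, with positive integer processing time $p_j$, weight $w_j$, due date $d_j$, and an integer $w$, decide whether there is a permutation $\rho$ of $[n]$ (a schedule on a single machine) such that the total weight of tardy jobs is at most $w$, where job $i$ has completion time $C_i=\sum_{j:\rho(j)\le\rho(i)}p_j$ and is tardy if $C_i>d_i$. The parameter is $\log(d_{\max}+w_{\max})$ with $d_{\max}=\max_j d_j$, $w_{\max}=\max_j w_j$. *)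

(* Defs.v *)
From HB Require Import structures.
From mathcomp Require Import all_boot all_order all_algebra all_fingroup.

Set Implicit Arguments.
Unset Strict Implicit.
Unset Printing Implicit Defensive.

Inductive move := Left | Stay | Right.

(* Tapes are two-way infinite.  A machine over the input/output alphabet [A]
   has the tape symbols [A + work] plus the blank, and [ntapes.+1] tapes; it
   halts when [delta] returns [None]. *)
Record machine (A : finType) := Machine {
  ntapes : nat;
  work : finType;
  state : finType;
  start : state;
  delta : state -> {ffun 'I_ntapes.+1 -> option (A + work)} ->
          option (state * {ffun 'I_ntapes.+1 -> option (A + work) * move})
}.

Section Machine.
Variables (A : finType) (M : machine A).

(* [None] is the blank. *)
Definition cell := option (A + work M).

(* [(l, r)]: [r] lists the cells from the head rightwards, and [l] the cells
   strictly left of the head, nearest first; all further cells are blank. *)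
Definition tape := (seq cell * seq cell)%type.

Definition scan (t : tape) : cell := head None t.2.

Definition act (t : tape) (am : cell * move) : tape :=
  let: (l, r) := (t.1, am.1 :: behead t.2) in
  match am.2 with
  | Left => (behead l, head None l :: r)
  | Stay => (l, r)
  | Right => (head None r :: l, behead r)
  end.

Definition config := (state M * {ffun 'I_(ntapes M).+1 -> tape})%type.

Definition step (c : config) : option config :=
  if delta c.1 [ffun i => scan (c.2 i)] is Some (q, a)
  then Some (q, [ffun i => act (c.2 i) (a i)]) else None.

Definition halted (c : config) : bool := ~~ isSome (step c).

(* A halted configuration is kept unchanged, so [halted (run t c)] says that
   the machine halts after at most [t] steps. *)
Fixpoint run (t : nat) (c : config) : config :=
  if t is t'.+1 then if step c is Some c' then run t' c' else c else c.

Definition init (x : seq A) : config :=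
  (start M, [ffun i => if i == ord0 then ([::], [seq Some (inl a) | a <- x])
                       else ([::], [::])]).

(* The output is the word on tape 0 from the head up to the first blank. *)
Definition outputs (c : config) (y : seq A) : Prop :=
  forall i, i <= size y ->
    nth None (c.2 ord0).2 i = nth None [seq Some (inl a) | a <- y] i.

End Machine.

Definition parameterized_problem (Sigma : finType) := seq Sigma * nat -> Prop.

(* The parameter is written in unary, so that the size of [(I, k)] is
   [|I| + k]. *)
Definition encode_pair (Sigma : finType) (x : seq Sigma * nat) :
    seq (option Sigma) :=
  [seq Some a | a <- x.1] ++ nseq x.2 None.

Definition polytime (Sigma : finType)
    (f : seq Sigma * nat -> seq Sigma * nat) : Prop :=
  exists (M : machine (option Sigma)) (q : {poly nat}),
  forall x : seq Sigma * nat,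
    let c := run q.[size (encode_pair x)]%R (init M (encode_pair x)) in
    halted c /\ outputs c (encode_pair (f x)).

Definition ppt (Sigma : finType) (P Q : parameterized_problem Sigma) : Prop :=
  exists f : seq Sigma * nat -> seq Sigma * nat,
    [/\ polytime f,
        forall x, P x <-> Q (f x)
      & exists p : {poly nat}, forall x, (f x).2 <= p.[x.2]%R].

Definition symbol : finType := (bool + 'I_3)%type.

Definition sep (i : nat) : symbol := inr (inord i).

(* Binary numeral, most significant digit first, no leading zeros; 0 is "0". *)
Definition bin (n : nat) : seq bool :=
  [seq odd (n %/ 2 ^ i) | i <- rev (iota 0 (trunc_log 2 n).+1)].

Definition encode_nat (n : nat) : seq symbol :=
  rcons [seq inl b | b <- bin n] (sep 0).

(* [(v, b)] is the variable [v] if [b], and its negation otherwise. *)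
Definition literal := (nat * bool)%type.
Definition clause := seq literal.
Definition cnf := seq clause.

Definition is_3cnf (phi : cnf) : bool := all (fun c => size c <= 3) phi.

Definition num_vars (phi : cnf) : nat :=
  size (undup [seq l.1 | l <- flatten phi]).

Definition satisfies (a : nat -> bool) (phi : cnf) : bool :=
  all (has (fun l : literal => a l.1 == l.2)) phi.

Definition satisfiable (phi : cnf) : Prop := exists a, satisfies a phi.

Definition encode_literal (l : literal) : seq symbol :=
  inl l.2 :: encode_nat l.1.

Definition encode_clause (c : clause) : seq symbol :=
  rcons (flatten [seq encode_literal l | l <- c]) (sep 1).

Definition encode_cnf (phi : cnf) : seq symbol :=
  rcons (flatten [seq encode_clause c | c <- phi]) (sep 2).

Definition and_3sat : parameterized_problem symbol := fun x =>
  exists phis : seq cnf,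
    [/\ x.1 = flatten [seq encode_cnf phi | phi <- phis],
        forall phi, phi \in phis -> is_3cnf phi /\ num_vars phi <= x.2
      & forall phi, phi \in phis -> satisfiable phi].

Record job := Job { ptime : nat; weight : nat; due : nat }.

Section Schedule.
Variable J : seq job.

Definition jobs : 'I_(size J) -> job := tnth (in_tuple J).

Definition positive_jobs : Prop :=
  forall i, [/\ 0 < ptime (jobs i), 0 < weight (jobs i) & 0 < due (jobs i)].

(* [rho i] is the position of job [i] in the schedule. *)
Definition completion (rho : 'S_(size J)) (i : 'I_(size J)) : nat :=
  \sum_(j | rho j <= rho i) ptime (jobs j).

Definition tardy (rho : 'S_(size J)) (i : 'I_(size J)) : bool :=
  due (jobs i) < completion rho i.

Definition tardy_weight (rho : 'S_(size J)) : nat :=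
  \sum_(i | tardy rho i) weight (jobs i).

(* Both are 0 when there is no job. *)
Definition dmax : nat := \max_i due (jobs i).
Definition wmax : nat := \max_i weight (jobs i).

End Schedule.

Definition encode_job (j : job) : seq symbol :=
  encode_nat (ptime j) ++ encode_nat (weight j) ++ encode_nat (due j).

(* Sign bit followed by the absolute value. *)
Definition encode_int (w : int) : seq symbol :=
  inl (w < 0)%R :: encode_nat `|w|%N.

(* The parameter is the logarithm rounded up to an integer. *)
Definition weighted_tardy_jobs : parameterized_problem symbol := fun x =>
  exists (J : seq job) (w : int),
    [/\ x.1 = encode_int w ++ flatten [seq encode_job j | j <- J],
        positive_jobs J,
        x.2 = up_log 2 (dmax J + wmax J)
      & exists rho : 'S_(size J), ((tardy_weight rho)%:Z <= w)%R].

(* Main.v *)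
(** With base-[B] digits, one for each variable and one for each triple of
    literals over [k] variables, the usual reduction from 3SAT to subset sum turns
    a formula into a multiset of numbers, some of whose elements sum to [T]
    iff the formula is satisfiable; [T] depends on [k] only, since all triples get
    a digit whether they occur in the formula or not.  The [i]-th of [n] formulas
    becomes a block of jobs with these processing times, due date [i T], and
    weight [n + 1 - i] times the processing time.  The processing times of the
    jobs on time in the first [i] blocks sum to at most [i T], and by Abel
    summation the weight of all jobs on time is the sum of these [n] sums.  So it
    is at most [n (n + 1) / 2 * T], with equality iff every block contributes
    exactly [T].  Formulas on which the same triples are present give the same
    numbers, and only one of them is kept; hence [n <= 2 ^ (2 k) ^ 3], and all due
    dates and weights have polynomially many bits in [k].

    For the running time, the output is described by terms with bounded sums over
    positions of the input.  Their values are polynomially bounded, so that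
    counters on the tapes of a Turing machine can evaluate them in unary; the large
    numbers of the output occur only through their bits. *)

Require Import Defs.
From mathcomp Require Import all_boot all_order all_algebra all_fingroup.
From mathcomp Require Import zify.
From Stdlib Require Import FunctionalExtensionality.

Set Implicit Arguments.
Unset Strict Implicit.
Unset Printing Implicit Defensive.

(** * Counter programs on Turing machines *)

(** Three constraints shape the construction. The machine works with polynomially bounded counters
    but must print long numbers: the base is a power of two, so each bit of a number is a bit of one
    digit, and digits are at most $3n^2$. The target parameter is an exact logarithm of the largest
    due date plus the largest weight: one extra job dominates both and makes that sum a power of two
    with known exponent. Variables of a formula may have names of any size: they are renumbered by
    their rank within the formula, and ranks are found by comparing input positions, since terms
    have no lists.

    The threshold is half of the total weight of the blocks, because the items of a block sum to
    $2T$; a bound on the tardy weight is thus a lower bound on the weight on time.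

    Inputs that are not encodings, that have too many variables in some formula, or that contain an
    empty clause are no-instances; they are sent to the empty word, which encodes no instance. *)

Lemma run_halted (A : finType) (M : machine A) (c : config M) n :
  step c = None -> Defs.run n c = c.
Proof. by case: n => //= n ->. Qed.

Section Programs.
Variable A : finType.

Inductive prim := Inc (r : nat) | Dec (r : nat) | InR | InL | Out (a : A).
Inductive test := Pos (r : nat) | Inp (f : pred (option A)).
Inductive cmd :=
  | Skip | Prim (p : prim) | Seq (c1 c2 : cmd)
  | If (b : test) (c : cmd) | While (b : test) (c : cmd).

Record st := St { rg : nat -> nat; ps : nat; ou : seq A }.

Definition upd (f : nat -> nat) r v := fun q => if q == r then v else f q.

(** [ps] cannot record a head to the left of the input, so [InL] at position 0 is undefined rather
    than truncated. *)
Definition pdef p s := if p is InL then 0 < ps s else true.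

Definition psem p s : st :=
  match p with
  | Inc r => St (upd (rg s) r (rg s r).+1) (ps s) (ou s)
  | Dec r => St (upd (rg s) r (rg s r).-1) (ps s) (ou s)
  | InR => St (rg s) (ps s).+1 (ou s)
  | InL => St (rg s) (ps s).-1 (ou s)
  | Out a => St (rg s) (ps s) (rcons (ou s) a)
  end.

Section Input.
Variable x : seq A.

Definition tsem b s : bool :=
  match b with
  | Pos r => 0 < rg s r
  | Inp f => f (onth x (ps s))
  end.

(** The counts are those of the instructions executed by [code]: one for a primitive or a
    conditional jump, and two per round of a loop, for the jump at its head and the jump back. *)
Inductive exec : cmd -> nat -> st -> st -> Prop :=
  | ESkip s : exec Skip 0 s s
  | EPrim p s : pdef p s -> exec (Prim p) 1 s (psem p s)
  | ESeq c1 c2 t1 t2 s s1 s2 :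
      exec c1 t1 s s1 -> exec c2 t2 s1 s2 -> exec (Seq c1 c2) (t1 + t2) s s2
  | EIfT b c t s s' : tsem b s -> exec c t s s' -> exec (If b c) t.+1 s s'
  | EIfF b c s : ~~ tsem b s -> exec (If b c) 1 s s
  | EWhileF b c s : ~~ tsem b s -> exec (While b c) 1 s s
  | EWhileT b c t1 t2 s s1 s2 : tsem b s ->
      exec c t1 s s1 -> exec (While b c) t2 s1 s2 ->
      exec (While b c) (t1 + t2).+2 s s2.

(** [IJn b d] skips [d] instructions if [b] fails, and [IJb d] goes back by [d]. Jumps are relative
    so that the code of a command can be placed anywhere. *)
Inductive instr := IPrim (p : prim) | IJn (b : test) (d : nat) | IJb (d : nat).

Fixpoint code c : seq instr :=
  match c with
  | Skip => [::]
  | Prim p => [:: IPrim p]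
  | Seq c1 c2 => code c1 ++ code c2
  | If b c => IJn b (size (code c)) :: code c
  | While b c =>
      IJn b (size (code c)).+1 :: rcons (code c) (IJb (size (code c)).+1)
  end.

(** The bound on forward jumps keeps the program counter at most [size P], where [inord] represents
    it faithfully in the machine state. *)
Inductive cstep (P : seq instr) : nat * st -> nat * st -> Prop :=
  | SPrim pc s p : onth P pc = Some (IPrim p) -> pdef p s ->
      cstep P (pc, s) (pc.+1, psem p s)
  | SJn pc s b d : onth P pc = Some (IJn b d) -> pc.+1 + d <= size P ->
      cstep P (pc, s) (if tsem b s then pc.+1 else pc.+1 + d, s)
  | SJb pc s d : onth P pc = Some (IJb d) -> cstep P (pc, s) (pc - d, s).

Inductive creach P : nat -> nat * st -> nat * st -> Prop :=
  | CRefl c : creach P 0 c c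
  | CStep t c c1 c2 : cstep P c c1 -> creach P t c1 c2 -> creach P t.+1 c c2.

Lemma creach_trans P t1 t2 c c1 c2 :
  creach P t1 c c1 -> creach P t2 c1 c2 -> creach P (t1 + t2) c c2.
Proof.
by elim=> [//|t d d1 d2 Hs _ IH] H2; rewrite addSn; apply: (CStep Hs); exact: IH.
Qed.

Lemma onth_mid (T : Type) (P : seq T) y Q : onth (P ++ y :: Q) (size P) = Some y.
Proof. by rewrite onthE map_cat nth_cat size_map ltnn subnn. Qed.

(** Quantifying over the surrounding code makes the induction hypotheses apply to subcommands. After
    a round of a loop, [IJb] returns to [size P], where the hypothesis for the remaining rounds
    starts. *)
Lemma code_correct c t s s' : exec c t s s' -> forall P Q,
  creach (P ++ code c ++ Q) t (size P, s) (size P + size (code c), s').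
Proof.
elim=> {c t s s'}.
- by move=> s P Q /=; rewrite addn0; exact: CRefl.
- move=> p s Hp P Q /=; rewrite addn1.
  by apply: CStep (CRefl _ _); apply: SPrim => //; exact: onth_mid.
- move=> c1 c2 t1 t2 s s1 s2 _ IH1 _ IH2 P Q /=; rewrite -catA size_cat addnA.
  apply: creach_trans (IH1 _ _) _.
  by rewrite catA -size_cat; exact: IH2.
- move=> b c t s s' Hb _ IH P Q /=.
  apply: CStep; first by apply: SJn; [exact: onth_mid|rewrite !size_cat /= ?size_cat
    ?size_rcons; lia].
  rewrite Hb -cat_rcons addnS -addSn -(size_rcons P (IJn b (size (code c)))).
  exact: IH.
- move=> b c s Hb P Q /=.
  apply: CStep; first by apply: SJn; [exact: onth_mid|rewrite !size_cat /= ?size_cat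
    ?size_rcons; lia].
  by rewrite (negbTE Hb) addnS addSn; exact: CRefl.
- move=> b c s Hb P Q /=.
  apply: CStep; first by apply: SJn; [exact: onth_mid|rewrite !size_cat /= ?size_cat
    ?size_rcons; lia].
  by rewrite (negbTE Hb) size_rcons !addnS addSn; exact: CRefl.
- move=> b c t1 t2 s s1 s2 Hb _ IH1 _ IH2 P Q.
  have -> : (t1 + t2).+2 = 1 + (t1 + (1 + t2)) by lia.
  apply: (@creach_trans _ _ _ _ ((size P).+1, s)).
    apply: CStep (CRefl _ _) => /=.
    have -> : (size P).+1 = if tsem b s then (size P).+1
                            else (size P).+1 + (size (code c)).+1 by rewrite Hb.
    by apply: SJn; [exact: onth_mid|rewrite !size_cat /= ?size_cat ?size_rcons; lia].
  apply: creach_trans.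
    have /= := IH1 (rcons P (IJn b (size (code c)).+1))
                 (IJb (size (code c)).+1 :: Q).
    by rewrite !cat_rcons size_rcons; apply.
  apply: creach_trans (IH2 P Q); apply: CStep (CRefl _ _) => /=.
  have E : (size P).+1 + size (code c) =
           size (P ++ IJn b (size (code c)).+1 :: code c).
    by rewrite size_cat /= addSnnS.
  have -> : (size P, s1) =
      ((size P).+1 + size (code c) - (size (code c)).+1, s1).
    by congr pair; lia.
  apply: SJb; rewrite E.
  suff -> : P ++ code (While b c) ++ Q =
     (P ++ IJn b (size (code c)).+1 :: code c) ++ IJb (size (code c)).+1 :: Q.
    exact: onth_mid.
  by rewrite /= cat_rcons -catA.
Qed.
End Input.

(** The successor makes [nreg] exceed every register that occurs. *)
Definition ireg i :=
  match i with
  | IPrim (Inc r) | IPrim (Dec r) | IJn (Pos r) _ => r.+1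
  | _ => 0
  end.

(** * Simulation of jump code by a Turing machine *)

Variable P : seq instr.

Definition nreg := foldr maxn 0 [seq ireg i | i <- P].

Definition tcell := option (A + unit).
Definition mk : tcell := Some (inr tt).
Definition letter (c : tcell) : option A := if c is Some (inl a) then Some a else None.

(** Tape 0 is the input, tape 1 the output, tape [r.+2] register [r]. On the mark the register is 0
    and [Dec] does not move, in accordance with the truncated predecessor. *)
Definition pact p (i : nat) (c : tcell) : tcell * move :=
  match p with
  | Inc r => (c, if i == r.+2 then Right else Stay)
  | Dec r => (c, if (i == r.+2) && (c != mk) then Left else Stay)
  | InR => (c, if i == 0 then Right else Stay)
  | InL => (c, if i == 0 then Left else Stay)
  | Out a => if i == 1 then (Some (inl a), Right) else (c, Stay)
  end.

Definition tact b (sc : {ffun 'I_nreg.+2 -> tcell}) : bool :=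
  match b with
  | Pos r => sc (inord r.+2) != mk
  | Inp f => f (letter (sc ord0))
  end.

(* State [inr 0] marks the origin of every register tape; [inr 1] and [inr 2]
   copy the output from tape 1, last letter first, to the left of the input on
   tape 0, leaving one blank in between; [inr 3] halts. *)
Definition tm_state := ('I_(size P).+1 + 'I_4)%type.

Definition tm_delta (q : tm_state) (sc : {ffun 'I_nreg.+2 -> tcell}) :
    option (tm_state * {ffun 'I_nreg.+2 -> tcell * move}) :=
  match q with
  | inl pc =>
    match onth P pc with
    | Some (IPrim p) => Some (inl (inord pc.+1), [ffun i => pact p (val i) (sc i)])
    | Some (IJn b d) =>
      Some (inl (inord (if tact b sc then pc.+1 else pc.+1 + d)),
            [ffun i => (sc i, Stay)])
    | Some (IJb d) => Some (inl (inord (pc - d)), [ffun i => (sc i, Stay)])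
    | None => Some (inr (inord 1),
                    [ffun i => (sc i, if val i <= 1 then Left else Stay)])
    end
  | inr j =>
    match val j with
    | 0 => Some (inl ord0, [ffun i => (if val i <= 1 then sc i else mk, Stay)])
    | 1 => Some (inr (inord 2), [ffun i => (sc i, if val i == 0 then Left else Stay)])
    | 2 => if sc (inord 1) is Some c then
             Some (inr (inord 2),
                   [ffun i => if val i <= 1 then (Some c, Left) else (sc i, Stay)])
           else Some (inr (inord 3),
                   [ffun i => (sc i, if val i == 0 then Right else Stay)])
    | _ => None
    end
  end.

Definition tm : machine A := @Machine A nreg.+1 unit tm_state (inr ord0) tm_delta.

(* [F] and [G] are the contents to the left of the head and from it on. *)
Definition tp (F G : nat -> tcell) (t : tape tm) : Prop :=
  (forall i, nth None t.1 i = F i) /\ (forall i, nth None t.2 i = G i).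

Lemma tp_ext F G F' G' t : tp F' G' t -> F' =1 F -> G' =1 G -> tp F G t.
Proof. by move=> [H1 H2] E1 E2; split=> i; rewrite ?H1 ?H2. Qed.

Lemma tp_scan F G t : tp F G t -> scan t = G 0.
Proof. by case=> _ /(_ 0) <-; rewrite nth0. Qed.

Lemma nth_behead0 (T : Type) (x0 : T) s i : nth x0 (behead s) i = nth x0 s i.+1.
Proof. by case: s => //=; rewrite nth_nil. Qed.

Lemma tp_stay F G t c : tp F G t ->
  tp F (fun i => if i is j.+1 then G i else c) (@Defs.act _ tm t (c, Stay)).
Proof. by case=> H1 H2; split=> //= -[//|i]; rewrite -H2 /= nth_behead0. Qed.

Lemma tp_right F G t c : tp F G t ->
  tp (fun i => if i is j.+1 then F j else c) (fun i => G i.+1)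
     (@Defs.act _ tm t (c, Right)).
Proof. by case=> H1 H2; split=> [[//|i]|i] /=; rewrite ?H1 // -H2 nth_behead0. Qed.

Lemma tp_left F G t c : tp F G t ->
  tp (fun i => F i.+1)
     (fun i => match i with 0 => F 0 | 1 => c | j.+2 => G j.+1 end)
     (@Defs.act _ tm t (c, Left)).
Proof.
case=> H1 H2; split=> [i|[|[//|i]]] /=; first by rewrite nth_behead0 H1.
  by rewrite -H1 nth0.
by rewrite nth_behead0 H2.
Qed.

Lemma tp_stay_scan F G t : tp F G t -> tp F G (@Defs.act _ tm t (scan t, Stay)).
Proof. by move=> H; apply: tp_ext (tp_stay _ H) _ _ => [//|[|i]] //;
  exact: tp_scan H. Qed.

Variable x : seq A.

Definition inL p i : tcell := if i < p then omap inl (onth x (p.-1 - i)) else None.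
Definition inR p i : tcell := omap inl (onth x (p + i)).
Definition outL o i : tcell := omap inl (onth (rev o) i).
(* Tape [r.+2] holds register [r]: its only nonblank cell is a mark, and the
   value of the register is the distance of the head to the right of it. *)
Definition regL n i : tcell := if i.+1 == n then mk else None.
Definition regR n i : tcell := if (n == 0) && (i == 0) then mk else None.

Definition rep (s : st) (T : {ffun 'I_nreg.+2 -> tape tm}) : Prop :=
  [/\ tp (inL (ps s)) (inR (ps s)) (T ord0),
      tp (outL (ou s)) (fun=> None) (T (inord 1))
    & forall r, r < nreg -> tp (regL (rg s r)) (regR (rg s r)) (T (inord r.+2))].

Lemma onth_nreg pc i : onth P pc = Some i -> ireg i <= nreg.
Proof.
rewrite /nreg; elim: P pc => [|j s IH] [|pc] //= H; rewrite leq_max.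
  by case: H => ->; rewrite leqnn.
by rewrite (IH _ H) orbT.
Qed.

Lemma onth_lt (T : Type) (s : seq T) i y : onth s i = Some y -> i < size s.
Proof. by elim: s i => [|z s IH] [|i] //= /IH. Qed.

Lemma tm_step q (T : {ffun 'I_nreg.+2 -> tape tm}) q' acts :
  tm_delta q [ffun i => scan (T i)] = Some (q', acts) ->
  @step _ tm (q, T) = Some (q', [ffun i => Defs.act (T i) (acts i)]).
Proof. by move=> H; rewrite /step /= H. Qed.

Lemma tact_tsem pc b d s T : rep s T -> onth P pc = Some (IJn b d) ->
  tact b [ffun i => scan (T i)] = tsem x b s.
Proof.
move=> [H0 H1 HR] /onth_nreg; case: b => [r|f] /= Hr; rewrite ffunE.
  by rewrite (tp_scan (HR _ Hr)) /regR; case: (rg s r).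
by rewrite (tp_scan H0) /inR addn0; case: (onth x _).
Qed.

Lemma rep_stay s T : rep s T ->
  rep s [ffun i => Defs.act (T i) ([ffun i => ([ffun i => scan (T i)] i, Stay)] i)].
Proof.
by case=> H0 H1 HR; split=> [||r Hr]; rewrite !ffunE; apply: tp_stay_scan => //;
  apply: HR.
Qed.

Lemma inL_S p i : inL p.+1 i.+1 = inL p i.
Proof. by rewrite /inL /= ltnS; case: p => //= p; rewrite subSS. Qed.

Lemma rep_prim p s T : rep s T -> pdef p s -> ireg (IPrim p) <= nreg ->
  rep (psem p s) [ffun i => Defs.act (T i) ([ffun i => pact p (val i) ([ffun i => scan
    (T i)] i)] i)].
Proof.
have E1 : val (inord 1 : 'I_nreg.+2) = 1 by rewrite /= inordK.
have N2 r : r < nreg -> val (inord r.+2 : 'I_nreg.+2) = r.+2 by move=> Hr;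
  rewrite /= inordK.
case=> H0 H1 HR; case: p => [r|r|||a] /= Hp Hr; split=> [||q Hq];
  rewrite !ffunE ?E1 ?(N2 _ Hq) /= ?eqSS; try exact: tp_stay_scan;
  try (by apply: tp_stay_scan; apply: HR).
- rewrite /upd; case: eqVneq => [->|_]; last by apply: tp_stay_scan; apply: HR.
  apply: tp_ext (tp_right _ (HR _ Hr)) _ _ => [[|i]|i]; rewrite ?(tp_scan (HR _ Hr)) //.
    by rewrite /regR /regL; case: (rg s r).
  by rewrite /regR; case: (rg s r).
- rewrite /upd (tp_scan (HR _ Hq)); case: eqVneq => [->|_] /=; last first.
    by rewrite -(tp_scan (HR _ Hq)); apply: tp_stay_scan; apply: HR.
  move: (HR _ Hr); case: (rg s r) => [|n] H /=.
    by rewrite -(tp_scan H); exact: tp_stay_scan.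
  apply: tp_ext (tp_left _ H) _ _ => [//|[|[|i]]] //=.
    by rewrite /regL /regR; case: n {H}.
    by rewrite /regR andbF.
  by rewrite /regR !andbF.
- apply: tp_ext (tp_right _ H0) _ _ => [[|i]|i].
  + by rewrite (tp_scan H0) /inL /inR /= subn0 addn0.
  + by rewrite inL_S.
  + by rewrite /inR addnS.
- move: Hp H0; case: (ps s) => // p _ H0 /=.
  apply: tp_ext (tp_left _ H0) _ _ => [i|[|[|i]]]; first by rewrite inL_S.
  + by rewrite /inL /inR /= subn0 addn0.
  + by rewrite (tp_scan H0) /inR addn1 addn0.
  + by rewrite /inR !addnS.
- apply: tp_ext (tp_right _ H1) _ _ => [[|i]|//]; by rewrite /outL rev_rcons.
Qed.

Lemma cstep_sim pc s pc' s' T : cstep x P (pc, s) (pc', s') -> rep s T ->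
  [/\ pc' <= size P & exists2 T', @step _ tm (inl (inord pc), T) = Some (inl (inord
    pc'), T')
    & rep s' T'].
Proof.
move E: (pc, s) => c; move E': (pc', s') => c' H; case: H E E' => {c c'}.
- move=> pc1 s1 p Hp Hd [??] [??] Hr; subst; have Hlt := onth_lt Hp; split=> //.
  exists [ffun i => Defs.act (T i) ([ffun i => pact p (val i) ([ffun i => scan (T i)]
    i)] i)].
    by apply: tm_step; rewrite /= inordK 1?ltnW // Hp.
  by apply: rep_prim => //; exact: onth_nreg Hp.
- move=> pc1 s1 b d Hp Hd [??] [??] Hr; subst; have Hlt := onth_lt Hp; split.
    by case: ifP => //; lia.
  exists [ffun i => Defs.act (T i) ([ffun i => ([ffun i => scan (T i)] i, Stay)] i)].
    by apply: tm_step; rewrite /= inordK 1?ltnW // Hp (tact_tsem Hr Hp).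
  exact: rep_stay.
- move=> pc1 s1 d Hp [??] [??] Hr; subst; have Hlt := onth_lt Hp; split.
    by lia.
  exists [ffun i => Defs.act (T i) ([ffun i => ([ffun i => scan (T i)] i, Stay)] i)].
    by apply: tm_step; rewrite /= inordK 1?ltnW // Hp.
  exact: rep_stay.
Qed.

(** Asking for every number [m] of further steps makes such facts compose by adding step counts. *)
Definition reach n c c' := forall m, @Defs.run _ tm (n + m) c = Defs.run m c'.

Lemma reach_trans n n' c c' c'' : reach n c c' -> reach n' c' c'' -> reach (n + n') c
  c''.
Proof. by move=> H1 H2 m; rewrite -addnA H1 H2. Qed.

Lemma reach_step c c' : @step _ tm c = Some c' -> reach 1 c c'.
Proof. by move=> H m; rewrite /= H. Qed.

Lemma creach_sim t pc s pc' s' T : creach x P t (pc, s) (pc', s') -> rep s T ->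
  exists2 T', reach t (inl (inord pc), T) (inl (inord pc'), T') & rep s' T'.
Proof.
move E: (pc, s) => c; move E': (pc', s') => c' H; elim: H pc s T E E' => {t c c'}.
  by move=> c pc s T <- [-> ->] Hr; exists T.
move=> t c [pc1 s1] c2 Hs _ IH pc s T E E' Hr; subst c.
have [_ [T1 H1 R1]] := cstep_sim Hs Hr.
have [T2 H2 R2] := IH _ _ _ erefl E' R1.
by exists T2 => //; exact: reach_trans (reach_step H1) H2.
Qed.

Lemma cstep_out c c' : cstep x P c c' -> size (ou c'.2) <= (size (ou c.2)).+1.
Proof. by case=> [pc s [] //= *||] //=; rewrite ?size_rcons. Qed.

(** A step emits at most one letter. This bounds the cost of the final copying phase by the running
    time of the program. *)
Lemma creach_out t pc s pc' s' : creach x P t (pc, s) (pc', s') ->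
  size (ou s') <= size (ou s) + t.
Proof.
move E: (pc, s) => c; move E': (pc', s') => c' H; elim: H pc s E E' => {t c c'}.
  by move=> c pc s <- [_ ->]; rewrite addn0.
move=> t c [pc1 s1] c2 Hs _ IH pc s E E'; subst c; apply: leq_trans (IH _ _ erefl E') _.
rewrite addnS -addSn leq_add2r.
exact: (cstep_out Hs).
Qed.

Let s0 := St (fun=> 0) 0 [::].

Lemma init_sim : exists2 T, reach 1 (@init _ tm x) (inl ord0, T) & rep s0 T.
Proof.
have E1 : val (inord 1 : 'I_nreg.+2) = 1 by rewrite /= inordK.
rewrite /init; set T0 := [ffun i => _].
have H0 : tp (inL 0) (inR 0) (T0 ord0).
  split=> i; rewrite ffunE /= /inL /inR ?nth_nil //.
  by elim: x i => [|y z IH] [|i] //=; exact: IH.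
have HN i : i != ord0 -> tp (fun=> None) (fun=> None) (T0 i).
  by move=> /negbTE Hi; split=> j; rewrite ffunE Hi /= ?nth_nil //; case: j => // j;
    rewrite nth_nil.
move: T0 H0 HN => T0 H0 HN.
exists [ffun i => Defs.act (T0 i) ([ffun i : 'I_nreg.+2 => (if val i <= 1
   then [ffun i => scan (T0 i)] i else mk, Stay)] i)].
  by apply: reach_step; apply: tm_step.
have N1 : inord 1 != ord0 :> 'I_nreg.+2 by rewrite -val_eqE E1.
split=> [||r Hr]; rewrite !ffunE ?E1.
- exact: tp_stay_scan.
- by apply: tp_ext (tp_stay_scan (HN _ N1)) _ _; case.
- have N2 : val (inord r.+2 : 'I_nreg.+2) = r.+2 by rewrite /= inordK.
  have N0 : inord r.+2 != ord0 :> 'I_nreg.+2 by rewrite -val_eqE N2.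
  by rewrite N2 /=; apply: tp_ext (tp_stay _ (HN _ N0)) _ _ => //; case.
Qed.

(** The letters [o] are still on tape 1, from the head leftwards, and [y] is already on tape 0,
    right of the head and followed by a blank. The scanned cell of tape 0 is unconstrained: it is
    overwritten or left behind next. *)
Definition copying (o y : seq A) (T : {ffun 'I_nreg.+2 -> tape tm}) :=
  [/\ exists2 G, tp (fun i => omap inl (onth o i.+1)) G (T (inord 1)) & G 0 = omap inl
    (onth o 0),
      (forall i, nth None (T ord0).1 i = None)
    & forall i, i <= size y -> nth None (T ord0).2 i.+1 = omap inl (onth y i)].

Lemma copy_sim o y T : copying o y T ->
  exists2 T', reach (size o).+1 (inr (inord 2), T) (inr (inord 3), T') &
   forall i, i <= size (rev o ++ y) -> nth None (T' ord0).2 i = omap inl (onth (rev o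
     ++ y) i).
Proof.
have E1 : val (inord 1 : 'I_nreg.+2) = 1 by rewrite /= inordK.
have E2 : val (inord 2 : 'I_4) = 2 by rewrite /= inordK.
elim: o y T => [|a o IH] y T [[G H1 HG] H0l H0r].
  exists [ffun i => Defs.act (T i) ([ffun i : 'I_nreg.+2 => (([ffun i => scan (T i)] i,
    if val i == 0 then Right else Stay))] i)].
    apply: reach_step; apply: tm_step; rewrite /tm_delta E2.
    by rewrite !ffunE (tp_scan H1) HG.
  move=> i Hi; rewrite !ffunE /= nth_behead0; exact: H0r.
set T1 : {ffun 'I_nreg.+2 -> tape tm} := [ffun i => Defs.act (T i) ([ffun i :
  'I_nreg.+2 => if val i <= 1 then (Some (inl a) , Left) else ([ffun i => scan (T i)]
    i, Stay)] i)].
have HT1 : copying o (a :: y) T1.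
  rewrite /T1; split; rewrite !ffunE ?E1.
  - by eexists; [exact: tp_left H1|].
  - by move=> i; rewrite /= nth_behead0 H0l.
  - case=> [_|i] //= Hi; rewrite nth_behead0; exact: H0r.
have [T' HT' HT''] := IH _ _ HT1.
exists T'; last by rewrite rev_cons cat_rcons.
rewrite -[(size (a :: o)).+1]/(1 + (size o).+1).
apply: reach_trans HT'; apply: reach_step; apply: tm_step.
by rewrite /tm_delta E2 !ffunE (tp_scan H1) HG.
Qed.

Lemma final_sim s T : rep s T -> ps s = 0 ->
  exists2 T', reach (size (ou s) + 3) (inl (inord (size P)), T) (inr (inord 3), T') &
   forall i, i <= size (ou s) -> nth None (T' ord0).2 i = omap inl (onth (ou s) i).
Proof.
have E1 : val (inord 1 : 'I_nreg.+2) = 1 by rewrite /= inordK.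
have E4 : val (inord 1 : 'I_4) = 1 by rewrite /= inordK.
case=> H0 H1 _ Hp; rewrite Hp in H0.
(* The head of tape 1 moves onto the last letter, if any, and that of tape 0 off the input. Its
   second move to the left leaves the blank that ends the output. *)
set T1 : {ffun 'I_nreg.+2 -> tape tm} := [ffun i => Defs.act (T i) ([ffun i :
  'I_nreg.+2 => ([ffun i => scan (T i)] i, if val i <= 1 then Left else Stay)] i)].
have S1 : reach 1 (inl (inord (size P)), T) (inr (inord 1), T1).
  apply: reach_step; apply: tm_step; rewrite /tm_delta inordK //.
  suff -> : onth P (size P) = None by [].
  by elim: P.
have H10 : tp (fun=> None) (fun i => if i is j.+1 then inR 0 j else None) (T1 ord0).
  rewrite !ffunE /=; apply: tp_ext (tp_left _ H0) _ _ => [//|[|[|i]]] //=.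
  by rewrite (tp_scan H0).
have H11 : tp (fun i => omap inl (onth (rev (ou s)) i.+1))
   (fun i => if i is 0 then omap inl (onth (rev (ou s)) 0) else None) (T1 (inord 1)).
  rewrite !ffunE E1 /=; apply: tp_ext (tp_left _ H1) _ _ => [//|[|[|i]]] //=.
  by rewrite (tp_scan H1).
move: T1 S1 H10 H11 => T1 S1 H10 H11.
set T2 : {ffun 'I_nreg.+2 -> tape tm} := [ffun i => Defs.act (T1 i) ([ffun i :
  'I_nreg.+2 => ([ffun i => scan (T1 i)] i, if val i == 0 then Left else Stay)] i)].
have S2 : reach 1 (inr (inord 1), T1) (inr (inord 2), T2).
  by apply: reach_step; apply: tm_step; rewrite /tm_delta E4.
have HT2 : copying (rev (ou s)) [::] T2.
  rewrite /T2; split; rewrite !ffunE ?E1 /=.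
  - by eexists; [exact: tp_stay_scan H11|].
  - by move=> i; rewrite nth_behead0; case: H10.
  - by case=> //= _; rewrite (tp_scan H10).
have [T3 S3] := copy_sim HT2.
rewrite revK cats0 => HT3; exists T3 => //.
have -> : size (ou s) + 3 = 1 + (1 + (size (rev (ou s))).+1) by rewrite size_rev; lia.
exact: reach_trans S1 (reach_trans S2 S3).
Qed.

(** One step writes the marks, [t] steps run the program, and the output length plus 3 is spent on
    copying; as the output has at most [t] letters, [2 * t + 4] steps suffice. The input position
    must be 0 so that the cells left of the head are blank. *)
Lemma tm_correct t s : creach x P t (0, s0) (size P, s) -> ps s = 0 ->
  forall m, 2 * t + 4 <= m ->
  let c := Defs.run m (@init _ tm x) in halted c /\ outputs c (ou s).
Proof.
move=> Hc Hp m Hm; have [T1 S1 R1] := init_sim.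
have S1' : reach 1 (init tm x) (inl (inord 0), T1).
  by rewrite (_ : inord 0 = ord0) //; apply: val_inj; rewrite /= inordK.
have [T2 S2 R2] := creach_sim Hc R1.
have [T3 S3 HT3] := final_sim R2 Hp.
have Hs := creach_out Hc; rewrite /= add0n in Hs.
have S := reach_trans S1' (reach_trans S2 S3).
have N : @step _ tm (inr (inord 3), T3) = None by rewrite /step /= inordK.
have -> : m = (1 + (t + (size (ou s) + 3))) + (m - (1 + (t + (size (ou s) + 3)))) by
  lia.
rewrite S (run_halted _ N).
split; first by rewrite /halted N.
move=> i Hi; rewrite HT3 //.
by elim: (ou s) i {Hi} => [|y z IH] [|i] //=.
Qed.
End Programs.

Definition runs (A : finType) (x : seq A) c t s s' := exists2 t', t' <= t & exec x c t'
  s s'.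

Definition st0 (A : finType) : st A := St (fun=> 0) 0 [::].

Lemma polytime_of_cmd (Sigma : finType) (f : seq Sigma * nat -> seq Sigma * nat)
    (c : cmd (option Sigma)) (e : nat) :
  (forall x, exists2 s, runs (encode_pair x) c ((size (encode_pair x) + 2) ^ e) (st0 _)
    s
      & ps s = 0 /\ ou s = encode_pair (f x)) ->
  polytime f.
Proof.
(* With [t] the power given by the hypothesis, this is the bound [2 * t + 4]. The 2 in the base
   keeps it above 1, so that its powers can absorb constants. *)
move=> H; exists (tm (code c)), (2%N%:P * ('X + 2%N%:P) ^+ e + 4%N%:P)%R.
move=> x; have [s [t Ht Hs] [Hp Ho]] := H x.
have Hc := code_correct Hs [::] [::]; rewrite cats0 /= add0n in Hc.
rewrite -Ho; apply: (tm_correct Hc Hp).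
rewrite hornerD hornerCM horner_exp hornerD hornerX !hornerC.
by rewrite !(natrDE, natrME, natrXE) leq_add2r leq_mul2l.
Qed.

(** * Polynomially bounded terms over input positions *)

Section Terms.
Variable A : finType.

(* Variables are de Bruijn indices in an environment of natural numbers, which
   [TLet] and the binders [TSum], [TDwn] extend and [TSh] shortens.  [TDwn]
   iterates [v |-> v - t(i, v)]: as its values only decrease, every term is
   polynomially bounded in the input size and the environment. *)
Inductive term :=
  | TNat (n : nat) | TVar (i : nat) | TAdd (t1 t2 : term)
  | TSum (n t : term)
  | TDwn (n t0 t : term)
  | TSym (a : A) (t : term) | TLen
  | TLet (t1 t2 : term) | TSh (t : term).

Inductive gen :=
  | GEmit (a : A) | GSeq (g1 g2 : gen) | GFor (n : term) (g : gen) | GSh (g : gen).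

Fixpoint ev (x : seq A) (t : term) (e : seq nat) : nat :=
  match t with
  | TNat n => n
  | TVar i => nth 0 e i
  | TAdd t1 t2 => ev x t1 e + ev x t2 e
  | TSum n t => \sum_(i < ev x n e) ev x t (val i :: e)
  | TDwn n t0 t =>
      iteri (ev x n e) (fun i a => a - ev x t [:: i, a & e]) (ev x t0 e)
  | TSym a t => onth x (ev x t e) == Some a
  | TLen => size x
  | TLet t1 t2 => ev x t2 (ev x t1 e :: e)
  | TSh t => ev x t (behead e)
  end.

Fixpoint gev (x : seq A) (g : gen) (e : seq nat) : seq A :=
  match g with
  | GEmit a => [:: a]
  | GSeq g1 g2 => gev x g1 e ++ gev x g2 e
  | GFor n g => flatten [seq gev x g (i :: e) | i <- iota 0 (ev x n e)]
  | GSh g => gev x g (behead e)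
  end.

Notation cmd := (cmd A).
Notation Skip := (Skip A).

Definition inc r : cmd := Prim (Inc A r).
Definition dec r : cmd := Prim (Dec A r).
Definition loop r (c : cmd) : cmd := While (Pos A r) (Seq (dec r) c).
Definition clear r : cmd := loop r Skip.

(* [env] lists the registers of the variables, registers from [fr] on are free
   and contain 0, and the value of the term is added to register [dst]. *)
Fixpoint compile_term (t : term) (env : seq nat) (fr dst : nat) : cmd :=
  match t with
  | TNat n => iter n (fun c => Seq c (inc dst)) Skip
  | TVar i => if i < size env then
      Seq (loop (nth 0 env i) (Seq (inc fr) (inc dst))) (loop fr (inc (nth 0 env i)))
      else Skip
  | TAdd t1 t2 => Seq (compile_term t1 env fr dst) (compile_term t2 env fr dst)
  | TSum n t =>
      Seq (compile_term n env fr.+1 fr)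
     (Seq (loop fr (Seq (compile_term t (fr.+1 :: env) fr.+2 dst) (inc fr.+1)))
          (clear fr.+1))
  | TDwn n t0 t =>
      Seq (compile_term t0 env fr.+1 fr) (Seq (compile_term n env fr.+2 fr.+1)
     (Seq (loop fr.+1
             (Seq (compile_term t [:: fr.+2, fr & env] fr.+4 fr.+3)
             (Seq (loop fr.+3 (dec fr)) (inc fr.+2))))
     (Seq (clear fr.+2) (loop fr (inc dst)))))
  | TSym a t =>
      Seq (compile_term t env fr.+1 fr)
     (Seq (loop fr (Seq (Prim (InR A)) (inc fr.+1)))
     (Seq (If (Inp (fun b => b == Some a)) (inc dst))
          (loop fr.+1 (Prim (InL A)))))
  | TLen =>
      Seq (While (Inp isSome) (Seq (Prim (InR A)) (Seq (inc dst) (inc fr))))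
          (loop fr (Prim (InL A)))
  | TLet t1 t2 =>
      Seq (compile_term t1 env fr.+1 fr) (Seq (compile_term t2 (fr :: env) fr.+1 dst)
        (clear fr))
  | TSh t => compile_term t (behead env) fr dst
  end.

Fixpoint compile_gen (g : gen) (env : seq nat) (fr : nat) : cmd :=
  match g with
  | GEmit a => Prim (Out a)
  | GSeq g1 g2 => Seq (compile_gen g1 env fr) (compile_gen g2 env fr)
  | GFor n g =>
      Seq (compile_term n env fr.+1 fr)
     (Seq (loop fr (Seq (compile_gen g (fr.+1 :: env) fr.+2) (inc fr.+1)))
          (clear fr.+1))
  | GSh g => compile_gen g (behead env) fr
  end.

(** * Correctness and running time of the compiled terms *)

Section Correct.
Variable x : seq A.
Notation run := (runs x).

Lemma run_le c T T' s s' : T <= T' -> run c T s s' -> run c T' s s'.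
Proof. by move=> H [t Ht He]; exists t => //; exact: leq_trans H. Qed.

Lemma run_eq c T s s1 s2 : run c T s s1 -> s1 = s2 -> run c T s s2.
Proof. by move=> H <-. Qed.

Lemma run_skip s : run Skip 0 s s.
Proof. by exists 0 => //; exact: ESkip. Qed.

Lemma run_seq c1 c2 T1 T2 s s1 s2 : run c1 T1 s s1 -> run c2 T2 s1 s2 ->
  run (Seq c1 c2) (T1 + T2) s s2.
Proof. by move=> [t1 H1 E1] [t2 H2 E2]; exists (t1 + t2);
  [exact: leq_add|exact: ESeq E1 E2]. Qed.

Lemma run_prim p s s' : pdef p s -> psem p s = s' -> run (Prim p) 1 s s'.
Proof. by move=> H <-; exists 1 => //; exact: EPrim. Qed.

Lemma run_while0 b c s : ~~ tsem x b s -> run (While b c) 1 s s.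
Proof. by move=> H; exists 1 => //; exact: EWhileF. Qed.

Lemma run_whileS b c T1 T2 s s1 s2 : tsem x b s -> run c T1 s s1 ->
  run (While b c) T2 s1 s2 -> run (While b c) (T1 + T2 + 2) s s2.
Proof.
move=> H [t1 H1 E1] [t2 H2 E2]; exists (t1 + t2).+2; first lia.
exact: EWhileT E1 E2.
Qed.

Lemma run_while b c (S : nat -> st A) n T :
  (forall i, i < n -> tsem x b (S i)) -> ~~ tsem x b (S n) ->
  (forall i, i < n -> run c T (S i) (S i.+1)) ->
  run (While b c) (n * (T + 2) + 1) (S 0) (S n).
Proof.
elim: n S => [|n IH] S H1 H2 H3; first exact: run_while0.
have -> : n.+1 * (T + 2) + 1 = T + (n * (T + 2) + 1) + 2 by lia.
apply: run_whileS (H1 0 _) (H3 0 _) _ => //.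
by apply: (IH (fun i => S i.+1)) => // i Hi; [apply: H1|apply: H3].
Qed.

(** The loop invariant is the family [S] of states after each number of rounds. The 3 extra steps of
    a round are the decrement, the test and the jump back. *)
Lemma run_loop r c (S : nat -> st A) n T :
  (forall i, i <= n -> rg (S i) r = n - i) ->
  (forall i, i < n -> run c T (psem (Dec A r) (S i)) (S i.+1)) ->
  run (loop r c) (n * (T + 3) + 1) (S 0) (S n).
Proof.
move=> H1 H2; have -> : T + 3 = 1 + T + 2 by lia.
apply: run_while => [i Hi||i Hi] /=.
- by rewrite H1 ?subn_gt0 // ltnW.
- by rewrite H1 // subnn.
- by apply: run_seq (H2 i Hi); exact: run_prim.
Qed.

Definition addr (f : nat -> nat) r v := fun q => if q == r then f q + v else f q.

End Correct.

(** Bounds are pure powers of [W]: from 2 on, constants and the factor 2 of a sum are absorbed by a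
    larger exponent. *)
Definition pb (f : nat -> nat) := exists c, forall W, 1 < W -> f W <= W ^ c.

Lemma pbC n : pb (fun=> n).
Proof. by exists n => W HW; apply: ltnW; exact: ltn_expl. Qed.

Lemma pbW : pb id.
Proof. by exists 1 => W _; rewrite expn1. Qed.

Lemma pbM f g : pb f -> pb g -> pb (fun W => f W * g W).
Proof.
by move=> [a Ha] [b Hb]; exists (a + b) => W HW; rewrite expnD leq_mul ?Ha ?Hb.
Qed.

Lemma pbD f g : pb f -> pb g -> pb (fun W => f W + g W).
Proof.
move=> [a Ha] [b Hb]; exists (a + b).+1 => W HW.
have W0 : 0 < W by exact: ltnW.
apply: (@leq_trans (2 * W ^ (a + b))); last by rewrite expnS leq_mul2r HW orbT.
rewrite mul2n -addnn leq_add //.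
  by apply: leq_trans (Ha W HW) _; rewrite leq_pexp2l // leq_addr.
by apply: leq_trans (Hb W HW) _; rewrite leq_pexp2l // leq_addl.
Qed.

Lemma pbX f n : pb f -> pb (fun W => f W ^ n).
Proof. by move=> [a Ha]; exists (a * n) => W HW; rewrite expnM; case: n => // n;
  rewrite leq_exp2r // Ha. Qed.

(** The destination lies outside [env] because it grows while variables are still to be read, and
    below [fr] so that scratch work cannot touch it. *)
Record fits (W : nat) (env : seq nat) (fr dst : nat) (f : nat -> nat) : Prop := Fits {
  f_gt1 : 1 < W;
  f_env : forall r, r \in env -> r < fr;
  f_val : forall r, r \in env -> f r <= W;
  f_dst : dst < fr;
  f_neq : dst \notin env;
  f_free : forall r, fr <= r -> f r = 0
}.

Definition vals (f : nat -> nat) env : seq nat := [seq f r | r <- env].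

(** One exponent, independent of the input and the registers, bounds both value and time. The value
    matters because an enclosing term may use it as a number of rounds or bind it to a variable. *)
Definition ok t := exists c, forall x env fr dst f o W,
  size x <= W -> fits W env fr dst f ->
  ev x t (vals f env) <= W ^ c /\
  runs x (compile_term t env fr dst) (W ^ c) (St f 0 o)
       (St (addr f dst (ev x t (vals f env))) 0 o).

Ltac regs := let q := fresh "q" in
  congr St; apply: functional_extensionality => q; rewrite /upd /addr /=;
  repeat (case: eqVneq => ? /=); try subst q; try lia.

Lemma vals_ext f g env : (forall r, r \in env -> f r = g r) -> vals f env = vals g env.
Proof. by move=> H; apply/eq_in_map. Qed.

Lemma ok_nat n : ok (TNat n).
Proof.
have [c Hc] := pbC n; exists c => x env fr dst f o W _ [W1 _ _ Hd _ _] /=.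
split; first exact: Hc.
suff: runs x (compile_term (TNat n) env fr dst) n (St f 0 o) (St (addr f dst n) 0 o).
  by apply: run_le; exact: Hc.
elim: n {c Hc} => [|n IH] /=.
  suff -> : addr f dst 0 = f by exact: run_skip.
  by apply: functional_extensionality => q; rewrite /addr addn0; case: ifP.
rewrite -addn1; apply: run_seq IH _; apply: run_prim => //=.
by regs.
Qed.

(** Reading a counter destroys it, so the value is moved to both [dst] and the scratch register
    [fr], and then back from [fr]. *)
Lemma ok_var i : ok (TVar i).
Proof.
have [c Hc] : pb (fun W => W + ((W * (2 + 3) + 1) + (W * (1 + 3) + 1))).
  by repeat (apply: pbD || apply: pbM || apply: pbW || apply: pbC).
exists c => x env fr dst f o W _ [W1 He Hv Hd Hn Hf] /=.
case: ltnP => Hi; last first.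
  rewrite nth_default ?size_map //; split=> //.
  apply: run_le (leq0n _) _.
  suff -> : addr f dst 0 = f by exact: run_skip.
  by apply: functional_extensionality => q; rewrite /addr addn0; case: ifP.
rewrite (nth_map 0) //; set r := nth 0 env i.
have Hr : r \in env by exact: mem_nth.
have Hfr := He _ Hr; have HW := Hv _ Hr; have F0 := Hf _ (leqnn fr).
have Nd : r != dst by apply: contraNneq Hn => <-.
split; first by apply: leq_trans (Hc _ W1); lia.
apply: run_le (leq_trans _ (Hc _ W1)) _; first exact: leq_addl.
apply: (run_seq (s1 := 
   St (fun q => if q == r then 0 else if q == fr then f r
                 else if q == dst then f q + f r else f q) 0 o)).
  apply: (run_le (T := f r * (2 + 3) + 1)); first by rewrite leq_add2r leq_mul2r HW
    orbT.
  pose S i := St (fun q => if q == r then f r - i else if q == fr then i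
                 else if q == dst then f q + i else f q) 0 o.
  have -> : St f 0 o = S 0 by rewrite /S; regs.
  have -> : St (fun q => if q == r then 0 else if q == fr then f r
                 else if q == dst then f q + f r else f q) 0 o = S (f r).
    by rewrite /S subnn.
  apply: run_loop => j Hj /=; first by rewrite eqxx.
  rewrite -[2]/(1 + 1); apply: run_seq; apply: run_prim => //=.
  by rewrite /S; regs.
apply: (run_le (T := f r * (1 + 3) + 1)); first by rewrite leq_add2r leq_mul2r HW orbT.
pose S i := St (fun q => if q == r then i else if q == fr then f r - i
                 else if q == dst then f q + f r else f q) 0 o.
have -> : St (fun q => if q == r then 0 else if q == fr then f r
                 else if q == dst then f q + f r else f q) 0 o = S 0.
  by rewrite /S subn0.
have -> : St (addr f dst (f r)) 0 o = S (f r) by rewrite /S; regs.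
apply: run_loop => j Hj /=.
  by rewrite eqxx; case: eqVneq => // E; lia.
by apply: run_prim => //=; rewrite /S; regs.
Qed.

(** A newly bound variable is bounded by a power of [W], not by [W]; the body of a binder is
    analysed with such a power as its bound. *)
Lemma fits_pow W n env fr dst f : fits W env fr dst f -> fits (W ^ n.+1) env fr dst f.
Proof.
case=> W1 He Hv Hd Hn Hf.
have H : W <= W ^ n.+1 by rewrite -{1}[W]expn1 leq_pexp2l // ltnW.
split=> // [|r Hr]; first exact: leq_trans H.
exact: leq_trans (Hv _ Hr) H.
Qed.

Lemma ok_add t1 t2 : ok t1 -> ok t2 -> ok (TAdd t1 t2).
Proof.
move=> [c1 H1] [c2 H2].
have [c Hc] : pb (fun W => W ^ c1 + W ^ c2).
  by repeat (apply: pbD || apply: pbX || apply: pbW || apply: pbC).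
exists c => x env fr dst f o W Hx Hfit /=; have W1 := f_gt1 Hfit.
have [V1 R1] := H1 x env fr dst f o W Hx Hfit.
have Hfit2 : fits W env fr dst (addr f dst (ev x t1 (vals f env))).
  case: Hfit => _ He Hv Hd Hn Hf; split=> // r Hr; rewrite /addr.
    by rewrite ifN ?Hv //; apply: contraNneq Hn => <-.
  by rewrite ifN ?Hf //; apply/eqP => E; lia.
have E : vals (addr f dst (ev x t1 (vals f env))) env = vals f env.
  apply: vals_ext => r Hr; rewrite /addr ifN //.
  by apply: contraNneq (f_neq Hfit) => <-.
have [V2 R2] := H2 x env fr dst _ o W Hx Hfit2; rewrite E in V2 R2.
split; first by apply: leq_trans (Hc _ W1); exact: leq_add.
apply: run_le (Hc _ W1) _; apply: run_seq R1 _.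
apply: run_eq R2 _; regs.
Qed.

Lemma fits_new W env fr dst f k : fits W env fr dst f ->
  fits W env (fr + k).+1 (fr + k) f.
Proof.
case=> W1 He Hv Hd Hn Hf; split=> // [r /He||r Hr]; try lia.
  by apply/negP => /He; lia.
by apply: Hf; lia.
Qed.

Lemma run_clear x r n f o : f r = n ->
  runs x (clear r) (n * 3 + 1) (St f 0 o) (St (upd f r 0) 0 o).
Proof.
move=> E; pose S i := St (upd f r (n - i)) 0 o.
have E0 : St f 0 o = S 0 by rewrite /S; regs.
have E1 : St (upd f r 0) 0 o = S n by rewrite /S subnn.
rewrite E0 E1; apply: (run_loop (T := 0)) => i Hi; first by rewrite /S /upd /= eqxx.
by apply: run_eq (run_skip _ _) _; rewrite /S /=; regs.
Qed.

Ltac pbs := repeat (apply: pbD || apply: pbM || apply: pbX || apply: pbW || apply: pbC).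

Lemma fits_mem W env fr dst f r : fits W env fr dst f -> r \in env ->
  [/\ r < fr, r != dst & f r <= W].
Proof.
by case=> _ He Hv _ Hn _ Hr; split; [exact: He| |exact: Hv]; apply: contraNneq Hn => <-.
Qed.

Lemma ok_sum n t : ok n -> ok t -> ok (TSum n t).
Proof.
move=> [cn Hn] [ct Ht].
have [c Hc] : pb (fun W => W ^ cn * (W ^ cn.+1) ^ ct +
    (W ^ cn + ((W ^ cn * (((W ^ cn.+1) ^ ct + 1) + 3) + 1) + (W ^ cn * 3 + 1)))) by pbs.
exists c => x env fr dst f o W Hx Hfit /=; have W1 := f_gt1 Hfit.
have Hfit1 := fits_new 0 Hfit; rewrite addn0 in Hfit1.
have [] := Hn x env fr.+1 fr f o W Hx Hfit1.
set N := ev x n (vals f env) => VN RN.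
have F0 : f fr = 0 by apply: (f_free Hfit).
have F1 : f fr.+1 = 0 by apply: (f_free Hfit).
have Hd := f_dst Hfit.
pose v j := ev x t (j :: vals f env).
(* Register [fr] holds the remaining rounds and [fr.+1] the index; [dst] has received the first [i]
   summands. *)
pose S i := St (fun q => if q == fr then N - i else if q == fr.+1 then i
   else if q == dst then f q + \sum_(j < i) v j else f q) 0 o.
have Hstep i : i < N -> v i <= (W ^ cn.+1) ^ ct /\
    runs x (Seq (compile_term t (fr.+1 :: env) fr.+2 dst) (inc fr.+1)) ((W ^ cn.+1) ^
      ct + 1)
      (psem (Dec A fr) (S i)) (S i.+1).
  move=> Hi; set s := psem _ _; pose g := rg s.
  have Hg r : r \in env -> g r = f r.
    by move=> Hr; have [H1 H2 _] := fits_mem Hfit Hr; rewrite /g /= /upd !ifN //; lia.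
  have gE : g fr.+1 = i.
    by rewrite /g /= /upd [fr.+1 == fr]eqn_leq ltnn !eqxx.
  have Hfg : fits (W ^ cn.+1) (fr.+1 :: env) fr.+2 dst g.
    have [W1' He Hv _ Hnd Hf] := fits_pow cn Hfit.
    split=> // [r|r||| r Hr].
    - by rewrite inE => /orP[/eqP ->|/He]; lia.
    - rewrite inE => /orP[/eqP ->|Hr]; last by rewrite Hg // Hv.
      by rewrite gE; apply: ltnW; apply: leq_trans Hi (leq_trans VN _);
        rewrite leq_pexp2l // ltnW.
    - lia.
    - by rewrite inE negb_or Hnd andbT; lia.
    - by rewrite /g /= /upd !ifN ?Hf //; lia.
  have E : vals g (fr.+1 :: env) = i :: vals f env.
    by rewrite /= (vals_ext Hg) gE.
  have Hx' : size x <= W ^ cn.+1.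
    by apply: leq_trans Hx _; rewrite -{1}[W]expn1 leq_pexp2l // ltnW.
  have [] := Ht x _ _ _ _ o _ Hx' Hfg; rewrite E -/(v i) => HV HR; split=> //.
  apply: run_seq HR _; apply: run_prim => //=.
  by rewrite /S big_ord_recr /g /=; regs.
have Hsum : \sum_(j < N) v j <= W ^ cn * (W ^ cn.+1) ^ ct.
  apply: (@leq_trans (\sum_(j < N) (W ^ cn.+1) ^ ct)).
    by apply: leq_sum => j _; have [] := Hstep j (ltn_ord j).
  by rewrite sum_nat_const card_ord leq_mul2r VN orbT.
split; first by apply: leq_trans (Hc _ W1); apply: leq_trans Hsum (leq_addr _ _).
apply: run_le (leq_trans (leq_addl _ _) (Hc _ W1)) _.
apply: run_seq RN _.
have E0 : St (addr f fr N) 0 o = S 0 by rewrite /S big_ord0; regs.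
rewrite E0; apply: (run_seq (s1 := S N)).
  apply: (run_le (T := N * (((W ^ cn.+1) ^ ct + 1) + 3) + 1)).
    by rewrite leq_add2r leq_mul2r VN orbT.
  apply: run_loop => i Hi; first by rewrite /S /= eqxx.
  by have [] := Hstep i Hi.
apply: (run_le (T := N * 3 + 1)); first by rewrite leq_add2r leq_mul2r VN orbT.
apply: run_eq (run_clear _ _ _) _.
  by rewrite ifN ?eqxx //; lia.
rewrite subnn -[\sum_(i < N) ev x t _]/(\sum_(i < N) v i); regs.
Qed.

Lemma pow_gt1 W a : 1 < W -> W <= W ^ a.+1.
Proof. by move=> H; rewrite -{1}[W]expn1 leq_pexp2l // ltnW. Qed.

Lemma ok_let t1 t2 : ok t1 -> ok t2 -> ok (TLet t1 t2).
Proof.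
move=> [c1 H1] [c2 H2].
have [c Hc] : pb (fun W => W ^ c1 + ((W ^ c1.+1) ^ c2 + (W ^ c1 * 3 + 1))) by pbs.
exists c => x env fr dst f o W Hx Hfit /=; have W1 := f_gt1 Hfit.
have Hfit1 := fits_new 0 Hfit; rewrite addn0 in Hfit1.
have [] := H1 x env fr.+1 fr f o W Hx Hfit1.
set N := ev x t1 (vals f env) => VN RN.
have F0 : f fr = 0 by apply: (f_free Hfit).
have Hd := f_dst Hfit.
pose g := addr f fr N.
have gE : g fr = N by rewrite /g /addr eqxx F0.
have Hg r : r \in env -> g r = f r.
  by move=> Hr; have [Hr1 Hr2 _] := fits_mem Hfit Hr; rewrite /g /addr ifN //; lia.
have Hfg : fits (W ^ c1.+1) (fr :: env) fr.+1 dst g.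
  have [W1' He Hv _ Hnd Hf] := fits_pow c1 Hfit.
  split=> // [r|r||| r Hr].
  - by rewrite inE => /orP[/eqP ->|/He]; lia.
  - rewrite inE => /orP[/eqP ->|Hr]; last by rewrite Hg // Hv.
    by rewrite gE; apply: leq_trans VN _; rewrite leq_pexp2l // ltnW.
  - lia.
  - by rewrite inE negb_or Hnd andbT; lia.
  - by rewrite /g /addr ifN ?Hf //; lia.
have E : vals g (fr :: env) = N :: vals f env by rewrite /= (vals_ext Hg) gE.
have [] := H2 x _ _ _ _ o _ (leq_trans Hx (pow_gt1 c1 W1)) Hfg; rewrite E.
set N2 := ev _ _ _ => HV HR.
split; first by apply: leq_trans (Hc _ W1); apply: leq_trans HV _; lia.
apply: run_le (Hc _ W1) _; apply: run_seq RN _; apply: run_seq HR _.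
apply: (run_le (T := N * 3 + 1)); first by rewrite leq_add2r leq_mul2r VN orbT.
apply: run_eq (run_clear _ _ _) _.
  by rewrite /addr ifN ?gE //; lia.
rewrite /g; regs.
Qed.

Lemma ok_sh t : ok t -> ok (TSh t).
Proof.
move=> [c H]; exists c => x env fr dst f o W Hx Hfit /=.
have -> : behead (vals f env) = vals f (behead env) by case: env {Hfit}.
apply: H => //; case: Hfit => W1 He Hv Hd Hn Hf.
have Hb r : r \in behead env -> r \in env by exact: mem_behead.
split=> // [r /Hb|r /Hb|]; [exact: He|exact: Hv|].
by apply: contra Hn; exact: Hb.
Qed.

Lemma ok_len : ok TLen.
Proof.
have [c Hc] : pb (fun W => W + ((W * ((1 + (1 + 1)) + 2) + 1) + (W * (1 + 3) + 1))) by
  pbs.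
exists c => x env fr dst f o W Hx Hfit /=; have W1 := f_gt1 Hfit.
have F0 : f fr = 0 by apply: (f_free Hfit).
have Hd := f_dst Hfit.
split; first by apply: leq_trans (Hc _ W1); lia.
apply: run_le (leq_trans (leq_addl _ _) (Hc _ W1)) _.
pose S i := St (fun q => if q == fr then i else if q == dst then f q + i else f q) i o.
apply: (run_seq (s1 := S (size x))).
  apply: (run_le (T := size x * ((1 + (1 + 1)) + 2) + 1)).
    by rewrite leq_add2r leq_mul2r Hx orbT.
  have -> : St f 0 o = S 0 by rewrite /S; regs.
  apply: run_while => [i Hi||i Hi] /=.
  - by rewrite onthTE.
  - by rewrite onthTE ltnn.
    apply: run_seq; first by apply: run_prim.
    apply: run_seq; first by apply: run_prim.
    apply: run_prim => //=.
    by rewrite /S; regs.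
apply: (run_le (T := size x * (1 + 3) + 1)); first by rewrite leq_add2r leq_mul2r Hx
  orbT.
pose S' i := St (fun q => if q == fr then size x - i else if q == dst then f q + size x
  else f q) (size x - i) o.
have -> : S (size x) = S' 0 by rewrite /S /S' subn0.
have -> : St (addr f dst (size x)) 0 o = S' (size x) by rewrite /S' subnn; regs.
apply: run_loop => j Hj /=; first by rewrite eqxx.
apply: run_prim; rewrite /= ?subn_gt0 //.
have -> : (size x - j).-1 = size x - j.+1 by lia.
by rewrite /S'; regs.
Qed.

(** While the head walks [N] cells, [N] is copied to [fr.+1] for the way back. *)
Lemma ok_sym a t : ok t -> ok (TSym a t).
Proof.
move=> [c1 H1].
have [c Hc] : pb (fun W => 1 + (W ^ c1 + ((W ^ c1 * ((1 + 1) + 3) + 1) + ((1 + 1) + (W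
  ^ c1 * (1 + 3) + 1))))) by pbs.
exists c => x env fr dst f o W Hx Hfit /=; have W1 := f_gt1 Hfit.
have Hfit1 := fits_new 0 Hfit; rewrite addn0 in Hfit1.
have [] := H1 x env fr.+1 fr f o W Hx Hfit1.
set N := ev x t (vals f env) => VN RN.
have F0 : f fr = 0 by apply: (f_free Hfit).
have F1 : f fr.+1 = 0 by apply: (f_free Hfit).
have Hd := f_dst Hfit.
split; first by apply: leq_trans (Hc _ W1); case: eqP.
apply: run_le (leq_trans (leq_addl _ _) (Hc _ W1)) _.
apply: run_seq RN _.
pose S i := St (fun q => if q == fr then N - i else if q == fr.+1 then i else f q) i o.
apply: (run_seq (s1 := S N)).
  apply: (run_le (T := N * ((1 + 1) + 3) + 1));
    first by rewrite leq_add2r leq_mul2r VN orbT.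
  have -> : St (addr f fr N) 0 o = S 0 by rewrite /S; regs.
  apply: run_loop => i Hi /=; first by rewrite eqxx.
  apply: run_seq; first by apply: run_prim.
    apply: run_prim => //=.
  by rewrite /S; regs.
set b := onth x N == Some a.
pose S' i := St (fun q => if q == fr.+1 then N - i else addr f dst b q) (N - i) o.
apply: (run_seq (s1 := S' 0)).
  rewrite /S' subn0; case Eb: b.
    have [t1 Ht1 R1] : runs x (inc dst) 1 (S N)
        (St (fun q => if q == fr.+1 then N else addr f dst true q) N o).
      by apply: run_prim => //=; rewrite /S; regs.
    by exists t1.+1 => //; apply: EIfT R1; exact: Eb.
  exists 1 => //; rewrite (_ : St _ N o = S N); last by rewrite /S; regs.
  by apply: EIfF; rewrite /= -/b Eb.
apply: (run_le (T := N * (1 + 3) + 1)); first by rewrite leq_add2r leq_mul2r VN orbT.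
have -> : St (addr f dst b) 0 o = S' N by rewrite /S' subnn; regs.
apply: run_loop => j Hj /=; first by rewrite eqxx.
apply: run_prim; rewrite /= ?subn_gt0 //.
have -> : (N - j).-1 = N - j.+1 by lia.
by rewrite /S'; regs.
Qed.

Lemma fits_addr W env fr dst f d v : fits W env fr dst f -> d < fr -> d \notin env ->
  fits W env fr dst (addr f d v).
Proof.
case=> W1 He Hv Hd Hn Hf H1 H2; split=> // r Hr; rewrite /addr.
  by rewrite ifN ?Hv //; apply: contraNneq H2 => <-.
by rewrite ifN ?Hf //; apply/eqP => E; lia.
Qed.

Lemma vals_addr f env d v : d \notin env -> vals (addr f d v) env = vals f env.
Proof.
by move=> H; apply: vals_ext => r Hr; rewrite /addr ifN //; apply: contraNneq H => <-.
Qed.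

Lemma run_sub x r d f o T : r != d -> f r <= T ->
  runs x (loop r (dec d)) (T * (1 + 3) + 1) (St f 0 o)
    (St (upd (upd f d (f d - f r)) r 0) 0 o).
Proof.
move=> Hrd HT; apply: (run_le (T := f r * (1 + 3) + 1));
  first by rewrite leq_add2r leq_mul2r HT orbT.
pose S i := St (upd (upd f d (f d - i)) r (f r - i)) 0 o.
have -> : St f 0 o = S 0 by rewrite /S; regs.
rewrite (_ : St (upd _ r 0) 0 o = S (f r)); last by rewrite /S subnn.
apply: run_loop => i Hi /=; first by rewrite /upd eqxx.
by apply: run_prim => //=; rewrite /S; regs.
Qed.

Lemma run_mv x r d f o T : r != d -> f r <= T ->
  runs x (loop r (inc d)) (T * (1 + 3) + 1) (St f 0 o)
    (St (upd (addr f d (f r)) r 0) 0 o).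
Proof.
move=> Hrd HT; apply: (run_le (T := f r * (1 + 3) + 1));
  first by rewrite leq_add2r leq_mul2r HT orbT.
pose S i := St (upd (addr f d i) r (f r - i)) 0 o.
have -> : St f 0 o = S 0 by rewrite /S; regs.
rewrite (_ : St (upd _ r 0) 0 o = S (f r)); last by rewrite /S subnn.
apply: run_loop => i Hi /=; first by rewrite /upd eqxx.
by apply: run_prim => //=; rewrite /S; regs.
Qed.

(** The accumulator starts at [N0] and only decreases, so all intermediate values are at most [N0];
    with arbitrary step functions an iteration could grow exponentially. *)
Lemma ok_dwn n t0 t : ok n -> ok t0 -> ok t -> ok (TDwn n t0 t).
Proof.
move=> [cn Hn] [c0 H0] [ct Ht].
(* [W ^ cw] bounds the index, the accumulator and [W] at once. *)
pose cw := (cn + c0).+1.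
have [c Hc] : pb (fun W => W ^ c0 + (W ^ c0 + (W ^ cn + ((W ^ cn *
    (((W ^ cw) ^ ct + (((W ^ cw) ^ ct * (1 + 3) + 1) + 1)) + 3) + 1) +
    ((W ^ cn * 3 + 1) + (W ^ c0 * (1 + 3) + 1)))))) by pbs.
exists c => x env fr dst f o W Hx Hfit /=; have W1 := f_gt1 Hfit.
have Hfit0 := fits_new 0 Hfit; rewrite addn0 in Hfit0.
have [] := H0 x env fr.+1 fr f o W Hx Hfit0.
set N0 := ev x t0 (vals f env) => VN0 RN0.
have Henv r : r \in env -> r < fr by exact: (f_env Hfit).
have Fr : fr \notin env by apply/negP => /Henv; lia.
have L1 : fr < (fr + 1).+1 by lia.
have Hfit1 := fits_addr N0 (fits_new 1 Hfit) L1 Fr.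
rewrite addn1 in Hfit1.
have [] := Hn x env fr.+2 fr.+1 _ o W Hx Hfit1; rewrite (vals_addr _ _ Fr).
set N := ev x n (vals f env) => VN RN.
have FF k : f (fr + k) = 0 by apply: (f_free Hfit); lia.
have := (FF 0, FF 1, FF 2, FF 3); rewrite addn0 addn1 addn2 addn3 => -[[[F0 F1] F2] F3].
have Hd := f_dst Hfit.
pose step i a := a - ev x t [:: i, a & vals f env].
pose a i := iteri i step N0.
have Ha i : a i <= N0.
  by elim: i => //= i IH; apply: leq_trans (leq_subr _ _) IH.
have Wcn : W ^ cn <= W ^ cw by rewrite leq_pexp2l /cw; lia.
have Wc0 : W ^ c0 <= W ^ cw by rewrite leq_pexp2l /cw; lia.
pose S i := St (fun q => if q == fr then a i else if q == fr.+1 then N - i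
   else if q == fr.+2 then i else f q) 0 o.
have Hstep i : i < N ->
    runs x (Seq (compile_term t [:: fr.+2, fr & env] fr.+4 fr.+3)
       (Seq (loop fr.+3 (dec fr)) (inc fr.+2)))
      ((W ^ cw) ^ ct + (((W ^ cw) ^ ct * (1 + 3) + 1) + 1))
      (psem (Dec A fr.+1) (S i)) (S i.+1).
  move=> Hi; set s := psem _ _; pose g := rg s.
  have gE : g = (fun q => if q == fr then a i else if q == fr.+1 then N - i.+1
   else if q == fr.+2 then i else f q).
    apply: functional_extensionality => q; rewrite /g /s /= /upd.
    by repeat (case: eqVneq => ? /=); try lia.
  have g0 : g fr = a i by rewrite gE eqxx.
  have g2 : g fr.+2 = i by rewrite gE; repeat (case: eqVneq => ? /=); lia.
  have gN q : q != fr -> q != fr.+1 -> q != fr.+2 -> g q = f q.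
    by move=> Q1 Q2 Q3; rewrite gE !ifN.
  have g3 : g fr.+3 = 0 by rewrite gN ?F3 //; lia.
  have Hg r : r \in env -> g r = f r by move=> /Henv Hr; rewrite gN //; lia.
  have Hfg : fits (W ^ cw) [:: fr.+2, fr & env] fr.+4 fr.+3 g.
    have [W1' He Hv _ Hnd Hf] := fits_pow (cn + c0) Hfit.
    split=> // [r|r|| r Hr].
    - by rewrite !inE => /or3P[/eqP ->|/eqP ->|/He]; lia.
    - rewrite !inE => /or3P[/eqP ->|/eqP ->|Hr]; last by rewrite Hg // Hv.
        by rewrite g2; apply: ltnW; apply: leq_trans Hi (leq_trans VN _).
      by rewrite g0; apply: leq_trans (Ha i) (leq_trans VN0 _).
    - by rewrite !inE !negb_or; apply/and3P; split; [lia|lia|apply/negP => /Henv; lia].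
    - by rewrite gN ?Hf //; lia.
  have E : vals g [:: fr.+2, fr & env] = [:: i, a i & vals f env].
    by rewrite /= (vals_ext Hg) g0 g2.
  have [] := Ht x _ _ _ _ o _ (leq_trans Hx (pow_gt1 (cn + c0) W1)) Hfg; rewrite E.
  set d := ev x t _ => HV HR.
  apply: run_seq HR _.
  have Dd : addr g fr.+3 d fr.+3 = d by rewrite /addr eqxx g3.
  apply: run_seq; first by apply: run_sub; [lia|rewrite Dd].
  have Df : addr g fr.+3 d fr = a i by rewrite /addr ifN ?g0 //; lia.
  apply: run_prim => //=; rewrite Dd Df; congr St;
    apply: functional_extensionality => q.
  rewrite /S /= -/(a i) /step -/d /upd /addr gE.
  by repeat (case: eqVneq => ? /=); try subst q; lia.
split; first by apply: leq_trans (Hc _ W1); apply: leq_trans (Ha N) (leq_trans VN0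
  (leq_addr _ _)).
apply: run_le (leq_trans (leq_addl _ _) (Hc _ W1)) _.
apply: run_seq RN0 _; apply: run_seq RN _.
have E0 : St (addr (addr f fr N0) fr.+1 N) 0 o = S 0 by rewrite /S /a /=; regs.
rewrite E0; apply: (run_seq (s1 := S N)).
  apply: run_le; last first.
    apply: (run_loop (n := N)) => [i Hi|i Hi]; last exact: Hstep Hi.
    by rewrite /S /= ifN ?eqxx //; lia.
  by rewrite leq_add2r leq_mul2r VN orbT.
have SN : S N = St (fun q => if q == fr then a N else if q == fr.+1 then 0
   else if q == fr.+2 then N else f q) 0 o by rewrite /S subnn.
rewrite SN; apply: run_seq.
  apply: (run_le (T := N * 3 + 1)); first by rewrite leq_add2r leq_mul2r VN orbT.
  by apply: run_clear; repeat (case: eqVneq => ? /=); lia.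
set g := upd _ _ _.
have g0 : g fr = a N by rewrite /g /upd; repeat (case: eqVneq => ? /=); lia.
apply: run_eq; first apply: (run_mv _ _ (T := W ^ c0)); first lia.
  by rewrite g0; exact: leq_trans (Ha N) VN0.
rewrite g0 /g -/(a N); congr St; apply: functional_extensionality => q.
rewrite /upd /addr -/step -/(a N).
by repeat (case: eqVneq => ? /=); try subst q; lia.
Qed.

Lemma compile_term_ok t : ok t.
Proof.
elim: t => [n|i|t1 H1 t2 H2|n Hn t H|n Hn t0 H0 t H|a t H||t1 H1 t2 H2|t H].
- exact: ok_nat.
- exact: ok_var.
- exact: ok_add.
- exact: ok_sum.
- exact: ok_dwn.
- exact: ok_sym.
- exact: ok_len.
- exact: ok_let.
- exact: ok_sh.
Qed.

Lemma compile_gen_ok g : exists c, forall x env fr dst f o W,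
  size x <= W -> fits W env fr dst f ->
  runs x (compile_gen g env fr) (W ^ c) (St f 0 o) (St f 0 (o ++ gev x g (vals f env))).
Proof.
elim: g => [a|g1 [c1 H1] g2 [c2 H2]|n g [ct Ht]|g [c H]] /=.
- exists 0 => x env fr dst f o W _ _; apply: run_prim => //=.
  by rewrite cats1.
- have [c Hc] : pb (fun W => W ^ c1 + W ^ c2) by pbs.
  exists c => x env fr dst f o W Hx Hfit; have W1 := f_gt1 Hfit.
  apply: run_le (Hc _ W1) _; apply: run_seq (H1 _ _ _ _ _ _ _ Hx Hfit) _.
  by rewrite catA; exact: H2 Hfit.
- have [cn Hn] := compile_term_ok n.
  have [c Hc] : pb (fun W => W ^ cn + ((W ^ cn * (((W ^ cn.+1) ^ ct + 1) + 3) + 1) + (W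
    ^ cn * 3 + 1))) by pbs.
  exists c => x env fr dst f o W Hx Hfit; have W1 := f_gt1 Hfit.
  have Hfit1 := fits_new 0 Hfit; rewrite addn0 in Hfit1.
  have [] := Hn x env fr.+1 fr f o W Hx Hfit1.
  set N := ev x n (vals f env) => VN RN.
  have F0 : f fr = 0 by apply: (f_free Hfit).
  have F1 : f fr.+1 = 0 by apply: (f_free Hfit).
  have Hd := f_dst Hfit.
  pose v j := gev x g (j :: vals f env).
  pose S i := St (fun q => if q == fr then N - i else if q == fr.+1 then i
     else f q) 0 (o ++ flatten [seq v j | j <- iota 0 i]).
  have Hstep i : i < N ->
      runs x (Seq (compile_gen g (fr.+1 :: env) fr.+2) (inc fr.+1)) ((W ^ cn.+1) ^ ct +
        1)
        (psem (Dec A fr) (S i)) (S i.+1).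
    move=> Hi; set s := psem _ _; pose h := rg s.
    have Hg r : r \in env -> h r = f r.
      by move=> Hr; have [? ? _] := fits_mem Hfit Hr; rewrite /h /= /upd !ifN //; lia.
    have gE : h fr.+1 = i by rewrite /h /= /upd [fr.+1 == fr]eqn_leq ltnn !eqxx.
    have Hfg : fits (W ^ cn.+1) (fr.+1 :: env) fr.+2 dst h.
      have [W1' He Hv _ Hnd Hf] := fits_pow cn Hfit.
      split=> // [r|r||| r Hr].
      - by rewrite inE => /orP[/eqP ->|/He]; lia.
      - rewrite inE => /orP[/eqP ->|Hr]; last by rewrite Hg // Hv.
        by rewrite gE; apply: ltnW; apply: leq_trans Hi (leq_trans VN _);
          rewrite leq_pexp2l // ltnW.
      - lia.
      - by rewrite inE negb_or Hnd andbT; lia.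
      - by rewrite /h /= /upd !ifN ?Hf //; lia.
    have E : vals h (fr.+1 :: env) = i :: vals f env by rewrite /= (vals_ext Hg) gE.
    have := Ht x _ _ _ _ (ou s) _ (leq_trans Hx (pow_gt1 cn W1)) Hfg;
      rewrite E -/(v i) => HR.
    apply: run_seq HR _; apply: run_prim => //=.
    rewrite /S -[i.+1]addn1 iotaD map_cat flatten_cat /= cats0 catA addn1 /h /=.
    by regs.
  apply: run_le (Hc _ W1) _; apply: run_seq RN _.
  have -> : St (addr f fr N) 0 o = S 0 by rewrite /S cats0; regs.
  apply: (run_seq (s1 := S N)).
    apply: (run_le (T := N * (((W ^ cn.+1) ^ ct + 1) + 3) + 1)).
      by rewrite leq_add2r leq_mul2r VN orbT.
    by apply: run_loop => i Hi; [rewrite /S /= eqxx|exact: Hstep].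
  apply: (run_le (T := N * 3 + 1)); first by rewrite leq_add2r leq_mul2r VN orbT.
  apply: run_eq; first by apply: run_clear; rewrite ifN ?eqxx //; lia.
  by rewrite subnn; regs.
- exists c => x env fr dst f o W Hx Hfit.
  have -> : behead (vals f env) = vals f (behead env) by case: env {Hfit}.
  apply: (H _ _ _ dst) => //; case: Hfit => W1 He Hv Hd Hn Hf.
  have Hb r : r \in behead env -> r \in env by exact: mem_behead.
  split=> // [r /Hb|r /Hb|]; [exact: He|exact: Hv|].
  by apply: contra Hn; exact: Hb.
Qed.
End Terms.

Theorem polytime_gen (Sigma : finType) (f : seq Sigma * nat -> seq Sigma * nat)
    (g : gen (option Sigma)) :
  (forall x, gev (encode_pair x) g [::] = encode_pair (f x)) -> polytime f.
Proof.
move=> H; have [c Hc] := compile_gen_ok g.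
apply: (@polytime_of_cmd _ f (compile_gen g [::] 1) c) => x.
(* There are no variables, and register 0 is a dummy destination. *)
have Hf : fits (size (encode_pair x) + 2) [::] 1 0 (fun=> 0) by split=> //; lia.
have := Hc (encode_pair x) [::] 1 0 (fun=> 0) [::] _ (leq_addr 2 _) Hf.
by rewrite cat0s /vals /= H => HR; eexists; [exact: HR|].
Qed.

(** * Scheduling and subset sums *)

Section Schedules.
Variable J : seq job.

(** The job of [P] scheduled last is on time, and all jobs of [P] have been processed by its
    completion; so their total is at most its due date. *)
Lemma on_time_sum (rho : 'S_(size J)) (P : pred 'I_(size J)) d :
  (forall j, P j -> ~~ tardy rho j) -> (forall j, P j -> due (jobs j) <= d) ->
  \sum_(j | P j) ptime (jobs j) <= d.
Proof.
move=> Hon Hd; have [j0 Hj0|H0] := pickP P; last by rewrite big_pred0.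
have [j Hj Hmax] := arg_maxnP (fun j => val (rho j)) Hj0.
apply: leq_trans (Hd j Hj); have := Hon j Hj; rewrite /tardy -leqNgt; apply: leq_trans.
rewrite /completion [X in _ <= X](bigID P) /=.
apply: leq_trans (leq_addr _ _).
by rewrite leq_eqVlt; apply/orP; left; apply/eqP; apply: eq_bigl => i;
case Hi: (P i); rewrite ?andbF //; have := Hmax i Hi; rewrite /= => ->.
Qed.

Lemma tardy_weight_on (rho : 'S_(size J)) :
  tardy_weight rho + \sum_(j | ~~ tardy rho j) weight (jobs j) =
  \sum_(j < size J) weight (jobs j).
Proof. by rewrite [RHS](bigID (tardy rho)). Qed.

(** The jobs of [S] come before all others, in index order: [key] is injective and encodes this
    order, and the position of a job is the number of smaller keys. *)
Lemma ex_schedule (S : pred 'I_(size J)) : exists rho : 'S_(size J),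
  forall i, S i -> completion rho i = \sum_(j | S j && (j <= i)) ptime (jobs j).
Proof.
pose m := size J.
pose key (j : 'I_m) : nat := if S j then nat_of_ord j else m + j.
have key_inj : injective key.
  move=> i j; rewrite /key; have := ltn_ord i; have := ltn_ord j.
  by case: (S i); case: (S j) => H1 H2 E; apply: val_inj => /=; lia.
pose f (j : 'I_m) := #|[set i | key i < key j]|.
have f_lt j : f j < m.
  rewrite -[X in _ < X]card_ord -cardsT; apply: proper_card; apply/properP; split.
    exact: subsetT.
  by exists j; rewrite ?inE ?ltnn.
have f_mono i j : (f i <= f j) = (key i <= key j).
  case: (leqP (key i) (key j)) => H.
    apply: subset_leq_card; apply/subsetP => l; rewrite !inE => Hl; exact: leq_trans H.
  apply/negbTE; rewrite -ltnNge; apply: proper_card; apply/properP; split.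
    by apply/subsetP => l; rewrite !inE => Hl; exact: ltn_trans H.
  by exists j; rewrite ?inE ?ltnn.
pose g j : 'I_m := Ordinal (f_lt j).
have g_inj : injective g.
  move=> i j [E]; apply: key_inj; apply/eqP.
  by rewrite eqn_leq -!f_mono E leqnn.
exists (perm g_inj) => i Hi; rewrite /completion; apply: eq_bigl => j.
rewrite !permE /= f_mono /key Hi; have := ltn_ord i.
by case: (S j) => //=; rewrite /m; lia.
Qed.
End Schedules.

(** * Numbers in base [2 ^ b] and summation by parts *)

Section Numerals.

Lemma sum_blocks (n m : nat) (F : nat -> nat) :
  \sum_(j < n * m) F j = \sum_(i < n) \sum_(a < m) F (i * m + a).
Proof.
elim: n => [|n IH]; first by rewrite mul0n !big_ord0.
rewrite big_ord_recr /= -IH -!(big_mkord xpredT F).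
rewrite mulSn addnC (big_cat_nat _ (leq_addr _ _)) //=; congr addn.
rewrite -{1}[n * m]add0n big_addn addKn big_mkord.
by apply: eq_bigr => i _; rewrite addnC.
Qed.

Variable b : nat.
Let B := 2 ^ b.

Definition num (m : nat) (g : nat -> nat) := \sum_(i < m) g i * B ^ i.

Lemma num_lt m g : (forall i, i < m -> g i < B) -> num m g < B ^ m.
Proof.
elim: m => [|m IH] H; first by rewrite /num big_ord0.
rewrite /num big_ord_recr /= -/(num m g) expnS.
have H1 : num m g < B ^ m by apply: IH => i Hi; apply: H; exact: ltnW.
have H2 := H m (ltnSn m).
apply: (@leq_trans (B ^ m + g m * B ^ m)); first by rewrite ltn_add2r.
by rewrite -mulSn leq_mul2r H2 orbT.
Qed.

Lemma numS m g : num m.+1 g = g 0 + B * num m (fun i => g i.+1).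
Proof.
rewrite /num big_ord_recl /= expn0 muln1 big_distrr /=; congr addn.
by apply: eq_bigr => i _; rewrite /bump /= add1n expnS mulnCA.
Qed.

Lemma B_gt0 : 0 < B. Proof. by rewrite expn_gt0. Qed.

Lemma num_inj m g h : (forall i, i < m -> g i < B) -> (forall i, i < m -> h i < B) ->
  num m g = num m h -> forall i, i < m -> g i = h i.
Proof.
elim: m g h => [//|m IH] g h Hg Hh; rewrite !numS => E.
have E0 : g 0 = h 0.
  have := congr1 (fun x => x %% B) E; rewrite ![B * _]mulnC ![_ + _ * B]addnC !modnMDl
    !modn_small //.
    exact: Hh.
  exact: Hg.
have E1 : num m (fun i => g i.+1) = num m (fun i => h i.+1).
  by move: E; rewrite E0 => /addnI /eqP; rewrite eqn_pmul2l ?B_gt0 // => /eqP.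
case=> [//|i] Hi; apply: (IH (fun i => g i.+1) (fun i => h i.+1)) => // j Hj;
  [exact: Hg|exact: Hh].
Qed.

Lemma num_digit m g p : (forall i, i < m -> g i < B) -> p < m ->
  (num m g %/ B ^ p) %% B = g p.
Proof.
elim: m g p => [//|m IH] g p Hg; rewrite numS; case: p => [_|p Hp].
  by rewrite expn0 divn1 [B * _]mulnC [_ + _ * B]addnC modnMDl modn_small // Hg.
rewrite expnS divnMA [B * _]mulnC [g 0 + _]addnC divnMDl ?B_gt0 // (divn_small (Hg 0
  isT)) addn0.
by apply: IH => // i Hi; exact: Hg.
Qed.

(** As the base is a power of two, bit [r] lies within digit [r %/ b]. This lets a generator with
    small counters print the number bit by bit. *)
Lemma num_bit m g r : 0 < b -> (forall i, i < m -> g i < B) -> r < m * b ->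
  odd (num m g %/ 2 ^ r) = odd (g (r %/ b) %/ 2 ^ (r %% b)).
Proof.
move=> b0 Hg Hr; have Hp : r %/ b < m by rewrite ltn_divLR.
have Hm : r %% b < b by rewrite ltn_mod.
rewrite -(num_digit Hg Hp) {1}(divn_eq r b) expnD [_ * b]mulnC expnM -/B divnMA.
move: (_ %/ B ^ _) => y; move: (r %% b) Hm => s Hs.
(* After the shift, the part of [y] above its last digit is a multiple of [2 ^ (b - s)], which is
   even because [s < b]. *)
rewrite {1}(divn_eq y B) {2}/B -(subnK (ltnW Hs)) expnD mulnA divnMDl ?expn_gt0 //.
by rewrite oddD oddM oddX /= subn_eq0 leqNgt Hs andbF.
Qed.

End Numerals.

Lemma abel_sum n (X : nat -> nat) :
  \sum_(i < n) (n - i) * X i = \sum_(m < n) \sum_(i < m.+1) X i.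
Proof.
elim: n => [|n IH]; first by rewrite !big_ord0.
rewrite [RHS]big_ord_recr /= -IH [in RHS]big_ord_recr /= addnA -big_split /=.
rewrite big_ord_recr /= subSnn mul1n; congr addn; apply: eq_bigr => i _.
by rewrite subSn 1?ltnW // mulSn addnC.
Qed.

(** Both weighted sums are sums of prefix sums. Each prefix sum of [X] is at most that of the
    constant [T], so the reverse inequality between the totals makes all of them equal, and
    differences give [X i]. *)
Lemma abel_tight n (X : nat -> nat) T :
  (forall m, m < n -> \sum_(i < m.+1) X i <= m.+1 * T) ->
  \sum_(i < n) (n - i) * T <= \sum_(i < n) (n - i) * X i ->
  forall i, i < n -> X i = T.
Proof.
move=> Hle; rewrite (abel_sum n (fun=> T)) abel_sum => Htot.
have Hc m : \sum_(i < m) T = m * T by rewrite sum_nat_const card_ord.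
have Heq m : m < n -> \sum_(i < m.+1) X i = m.+1 * T.
  move=> Hm; apply/eqP; rewrite eqn_leq Hle //=.
  have := leqif_sum (fun (m : 'I_n) (_ : true) => leqif_eq (Hle m (ltn_ord m))).
  move=> [H1 H2]; move: Htot.
  rewrite [X in X <= _](eq_bigr (fun m : 'I_n => m.+1 * T)); last by move=> ? _;
    exact: Hc.
  move=> Htot; have : \sum_(i < n) \sum_(j < i.+1) X j == \sum_(i < n) i.+1 * T.
    by rewrite eqn_leq H1.
  by rewrite H2 => /forallP /(_ (Ordinal Hm)) /= /eqP ->.
case=> [|i] Hi; first by have := Heq 0 Hi; rewrite big_ord1 mul1n.
have := Heq i.+1 Hi; rewrite big_ord_recr /= Heq 1?ltnW // [_.+2 * T]mulSn.
lia.
Qed.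

(** * The jobs, and schedules versus satisfying assignments *)

Section Reduction.
Variables (k b n : nat) (pres : nat -> nat -> bool).

Definition nlits := 2 * k.
Definition ntriples := nlits * nlits * nlits.
Definition npos := k + ntriples.
Definition nitems := nlits + 3 * ntriples.

(** For [q < ntriples] these are the three digits of [q] in base [nlits], so that every ordered
    triple of literals, repetitions included, has a number. *)
Definition triple q := [:: q %/ (nlits * nlits); (q %/ nlits) %% nlits; q %% nlits].

(* Item [a < nlits] stands for the literal of variable [a %/ 2] and sign [odd a];
   the others are three slack items for each triple.  Position [p < k] belongs to
   variable [p], and position [k + q] to triple [q]. *)
Definition digit a p : nat :=
  if a < nlits then
    if p < k then nat_of_bool (a %/ 2 == p) else if p < npos then count_mem a (triple
      (p - k)) else 0
  else nat_of_bool (p == k + (a - nlits) %/ 3).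

(** At a variable, exactly one of its two literals is to be chosen. At a triple, the chosen literals
    are completed to 3 by slack items; without the third slack item at least one literal is needed.
    Position [npos] is reserved for the powers [B ^ npos]. *)
Definition target p := if p < k then 1 else if p < npos then 3 else 0.

(* The third slack item of a present clause gets a processing time exceeding its
   due date, so that the clause needs a true literal; weights and due dates do
   not depend on the formulas. *)
Definition disabled i a :=
  [&& nlits <= a, (a - nlits) %% 3 == 2 & pres i ((a - nlits) %/ 3)].

Local Notation num := (num b npos.+1).
Local Notation B := (2 ^ b).

Definition item_job i a :=
  Job (num (if disabled i a then fun p => nat_of_bool (p == npos) else digit a))
      (num (fun p => (n - i) * digit a p))
      (num (fun p => i.+1 * target p)).

(* This job has the largest due date and weight, powers of 2 with known exponent. *)
Definition last_job :=
  Job (num (fun p => nat_of_bool (p == 0))) (num (fun p => nat_of_bool (p == npos)))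
    (num (fun p => nat_of_bool (p == npos))).

Definition job_at j :=
  if j < n * nitems then item_job (j %/ nitems) (j %% nitems) else last_job.

Definition job_list := [seq job_at j | j <- iota 0 (n * nitems).+1].

(** All items of a block together have the digits of [2 * T] ([sum_all_items]), so this is half of
    the total weight of the blocks. *)
Definition threshold := num (fun p => (\sum_(i < n) (n - i)) * target p).

(** Base at least 8 leaves room for the digit sums over all items, which are at most 6; [n_small]
    does the same for single digits multiplied by at most [n]. *)
Hypothesis b_ge3 : 2 < b.
Hypothesis n_small : 3 * n < B.

Lemma B_ge8 : 8 <= B.
Proof. by rewrite -[8]/(2 ^ 3) leq_exp2l. Qed.

Lemma target_le p : target p <= 3.
Proof. by rewrite /target; case: ifP => // _; case: ifP. Qed.

Lemma target_npos : target npos = 0.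
Proof. by rewrite /target ltnn ifN // -leqNgt leq_addr. Qed.

Lemma slack_pos y : y < 3 * ntriples -> y %/ 3 < ntriples.
Proof. by move=> H; rewrite ltn_divLR // mulnC. Qed.

Lemma digit_npos a : a < nitems -> digit a npos = 0.
Proof.
move=> Ha; rewrite /digit; case: ltnP => H.
  by rewrite ltnn ifN // -leqNgt leq_addr.
rewrite /npos eqn_add2l gtn_eqF //; apply: slack_pos.
by rewrite ltn_subLR.
Qed.

Lemma digit_le a p : digit a p <= 3.
Proof.
rewrite /digit; case: ifP => _; last by case: eqP.
case: ifP => _; first by case: eqP.
by case: ifP => // _; exact: count_size.
Qed.

Lemma triple_lt q l : q < ntriples -> l \in triple q -> l < nlits.
Proof.
move=> Hq; have L0 : 0 < nlits by move: Hq; rewrite /ntriples; case: nlits.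
rewrite !inE => /or3P[] /eqP ->; rewrite ?ltn_mod //.
have L1 : 0 < nlits * nlits by case: nlits L0.
by rewrite ltn_divLR // mulnA.
Qed.

Lemma sum_count (s : seq nat) m : {in s, forall l, l < m} ->
  forall S : pred nat, \sum_(l < m | S l) count_mem (l : nat) s = count S s.
Proof.
elim: s => [|x s IH] Hs S /=; first by rewrite big1.
rewrite big_split /= IH; last by move=> l Hl; apply: Hs; rewrite inE Hl orbT.
congr addn; have Hx : x < m by apply: Hs; rewrite inE eqxx.
rewrite big_mkcond (bigD1 (Ordinal Hx)) //= eqxx big1 ?addn0; first by case: (S x).
by move=> i /negbTE Hi; rewrite -val_eqE /= in Hi; rewrite eq_sym Hi; case: (S i).
Qed.

(** At the position of a variable only its two literals have a digit; at that of a triple, only its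
    own literals, with multiplicity, and its three slack items do. *)
Lemma sum_items (S : pred nat) p : p < npos ->
  \sum_(a < nitems | S a) digit a p =
  if p < k then S (2 * p) + S (2 * p).+1
  else count S (triple (p - k)) + \sum_(z < 3) S (nlits + (3 * (p - k) + z)).
Proof.
move=> Hp; rewrite big_mkcond /= big_split_ord /=.
have E1 (a : 'I_nlits) : (if S a then digit a p else 0) =
    if S a then if p < k then nat_of_bool (a %/ 2 == p) else count_mem (a : nat)
      (triple (p - k)) else 0.
  by rewrite /digit ltn_ord Hp.
rewrite (eq_bigr _ (fun a _ => E1 a)) {E1}.
have E2 (y : 'I_(3 * ntriples)) : (if S (nlits + y) then digit (nlits + y) p else 0) =
    S (nlits + y) * (p == k + y %/ 3).
  by rewrite /digit ltnNge leq_addr /= addKn; case: (S _); rewrite ?mul1n.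
rewrite (eq_bigr _ (fun a _ => E2 a)) {E2}.
case: ltnP => Hk.
  rewrite [X in _ + X]big1 ?addn0; last first.
    by move=> i _; rewrite ltn_eqF ?muln0 // (leq_trans Hk) ?leq_addr.
  rewrite /nlits mulnC.
  rewrite (sum_blocks k 2 (fun a => if S a then nat_of_bool (a %/ 2 == p) else 0)).
  rewrite (bigD1 (Ordinal Hk)) //= [X in _ + X]big1 ?addn0.
    under eq_bigr => a _.
      rewrite divnMDl // divn_small ?ltn_ord // addn0 eqxx.
      rewrite (_ : (if _ then _ else _) = S (p * 2 + a) :> nat); last by case: (S _).
      over.
    by rewrite big_ord_recl big_ord1 /= addn0 addn1 [p * 2]mulnC.
  move=> i; rewrite -val_eqE /= => /negbTE Hi; apply: big1 => z _.
  by rewrite divnMDl // divn_small ?addn0 // Hi; case: (S _).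
have Hq : p - k < ntriples by rewrite ltn_subLR.
congr addn.
  rewrite -big_mkcond; apply: (@sum_count (triple (p - k))) => l; exact: triple_lt.
rewrite mulnC (sum_blocks ntriples 3 (fun y => S (nlits + y) * (p == k + y %/ 3))).
rewrite (bigD1 (Ordinal Hq)) //= [X in _ + X]big1 ?addn0.
  apply: eq_bigr => z _; rewrite divnMDl // divn_small // addn0 subnKC // eqxx muln1.
  by rewrite mulnC.
move=> i; rewrite -val_eqE /= => /negbTE Hi; apply: big1 => z _.
rewrite divnMDl // divn_small // addn0 (_ : (p == k + i) = false) ?muln0 //.
by apply/eqP => E; move: Hi; rewrite E addKn eqxx.
Qed.

Lemma sum_digits (S : pred nat) :
  \sum_(a < nitems | S a) num (digit a) =
  num (fun p => \sum_(a < nitems | S a) digit a p).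
Proof.
rewrite /num exchange_big /=; apply: eq_bigr => p _.
by rewrite big_distrl.
Qed.

Lemma sum_all_items p : p <= npos -> \sum_(a < nitems) digit a p = 2 * target p.
Proof.
rewrite leq_eqVlt => /orP[/eqP ->|Hp].
  by rewrite target_npos big1 // => a _; exact: digit_npos.
rewrite (sum_items predT Hp) /target Hp; case: ifP => // _.
by rewrite count_predT sum1_card card_ord.
Qed.

Lemma num_scale c g : num (fun p => c * g p) = c * num g.
Proof. by rewrite /num big_distrr /=; apply: eq_bigr => p _; rewrite mulnA. Qed.

Lemma num_npos g : g npos = 0 -> (forall p, p < npos -> g p < B) -> num g < B ^ npos.
Proof.
move=> E H; rewrite /num big_ord_recr /= E mul0n addn0; exact: num_lt.
Qed.

Lemma num_top : num (fun p => nat_of_bool (p == npos)) = B ^ npos.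
Proof.
rewrite /num big_ord_recr /= eqxx mul1n big1 // => p _.
by rewrite ltn_eqF.
Qed.

Lemma num_one : num (fun p => nat_of_bool (p == 0)) = 1.
Proof. by rewrite /num big_ord_recl /= expn0 big1. Qed.

Definition solvable (pr : pred nat) := exists v : nat -> bool, forall q, q < ntriples ->
  pr q -> has (fun l => v (l %/ 2) == odd l) (triple q).

(** The digit sums stay below [B], so nothing is carried and the equality with [T] holds position by
    position. *)
Lemma items_solvable i (S : pred nat) :
  (forall a, a < nitems -> S a -> ~~ disabled i a) ->
  \sum_(a < nitems | S a) num (digit a) = num target -> solvable (pres i).
Proof.
move=> Hdis; rewrite sum_digits => Hnum.
have Hp p : p < npos -> \sum_(a < nitems | S a) digit a p = target p.
  move=> Hp; apply: (num_inj _ _ Hnum) => [j Hj|j Hj|].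
  - apply: leq_trans B_ge8; apply: (@leq_ltn_trans (2 * target j)); last first.
      by have := target_le j; lia.
    rewrite -(sum_all_items (p := j)) // [X in _ <= X](bigID (fun a : 'I_nitems => S
      a)).
    exact: leq_addr.
  - by apply: leq_trans B_ge8; have := target_le j; lia.
  - exact: ltnW.
(* A variable is true if its odd literal is selected; its target 1 forces the opposite choice for
   the even one. *)
pose v u := S (2 * u).+1; exists v => q Hq Hpr.
have Hvar u : u < k -> S (2 * u) = ~~ v u.
  move=> Hu; have /Hp : u < npos by apply: leq_trans Hu (leq_addr _ _).
  rewrite sum_items; last by apply: leq_trans Hu (leq_addr _ _).
  by rewrite /target Hu /v; case: (S _); case: (S _).
have /Hp : k + q < npos by rewrite ltn_add2l.
rewrite sum_items ?ltn_add2l // /target [k + q < k]ltnNge leq_addr [~~ true]/=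
  ltn_add2l Hq addKn.
(* Only two slack items of a present triple can be selected, so the target 3 requires a selected
   literal. *)
have D2 : S (nlits + (3 * q + 2)) = false.
  have Hlt : nlits + (3 * q + 2) < nitems by rewrite /nitems; lia.
  apply/negP => /(Hdis _ Hlt); rewrite /disabled leq_addr addKn /= mulnC.
  by rewrite modnMDl divnMDl // addn0 Hpr.
move=> E; have : has S (triple q).
  rewrite has_count; move: (count S _) E => c.
  rewrite !big_ord_recr big_ord0 /= D2 !add0n addn0.
  by do 2!case: (S (_ + _)); case: c => [|[|[]]].
case/hasP => l Hl Sl; apply/hasP; exists l => //; have Hl' := triple_lt Hq Hl.
have Hu : l %/ 2 < k by rewrite ltn_divLR // mulnC.
move: Sl; rewrite {1}(divn_eq l 2) modn2 mulnC.
case: (odd l); rewrite ?addn1 ?addn0; first by rewrite /v => ->.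
by rewrite Hvar // => /negbTE ->.
Qed.

(** The true literals are selected, together with as many slack items as the number of true literals
    in the triple falls short of 3. A present triple has a true literal, so its third slack item is
    left out. *)
Lemma solvable_items i : solvable (pres i) -> exists S : pred nat,
  (forall a, a < nitems -> S a -> ~~ disabled i a) /\
  \sum_(a < nitems | S a) num (digit a) = num target.
Proof.
case=> v Hv; pose sat l := v (l %/ 2) == odd l.
pose S a := if a < nlits then sat a
  else (a - nlits) %% 3 < 3 - count sat (triple ((a - nlits) %/ 3)).
have Slack q z : z < 3 -> S (nlits + (3 * q + z)) = (z < 3 - count sat (triple q)).
  move=> Hz; rewrite /S ltnNge leq_addr /= addKn mulnC modnMDl modn_small //.
  by rewrite divnMDl // (divn_small Hz) addn0.
exists S; split.
  move=> a Ha; rewrite /S /disabled; case: ltnP => // Hl Hs.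
  apply/negP => /and3P[_ /eqP E Hpr]; move: Hs; rewrite E.
  have Hq : (a - nlits) %/ 3 < ntriples by apply: slack_pos; rewrite ltn_subLR.
  have H : has sat _ := Hv _ Hq Hpr; move: H; rewrite has_count; lia.
rewrite sum_digits; apply: eq_bigr => -[p /= Hp] _; congr muln.
move: Hp; rewrite ltnS leq_eqVlt => /orP[/eqP ->|Hp].
  by rewrite target_npos big1 // => a _; exact: digit_npos.
rewrite sum_items // /target Hp; case: ltnP => Hk.
  have L : (2 * p).+1 < nlits by rewrite /nlits; lia.
  rewrite /S (ltnW L) L /sat -[(2 * p).+1]addn1 mulnC divnMDl // mulnK // addn0.
  by rewrite oddD oddM andbF; case: (v p).
have Hq : p - k < ntriples by rewrite ltn_subLR.
have E : count S (triple (p - k)) = count sat (triple (p - k)).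
  by apply: eq_in_count => l Hl; rewrite /S (triple_lt Hq Hl).
have := count_size sat (triple (p - k)); rewrite E -[size _]/3.
rewrite !big_ord_recr big_ord0 !Slack //.
move: (count sat _) => c Hc.
by case: c Hc => [|[|[|[|c]]]].
Qed.

Local Notation T := (num target).

Lemma size_job_list : size job_list = (n * nitems).+1.
Proof. by rewrite size_map size_iota. Qed.

Lemma jobsE (j : 'I_(size job_list)) : jobs j = job_at j.
Proof.
rewrite /jobs (tnth_nth last_job) /= (nth_map 0) ?nth_iota //.
  by rewrite -size_job_list.
by rewrite size_iota -size_job_list.
Qed.

Lemma sum_job_list (F : nat -> nat) :
  \sum_(j < size job_list) F j =
  \sum_(i < n) \sum_(a < nitems) F (i * nitems + a) + F (n * nitems).
Proof. by rewrite size_job_list big_ord_recr /= (sum_blocks n nitems). Qed.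

Lemma job_at_item i a : i < n -> a < nitems -> job_at (i * nitems + a) = item_job i a.
Proof.
move=> Hi Ha; have A0 : 0 < nitems by exact: leq_ltn_trans Ha.
rewrite /job_at divnMDl // (divn_small Ha) addn0 modnMDl (modn_small Ha) ifT //.
apply: (@leq_trans (i * nitems + nitems)); first by rewrite ltn_add2l.
by rewrite addnC -mulSn leq_mul2r Hi orbT.
Qed.

Lemma job_at_last : job_at (n * nitems) = last_job.
Proof. by rewrite /job_at ltnn. Qed.

Lemma n_lt m : m <= n -> 3 * m < B.
Proof. by move=> H; apply: leq_ltn_trans n_small; rewrite leq_mul2l H orbT. Qed.

(** [T] has digit 0 at [npos], and a factor of at most [n] causes no carry. Hence a disabled item
    can never meet its due date, while the last job can wait for all blocks. *)
Lemma due_lt m : m <= n -> m * T < B ^ npos.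
Proof.
move=> Hm; rewrite -num_scale; apply: num_npos; first by rewrite target_npos muln0.
move=> p _; apply: leq_ltn_trans (n_lt Hm); rewrite mulnC leq_mul2r target_le orbT //.
Qed.

Lemma due_item i a : due (item_job i a) = i.+1 * T.
Proof. exact: num_scale. Qed.

Lemma weight_item i a : weight (item_job i a) = (n - i) * num (digit a).
Proof. exact: num_scale. Qed.

Lemma ptime_item i a : ptime (item_job i a) = if disabled i a then B ^ npos else num
  (digit a).
Proof. by rewrite /=; case: ifP => // _; exact: num_top. Qed.

Lemma thresholdE : threshold = \sum_(i < n) (n - i) * T.
Proof. by rewrite /threshold num_scale big_distrl. Qed.

Lemma sum_item_digits : \sum_(a < nitems) num (digit a) = 2 * T.
Proof.
rewrite (sum_digits predT) -num_scale; apply: eq_bigr => -[p Hp] _ /=.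
by rewrite sum_all_items.
Qed.

Lemma schedule_solvable (rho : 'S_(size job_list)) :
  tardy_weight rho <= threshold -> forall i, i < n -> solvable (pres i).
Proof.
move=> Htw.
(* Extended to all natural numbers, so that jobs can be addressed as [i * nitems + a]. *)
pose on j := if insub j is Some o then ~~ tardy rho o else false.
have onE (o : 'I_(size job_list)) : on o = ~~ tardy rho o by rewrite /on valK.
pose p j := ptime (job_at j).
have Hsum (P : pred nat) d : (forall j, P j -> on j) ->
    (forall j, P j -> due (job_at j) <= d) ->
    \sum_(o < size job_list | P o) p o <= d.
  move=> H1 H2; rewrite (eq_bigr (fun o => ptime (jobs o))); last by move=> o _;
    rewrite jobsE.
  apply: (on_time_sum (rho := rho)) => o Ho; last by rewrite jobsE; exact: H2.
  by rewrite -onE; exact: H1.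
pose s i a := on (i * nitems + a).
have Hlt i a : i < n -> a < nitems -> i * nitems + a < size job_list.
  move=> Hi Ha; rewrite size_job_list ltnS ltnW //.
  apply: (@leq_trans (i * nitems + nitems)); first by rewrite ltn_add2l.
  by rewrite addnC -mulSn leq_mul2r Hi orbT.
have Hdis i a : i < n -> a < nitems -> s i a -> ~~ disabled i a.
  move=> Hi Ha Hs; apply/negP => Hd.
  have := Hsum (pred1 (i * nitems + a)) (i.+1 * T).
  rewrite (big_pred1 (Ordinal (Hlt i a Hi Ha))); last by move=> o; rewrite /= -val_eqE.
  rewrite /p /= job_at_item // ptime_item Hd leqNgt due_lt //.
  by move=> H; suff: false by []; apply: H => j /eqP ->; rewrite ?job_at_item ?due_item.
pose X i := \sum_(a < nitems | s i a) num (digit a).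
have XE i : i < n -> X i = \sum_(a < nitems) s i a * p (i * nitems + a).
  move=> Hi; rewrite /X big_mkcond; apply: eq_bigr => a _.
  case Hs: (s i a); rewrite ?mul0n // mul1n /p job_at_item // ptime_item ifN //.
  exact: Hdis.
(* All jobs of the first [m.+1] blocks are due by [m.+1 * T], so [on_time_sum] applies to those on
   time. *)
have Hpre m : m < n -> \sum_(i < m.+1) X i <= m.+1 * T.
  move=> Hm.
  apply: leq_trans (Hsum (fun j => on j && (j < m.+1 * nitems)) (m.+1 * T) _ _);
    last first.
  - move=> j /andP[_ Hj]; rewrite /job_at.
    have Hj2 : j < n * nitems by apply: leq_trans Hj _; rewrite leq_mul2r Hm orbT.
    have A0 : 0 < nitems by case: nitems Hj => //; rewrite muln0.
    by rewrite Hj2 due_item leq_mul2r ltn_divLR // Hj orbT.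
  - by move=> j /andP[].
  rewrite [X in _ <= X]big_mkcond (sum_job_list (fun j => if on j && (j < m.+1 *
    nitems) then p j else 0)) /=.
  apply: leq_trans (leq_addr _ _).
  rewrite (big_ord_widen n _ Hm) [X in _ <= X](bigID (fun i : 'I_n => i < m.+1)) /=.
  apply: leq_trans (leq_addr _ _); apply: leq_sum => i Hi; rewrite XE //.
  apply: leq_sum => a _; rewrite -/(s i a).
  suff -> : i * nitems + a < m.+1 * nitems by case: (s i a); rewrite ?mul1n.
  apply: (@leq_trans (i * nitems + nitems)); first by rewrite ltn_add2l.
  by rewrite addnC -mulSn leq_mul2r Hi orbT.
(* The blocks weigh twice the threshold in total, so at least the threshold is on time. *)
have Htot : \sum_(i < n) (n - i) * T <= \sum_(i < n) (n - i) * X i.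
  have := tardy_weight_on rho.
  have -> : \sum_(j | ~~ tardy rho j) weight (jobs j) =
      \sum_(j < size job_list) on j * weight (job_at j).
    rewrite big_mkcond; apply: eq_bigr => j _.
    by rewrite onE jobsE; case: (tardy rho j); rewrite ?mul0n ?mul1n.
  have -> : \sum_(j < size job_list) weight (jobs j) =
      \sum_(j < size job_list) weight (job_at j).
    by apply: eq_bigr => j _; rewrite jobsE.
  rewrite (sum_job_list (fun j => on j * weight (job_at j))).
  rewrite (sum_job_list (fun j => weight (job_at j))) job_at_last.
  have -> : \sum_(i < n) \sum_(a < nitems) on (i * nitems + a) * weight (job_at (i *
    nitems + a)) =
      \sum_(i < n) (n - i) * X i.
    apply: eq_bigr => i _; rewrite /X big_distrr /= [RHS]big_mkcond /=;
      apply: eq_bigr => a _.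
    rewrite -/(s i a) job_at_item // weight_item.
    by case: (s i a); rewrite ?mul0n ?mul1n.
  have -> : \sum_(i < n) \sum_(a < nitems) weight (job_at (i * nitems + a)) =
      2 * \sum_(i < n) (n - i) * T.
    rewrite big_distrr /=; apply: eq_bigr => i _; rewrite mulnCA -sum_item_digits.
    rewrite big_distrr /=; apply: eq_bigr => a _.
    by rewrite job_at_item // weight_item.
  move: Htw; rewrite thresholdE; move: (weight last_job) => wl.
  (* If the last job is tardy, its weight counts against the threshold and the bound for the blocks
     is only stronger. *)
  case: (on _); lia.
move=> i Hi; apply: (@items_solvable i (s i)) => [a|]; first exact: Hdis.
exact: (abel_tight Hpre Htot).
Qed.

Lemma solvable_schedule : (forall i, i < n -> solvable (pres i)) ->
  exists rho : 'S_(size job_list), tardy_weight rho <= threshold.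
Proof.
move=> Hsol.
have /fin_all_exists [S0 HS0] (i : 'I_n) := solvable_items (Hsol i (ltn_ord i)).
pose S i a := if insub i is Some i' then S0 i' a else false.
have SE (i : 'I_n) a : S i a = S0 i a by rewrite /S valK.
have HS i : i < n -> (forall a, a < nitems -> S i a -> ~~ disabled i a) /\
    \sum_(a < nitems) S i a * num (digit a) = T.
  move=> Hi; have [H1 H2] := HS0 (Ordinal Hi); split=> [a Ha|].
    by rewrite (SE (Ordinal Hi)); exact: H1.
  rewrite -H2 [RHS]big_mkcond; apply: eq_bigr => a _; rewrite (SE (Ordinal Hi)).
  by case: (S0 _ _); rewrite ?mul1n ?mul0n.
(* The implication also selects the last job, which has the largest index and so runs right after
   all selected items. *)
pose sel j := (j < n * nitems) ==> S (j %/ nitems) (j %% nitems).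
have selE i a : i < n -> a < nitems -> sel (i * nitems + a) = S i a.
  move=> Hi Ha; have A0 : 0 < nitems by exact: leq_ltn_trans Ha.
  rewrite /sel divnMDl // (divn_small Ha) addn0 modnMDl (modn_small Ha).
  suff -> : i * nitems + a < n * nitems by [].
  apply: (@leq_trans (i * nitems + nitems)); first by rewrite ltn_add2l.
  by rewrite addnC -mulSn leq_mul2r Hi orbT.
have sel_last : sel (n * nitems) by rewrite /sel ltnn.
pose p j := ptime (job_at j).
have pE i a : i < n -> a < nitems -> S i a -> p (i * nitems + a) = num (digit a).
  move=> Hi Ha Hs; rewrite /p job_at_item // ptime_item ifN //.
  by have [H _] := HS i Hi; exact: H.
have Hpre r : r <= n ->
    \sum_(o < size job_list | sel o && (o < r * nitems)) p o = r * T.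
  move=> Hr; rewrite big_mkcond.
  rewrite (sum_job_list (fun j => if sel j && (j < r * nitems) then p j else 0)) /=.
  rewrite [n * nitems < _]ltnNge leq_mul2r Hr orbT andbF addn0.
  have <- : \sum_(i < n | i < r) T = r * T.
    have /= <- := @big_ord_widen _ 0 addn r n (fun=> T) Hr.
    by rewrite sum_nat_const card_ord.
  rewrite [RHS]big_mkcond /=.
  apply: eq_bigr => i _; case: ltnP => Hi.
    have [_ <-] := HS i (ltn_ord i); apply: eq_bigr => a _; rewrite selE //.
    have -> : i * nitems + a < r * nitems.
      apply: (@leq_trans (i * nitems + nitems)); first by rewrite ltn_add2l.
      by rewrite addnC -mulSn leq_mul2r Hi orbT.
    by case Hs: (S i a); rewrite ?mul0n // mul1n pE.
  apply: big1 => a _; rewrite ifN // negb_and -leqNgt orbC.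
  by rewrite (leq_trans _ (leq_addr _ _)) // leq_mul2r Hi orbT.
have [rho Hrho] := @ex_schedule job_list (fun o => sel o).
exists rho.
have Hon (o : 'I_(size job_list)) : sel o -> ~~ tardy rho o.
  move=> Ho; rewrite /tardy -leqNgt (Hrho o Ho) jobsE.
  rewrite (eq_bigr (fun o : 'I__ => p o)); last by move=> j _; rewrite jobsE.
  (* The last job completes at [n * T + 1], within [B ^ npos] by [due_lt]. A selected item completes
     no later than the selected items of all blocks up to its own, which take exactly its due
     date. *)
  case: (ltnP o (n * nitems)) => Hlt; last first.
    rewrite /job_at ltnNge Hlt /= num_top.
    apply: (@leq_trans (\sum_(j < size job_list | sel j) p j)).
      by rewrite [X in _ <= X](bigID (fun j : 'I__ => j <= o)) /= leq_addr.
    have : n * T < B ^ npos by exact: due_lt.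
    rewrite -(Hpre n) //; apply: leq_trans.
    rewrite big_mkcond [X in _ <= X.+1]big_mkcond.
    rewrite (sum_job_list (fun j => if sel j then p j else 0)).
    rewrite (sum_job_list (fun j => if sel j && (j < n * nitems) then p j else 0)) /=.
    have -> : p (n * nitems) = 1 by rewrite /p job_at_last; exact: num_one.
    rewrite ltnn andbF addn0 sel_last addn1 ltnS.
    apply: leq_sum => i _; apply: leq_sum => a _.
    suff -> : i * nitems + a < n * nitems by rewrite andbT.
    apply: (@leq_trans (i * nitems + nitems)); first by rewrite ltn_add2l.
    by rewrite addnC -mulSn leq_mul2r ltn_ord orbT.
  have A0 : 0 < nitems by case: nitems Hlt => //; rewrite muln0.
  have Hm : o %/ nitems < n by rewrite ltn_divLR.
  rewrite /job_at Hlt due_item -(Hpre _ Hm).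
  rewrite big_mkcond [X in _ <= X]big_mkcond; apply: leq_sum => j _.
  case: (sel j) => //=; case: (leqP j o) => // Hj.
  suff -> : j < (o %/ nitems).+1 * nitems by [].
  by apply: leq_ltn_trans Hj _; rewrite -ltn_divLR.
(* Only unselected items can be tardy, and in each block their digits sum to [2 * T] minus [T]. *)
rewrite /tardy_weight thresholdE.
apply: (@leq_trans (\sum_(o < size job_list) ~~ sel o * weight (job_at o))).
  rewrite big_mkcond; apply: leq_sum => o _; rewrite jobsE.
  by case Ht: (tardy rho o) => //; case Hs: (sel o); rewrite ?mul1n //;
    move: (Hon o Hs); rewrite Ht.
rewrite (sum_job_list (fun j => ~~ sel j * weight (job_at j))) sel_last addn0.
apply: leq_sum => i _; have [_ HT] := HS i (ltn_ord i).
rewrite (eq_bigr (fun a : 'I_nitems => (n - i) * (~~ S i a * num (digit a))));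
  last first.
  by move=> a _; rewrite selE // job_at_item // weight_item mulnCA.
rewrite -big_distrr /= leq_mul2l.
suff : T + \sum_(a < nitems) ~~ S i a * num (digit a) = 2 * T.
  by rewrite mul2n -addnn => /addnI ->; rewrite leqnn orbT.
rewrite -{1}HT -big_split /= -sum_item_digits; apply: eq_bigr => a _.
by case: (S i a); rewrite /= ?mul0n ?mul1n ?add0n ?addn0.
Qed.

(** Every item has a nonzero digit at its own position. Items exist only for positive [k], and then
    position 0 of [T] carries the digit 1. *)
Lemma job_list_positive : positive_jobs job_list.
Proof.
move=> j; rewrite jobsE /job_at; case: ifP => [Hj|_]; last first.
  by rewrite /= num_top num_one expn_gt0 expn_gt0.
have A0 : 0 < nitems by case: nitems Hj => //; rewrite muln0.
have Hi : j %/ nitems < n by rewrite ltn_divLR.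
have Ha : j %% nitems < nitems by rewrite ltn_mod.
have K0 : 0 < k by move: A0; rewrite /nitems /ntriples /nlits; case: (k).
move: (j %/ _) (j %% _) Hi Ha => i a Hi Ha.
have B0 : 0 < B ^ npos by rewrite !expn_gt0.
have num_gt0 g p : p < npos -> 0 < g p -> 0 < num g.
  move=> Hp Hg; rewrite /num (bigD1 (Ordinal (ltnW Hp : p < npos.+1))) //=.
  by rewrite addn_gt0 muln_gt0 Hg !expn_gt0.
have D0 : 0 < num (digit a).
  case: (ltnP a nlits) => Hl.
    apply: (num_gt0 _ (a %/ 2)); last by rewrite /digit Hl ltn_divLR // mulnC Hl eqxx.
    by apply: leq_trans (leq_addr _ _); rewrite ltn_divLR // mulnC.
  have Hq : (a - nlits) %/ 3 < ntriples by apply: slack_pos; rewrite ltn_subLR.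
  apply: (num_gt0 _ (k + (a - nlits) %/ 3)); first by rewrite ltn_add2l.
  by rewrite /digit [a < nlits]ltnNge Hl /= eqxx.
rewrite ptime_item weight_item due_item; split.
- by case: ifP.
- by rewrite muln_gt0 subn_gt0 Hi.
- rewrite muln_gt0 /=; apply: (num_gt0 _ 0); last by rewrite /target K0.
  exact: leq_trans K0 (leq_addr _ _).
Qed.

Lemma dmax_job_list : dmax job_list = B ^ npos.
Proof.
apply/eqP; rewrite eqn_leq; apply/andP; split.
  apply/bigmax_leqP => j _; rewrite jobsE /job_at; case: ifP => [Hj|_];
    last by rewrite /= num_top.
  rewrite due_item ltnW // due_lt // ltn_divLR //.
  by case: nitems Hj => //; rewrite muln0.
have Hl : n * nitems < size job_list by rewrite size_job_list.
apply: leq_trans (leq_bigmax (Ordinal Hl)).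
by rewrite jobsE job_at_last /= num_top.
Qed.

Lemma wmax_job_list : wmax job_list = B ^ npos.
Proof.
apply/eqP; rewrite eqn_leq; apply/andP; split.
  apply/bigmax_leqP => j _; rewrite jobsE /job_at; case: ifP => [Hj|_];
    last by rewrite /= num_top.
  have A0 : 0 < nitems by case: nitems Hj => //; rewrite muln0.
  apply: ltnW; apply: num_npos; first by rewrite digit_npos ?muln0 // ltn_mod.
  move=> p _; apply: leq_ltn_trans n_small.
  by rewrite mulnC leq_mul ?digit_le // leq_subr.
have Hl : n * nitems < size job_list by rewrite size_job_list.
apply: leq_trans (leq_bigmax (Ordinal Hl)).
by rewrite jobsE job_at_last /= num_top.
Qed.

(** Both maxima equal the power [B ^ npos] of the last job, so their sum is again a power of two and
    no rounding occurs. *)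
Lemma job_list_parameter : up_log 2 (dmax job_list + wmax job_list) = (b * npos).+1.
Proof. by rewrite dmax_job_list wmax_job_list addnn -mul2n -expnM -expnS up_expnK. Qed.

End Reduction.

(** * Binary numerals and well-formed inputs *)

Lemma bin_double n (c : bool) : 0 < n -> bin (2 * n + c) = rcons (bin n) c.
Proof.
move=> n0; rewrite /bin.
have -> : trunc_log 2 (2 * n + c) = (trunc_log 2 n).+1.
  have /andP[] := trunc_log_bounds (isT : 1 < 2) n0; rewrite expnS.
  by move=> H1 H2; apply: trunc_log_eq => //; rewrite !expnS; case: c; lia.
have Eo : odd (2 * n + c) = c by rewrite oddD oddM; case: (c).
rewrite -[iota 0 _.+2]/(0 :: iota (1 + 0) (trunc_log 2 n).+1) iotaDl.
rewrite rev_cons map_rcons expn0 divn1 Eo.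
congr rcons; rewrite -map_rev -map_comp; apply: eq_map => i /=.
rewrite add1n expnS divnMA mulnC divnMDl //.
by case: (c); rewrite ?addn0.
Qed.

Lemma pos_double_ind (P : nat -> Prop) : P 1 ->
  (forall n (c : bool), 0 < n -> P n -> P (2 * n + c)) -> forall n, 0 < n -> P n.
Proof.
move=> P1 PS n; elim/ltn_ind: n => n IH n0.
have [->//|n1] : n = 1 \/ 1 < n by lia.
have -> : n = 2 * n./2 + odd n by rewrite -{1}[n]odd_double_half addnC mul2n.
by apply: PS; [|apply: IH]; lia.
Qed.

Lemma bin_head n : 0 < n -> exists ds, bin n = true :: ds.
Proof.
move: n; apply: pos_double_ind => [|n c n0 [ds Hds]]; first by exists [::].
by exists (rcons ds c); rewrite bin_double // Hds.
Qed.

Definition unbin := foldl (fun n (c : bool) => 2 * n + c) 0.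

Lemma binK : cancel bin unbin.
Proof.
case=> [//|n]; move: (n.+1) (ltn0Sn n); apply: pos_double_ind => // m c m0 IH.
by rewrite bin_double // /unbin foldl_rcons -/unbin -/(unbin _) IH.
Qed.

Lemma bin_inj : injective bin. Proof. exact: can_inj binK. Qed.

Lemma bin_surj ds : exists2 n, 0 < n & bin n = true :: ds.
Proof.
elim/last_ind: ds => [|ds c [n n0 E]]; first by exists 1.
by exists (2 * n + c); [lia|rewrite bin_double // E].
Qed.

(** Positions above the leading 1 are dropped, and position 0 is kept in every case to give the
    numeral of 0. The generator prints numerals in this form. *)
Lemma bin_bits n K : n < 2 ^ K.+1 ->
  bin n = [seq odd (n %/ 2 ^ r) |
            r <- [seq K - i | i <- iota 0 K.+1] & (r == 0) || (0 < n %/ 2 ^ r)].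
Proof.
move=> Hn; have -> : [seq K - i | i <- iota 0 K.+1] = rev (iota 0 K.+1).
  apply: (@eq_from_nth _ 0); rewrite ?size_rev ?size_map // size_iota => i Hi.
  by rewrite (nth_map 0) ?size_iota // nth_rev ?size_iota // !nth_iota //; lia.
rewrite filter_rev /bin; congr (map _ (rev _)); set t := trunc_log 2 n.
have Ht : t <= K.
  case: n Hn @t => [|n] Hn t //; rewrite -ltnS -(ltn_exp2l _ _ (isT : 1 < 2)).
  exact: leq_ltn_trans (trunc_logP (isT : 1 < 2) (isT : 0 < n.+1)) Hn.
have Hr r : ((r == 0) || (0 < n %/ 2 ^ r)) = (r < t.+1).
  rewrite divn_gt0 ?expn_gt0 // ltnS; case: r => [|r] //=.
  case: n Hn @t Ht => [|n] Hn t Ht; first by rewrite leqNgt expn_gt0.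
  apply/idP/idP => [|H]; first exact: trunc_log_max.
  by apply: leq_trans (trunc_logP (isT : 1 < 2) (isT : 0 < n.+1)); rewrite leq_exp2l.
have -> : K.+1 = t.+1 + (K - t) by lia.
rewrite iotaD filter_cat -[LHS]cats0; congr cat.
  by rewrite (eq_in_filter (a2 := predT)) ?filter_predT // => r; rewrite mem_iota Hr.
rewrite (eq_in_filter (a2 := pred0)) ?filter_pred0 // => r;
  rewrite mem_iota Hr => /andP[H _].
by rewrite ltnNge H.
Qed.

(** * An automaton for sequences of encoded formulas *)

Lemma sepE (i j : nat) : i < 3 -> j < 3 -> (sep i == sep j) = (i == j).
Proof.
move=> Hi Hj; rewrite /sep; apply/eqP/eqP => [[E]|->] //.
by have := congr1 val E; rewrite /= !inordK.
Qed.

Lemma symbolP (a : symbol) : (exists b, a = inl b) \/ exists2 i, i < 3 & a = sep i.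
Proof.
case: a => [b|i]; first by left; exists b.
by right; exists i => //; rewrite /sep inord_val.
Qed.

Lemma bit_sep (c : bool) i : (inl c == sep i :> symbol) = false.
Proof. by []. Qed.

Lemma sep_bit (c : bool) i : (sep i == inl c :> symbol) = false.
Proof. by []. Qed.

(* States of an automaton recognizing sequences of nonempty 3-clauses:
   0 at a formula boundary, 1 after a clause, 2 rejection; inside the i-th
   literal, 4i+1 after the sign, 4i+2 after the digit 0, 4i+3 after a digit 1,
   and 4i after its end. *)
Definition vnext (q : nat) (f t s0 s1 s2 : bool) : nat :=
  if q < 2 then (if f || t then 5 else if s2 then 0 else 2)
  else if q == 2 then 2
  else if q %% 4 == 0 then
    (if (f || t) && (q < 12) then q + 5 else if s1 then 1 else 2)
  else if q %% 4 == 1 then (if t then q + 2 else if f then q + 1 else 2)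
  else if q %% 4 == 2 then (if s0 then q - 2 else 2)
  else (if f || t then q else if s0 then q - 3 else 2).

Definition vstep q (a : symbol) :=
  vnext q (a == inl false) (a == inl true) (a == sep 0) (a == sep 1) (a == sep 2).

(** An empty clause makes its formula unsatisfiable, so inputs containing one can be rejected like
    malformed ones. A nonempty clause can be padded to a triple by repeating a literal. *)
Definition good_clause (c : clause) := 0 < size c <= 3.
Definition good_cnf (phi : cnf) := all good_clause phi.

(* [pending q phi c rest]: in state [q], the clauses [phi] and literals [c] of the
   unfinished formula and clause are complete, and [rest] is a partial literal. *)
Inductive pending : nat -> cnf -> clause -> seq symbol -> Prop :=
  | PendF : pending 0 [::] [::] [::]
  | PendC phi : pending 1 phi [::] [::]
  | PendL phi c : 0 < size c <= 3 -> pending (4 * size c) phi c [::]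
  | PendS phi c b : size c < 3 -> pending (4 * (size c).+1 + 1) phi c [:: inl b]
  | PendZ phi c b : size c < 3 ->
      pending (4 * (size c).+1 + 2) phi c [:: inl b; inl false]
  | PendD phi c b ds : size c < 3 ->
      pending (4 * (size c).+1 + 3) phi c [:: inl b, inl true & [seq inl d | d <- ds]].

Definition parsed (u : seq symbol) (q : nat) :=
  exists phis phi c rest, [/\ all good_cnf phis, good_cnf phi,
    u = flatten [seq encode_cnf phi | phi <- phis] ++
        flatten [seq encode_clause c | c <- phi] ++
        flatten [seq encode_literal l | l <- c] ++ rest
    & pending q phi c rest].

Lemma vstep_bit q b : vstep q (inl b) = vnext q (~~ b) b false false false.
Proof. by rewrite /vstep !bit_sep; case: b. Qed.

Lemma vstep_sep q i : i < 3 -> vstep q (sep i) = vnext q false false (i == 0) (i == 1)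
  (i == 2).
Proof. by move=> Hi; rewrite /vstep !sep_bit !sepE. Qed.

Lemma vnextL i f t s0 s1 s2 : 0 < i -> vnext (4 * i) f t s0 s1 s2 =
  if (f || t) && (i < 3) then 4 * i.+1 + 1 else if s1 then 1 else 2.
Proof.
case: i => // i _; rewrite /vnext modnMr eqxx.
have -> : (4 * i.+1 < 2) = false by lia.
have -> : (4 * i.+1 == 2) = false by lia.
have -> : (4 * i.+1 < 12) = (i.+1 < 3) by lia.
by rewrite (_ : 4 * i.+1 + 5 = 4 * i.+2 + 1); last lia.
Qed.

Lemma vnextR i r f t s0 s1 s2 : 0 < i -> r < 4 -> 0 < r -> vnext (4 * i + r) f t s0 s1
  s2 =
  if r == 1 then (if t then 4 * i + 3 else if f then 4 * i + 2 else 2)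
  else if r == 2 then (if s0 then 4 * i else 2)
  else (if f || t then 4 * i + r else if s0 then 4 * i else 2).
Proof.
move=> Hi Hr Hr0; rewrite /vnext mulnC modnMDl modn_small // mulnC.
have -> : (4 * i + r < 2) = false by lia.
have -> : (4 * i + r == 2) = false by lia.
rewrite [r == 0]eqn0Ngt Hr0 /=.
case: r Hr Hr0 => [|[|[|[|r]]]] //= _ _; first by rewrite -!addnA.
  by rewrite addnK.
by rewrite addnK.
Qed.

(** Each accepted symbol extends the partial literal or closes a literal, a clause or a formula.
    Digits after a leading 1 always form a numeral, by [bin_surj]. *)
Lemma parsed_rcons u q a : parsed u q -> vstep q a != 2 -> parsed (rcons u a) (vstep q
  a).
Proof.
case=> phis [phi [c [rest [Hphis Hphi -> Hp]]]].
have Lit l : encode_literal l = inl l.2 :: rcons [seq inl b | b <- bin l.1] (sep 0) by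
  [].
case: Hp Hphi => {q phi c rest} [|phi|phi c Hc|phi c b Hc|phi c b Hc|phi c b ds Hc]
  Hphi.
- have [[b ->]|[i Hi ->]] := symbolP a; rewrite ?vstep_bit ?vstep_sep //.
    move=> _; exists phis, [::], [::], [:: inl b]; split=> //;
      first by rewrite /= !cats0 cats1.
    have -> : vnext 0 (~~ b) b false false false = 4 * (size ([::] : clause)).+1 + 1 by
      case: b.
    exact: PendS.
  case: i Hi => [|[|[|i]]] //= _ _; exists (rcons phis [::]), [::], [::], [::]; split.
  - by rewrite all_rcons /= Hphis.
  - by [].
  - by rewrite map_rcons flatten_rcons /= !cats0 cats1.
  - exact: PendF.
- have [[b ->]|[i Hi ->]] := symbolP a; rewrite ?vstep_bit ?vstep_sep //.
    move=> _; exists phis, phi, [::], [:: inl b]; split=> //;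
      first by rewrite /= !cats0 -cats1 -!catA.
    have -> : vnext 1 (~~ b) b false false false = 4 * (size ([::] : clause)).+1 + 1 by
      case: b.
    exact: PendS.
  case: i Hi => [|[|[|i]]] //= _ _; exists (rcons phis phi), [::], [::], [::]; split.
  - by rewrite all_rcons Hphi Hphis.
  - by [].
  - by rewrite map_rcons flatten_rcons /= !cats0 -!cats1 -catA /encode_cnf cats1.
  - exact: PendF.
- have [[b ->]|[i Hi ->]] := symbolP a; rewrite ?vstep_bit ?vstep_sep // vnextL;
    try lia.
    have -> : ~~ b || b = true by case: b.
    case: ltnP => // H _; exists phis, phi, c, [:: inl b]; split=> //;
      last exact: PendS.
    by rewrite cats0 -cats1 -!catA.
  rewrite /=; case: (i =P 1) => // -> _; exists phis, (rcons phi c), [::], [::];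
    split=> //.
  - by rewrite /good_cnf all_rcons -/(good_cnf phi) Hphi andbT; exact: Hc.
  - by rewrite map_rcons flatten_rcons /= !cats0 -!cats1 -!catA /encode_clause cats1.
  - exact: PendC.
- have [[d ->]|[i Hi ->]] := symbolP a; rewrite ?vstep_bit ?vstep_sep // vnextR //.
  case: d => _; exists phis, phi, c.
    exists [:: inl b; inl true]; split=> //; first by rewrite -cats1 -!catA.
    exact: (PendD phi b [::]).
  exists [:: inl b; inl false]; split=> //; first by rewrite -cats1 -!catA.
  exact: PendZ.
- have [[d ->]|[i Hi ->]] := symbolP a; rewrite ?vstep_bit ?vstep_sep // vnextR //=.
  case: (i =P 0) => // -> _; exists phis, phi, (rcons c (0, b)), [::]; split=> //.
    by rewrite map_rcons flatten_rcons cats0 -!cats1 -!catA.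
  have -> : 4 * (size c).+1 = 4 * size (rcons c (0, b)) by rewrite size_rcons.
  by apply: PendL; rewrite size_rcons.
- have [[d ->]|[i Hi ->]] := symbolP a; rewrite ?vstep_bit ?vstep_sep // vnextR //=.
    have -> : ~~ d || d = true by case: d.
    move=> _; exists phis, phi, c, [:: inl b, inl true & [seq inl d | d <- rcons ds d]].
    split=> //; last exact: PendD.
    by rewrite map_rcons -!cats1 -!catA.
  case: (i =P 0) => // -> _; have [v v0 Ev] := bin_surj ds.
  exists phis, phi, (rcons c (v, b)), [::]; split=> //.
    by rewrite map_rcons flatten_rcons cats0 /encode_literal /encode_nat Ev -!cats1
      -!catA.
  have -> : 4 * (size c).+1 = 4 * size (rcons c (v, b)) by rewrite size_rcons.
  by apply: PendL; rewrite size_rcons.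
Qed.

Definition vrun := foldl vstep 0.

Lemma vstep2 a : vstep 2 a = 2. Proof. by []. Qed.

Lemma vrun_parsed u : vrun u != 2 -> parsed u (vrun u).
Proof.
elim/last_ind: u => [_|u a IH]; first by exists [::], [::], [::], [::]; split=> //;
  exact: PendF.
rewrite /vrun foldl_rcons -/vrun -/(vrun u) => H; apply: parsed_rcons (H); apply: IH.
by apply: contraNneq H => ->; rewrite vstep2.
Qed.

Lemma vrun_literal q l : q \in [:: 0; 1; 4; 8] ->
  foldl vstep q (encode_literal l) = if q < 2 then 4 else q + 4.
Proof.
move=> Hq; rewrite /encode_literal /encode_nat /= vstep_bit foldl_rcons.
have Hds ds q' : q' %% 4 = 3 -> foldl vstep q' [seq inl d | d <- ds] = q'.
  move=> Hq'; elim: ds => //= d ds IH; rewrite vstep_bit.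
  suff -> : vnext q' (~~ d) d false false false = q' by [].
  rewrite /vnext Hq' /=; case: ifP => H; first by case: q' H Hq' {IH} => [|[]].
  case: ifP => [/eqP E|_]; first by move: Hq'; rewrite E.
  by case: d.
case: l => [v b] /=; case: (posnP v) => [->|v0].
  by move: Hq; rewrite !inE => /or4P[] /eqP ->; case: b;
    rewrite /= ?vstep_bit ?vstep_sep.
have [ds ->] := bin_head v0; rewrite /= vstep_bit Hds.
  by move: Hq; rewrite !inE => /or4P[] /eqP ->; case: b;
    rewrite /= ?vstep_bit ?vstep_sep.
by move: Hq; rewrite !inE => /or4P[] /eqP ->; case: b.
Qed.

Lemma vrun_clause q c : q < 2 -> good_clause c -> foldl vstep q (encode_clause c) = 1.
Proof.
move=> Hq; rewrite /encode_clause foldl_rcons /good_clause.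
have Hq' : q \in [:: 0; 1; 4; 8] by case: q Hq => [|[]].
move: encode_literal vrun_literal => enc Henc.
have {}Henc l : foldl vstep q (enc l) = 4 /\ foldl vstep 4 (enc l) = 8 /\ foldl vstep 8
  (enc l) = 12.
  by rewrite !Henc // Hq.
case: c => [|l1 [|l2 [|l3 []]]] // _; rewrite /= ?cats0 ?foldl_cat.
- by have [-> _] := Henc l1; rewrite vstep_sep.
- by have [-> _] := Henc l1; have [_ [-> _]] := Henc l2; rewrite vstep_sep.
- have [-> _] := Henc l1; have [_ [-> _]] := Henc l2; have [_ [_ ->]] := Henc l3.
  by rewrite vstep_sep.
Qed.

Lemma vrun_cnf phi : good_cnf phi -> foldl vstep 0 (encode_cnf phi) = 0.
Proof.
move=> H; rewrite /encode_cnf foldl_rcons.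
suff : forall q, q < 2 -> foldl vstep q (flatten [seq encode_clause c | c <- phi]) < 2.
  by move=> /(_ 0 isT); case: (foldl _ _ _) => [|[]] // _; rewrite vstep_sep.
elim: phi H => //= c phi IH /andP[Hc Hphi] q Hq.
by rewrite foldl_cat vrun_clause // IH.
Qed.

Lemma vrunP u : reflect
  (exists2 phis, u = flatten [seq encode_cnf phi | phi <- phis] & all good_cnf phis)
  (vrun u == 0).
Proof.
apply: (iffP eqP) => [E|[phis -> H]].
  have : parsed u 0 by rewrite -E; apply: vrun_parsed; rewrite E.
  case=> phis [phi [c [rest [H1 _ -> Hp]]]]; exists phis => //.
  move: Hp; move Eq: 0 => q Hp.
  case: Hp Eq => {phi c rest q} [|phi|phi c|phi c b _|phi c b _|phi c b ds _] //=;
    try lia.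
  by rewrite !cats0.
rewrite /vrun; elim: phis H => //= phi phis IH /andP[H1 H2].
by rewrite foldl_cat vrun_cnf // IH.
Qed.

(** * Formulas read off from positions *)

Definition unreset (r : pred nat) q p := ~~ has (fun q' => (q < q') && r q') (iota 0 p).

(* The values of [g] at the positions below [p] satisfying [add], from the last
   one satisfying [reset] on. *)
Definition collect (T : Type) (add reset : pred nat) (g : nat -> T) p :=
  [seq g q | q <- iota 0 p & add q && unreset reset q p].

Lemma iotaSr m n : iota m n.+1 = rcons (iota m n) (m + n).
Proof. by rewrite -addn1 iotaD cats1. Qed.

(** This recursion links the positional definition, which terms can evaluate, to the state update of
    a left-to-right scan, which can be followed along the encoding of a formula. *)
Lemma collectS (T : Type) (add reset : pred nat) (g : nat -> T) p :
  collect add reset g p.+1 =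
  (if reset p then [::] else collect add reset g p) ++ (if add p then [:: g p] else
    [::]).
Proof.
have unresetS q : q <= p -> unreset reset q p.+1 = unreset reset q p && ~~ ((q < p) &&
  reset p).
  by move=> Hq; rewrite /unreset iotaSr -cats1 has_cat /= orbF negb_or.
have unreset_p : unreset reset p p.
  by apply/hasPn => q; rewrite mem_iota => /andP[_ Hq];
    rewrite negb_and -leqNgt (ltnW Hq).
rewrite {1}/collect iotaSr -cats1 filter_cat map_cat /= unresetS // ltnn unreset_p /=
  andbT.
congr cat; last by case: (add p).
rewrite (eq_in_filter (a2 := fun q => (add q && unreset reset q p) && ~~ reset p));
  last first.
  by move=> q; rewrite mem_iota add0n => /andP[_ Hq];
    rewrite (unresetS _ (ltnW Hq)) Hq /= andbA.
case: (reset p); last by congr map; apply: eq_filter => q; rewrite andbT.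
by rewrite (eq_filter (a2 := pred0)) ?filter_pred0 // => q; rewrite andbF.
Qed.

Section Scan.
Variable s : seq symbol.

Definition at_sep j p := onth s p == Some (sep j).
Definition at_bit c p := onth s p == Some (inl c).
Definition is_bit p := at_bit false p || at_bit true p.

Definition bits_before p := collect is_bit (fun q => ~~ is_bit q) (at_bit true) p.
Definition lits_of_clause p := collect (at_sep 0) (at_sep 1) bits_before p.
Definition lits_of_cnf p := collect (at_sep 0) (at_sep 2) bits_before p.
Definition clauses_of_cnf p := collect (at_sep 1) (at_sep 2) lits_of_clause p.
Definition cnf_ends := [seq e <- iota 0 (size s) | at_sep 2 e].

Definition scanned := (seq bool * seq (seq bool) * seq (seq (seq bool)) * seq (seq bool)
  * seq (seq (seq (seq bool)) * seq (seq bool)))%type.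

(** The state consists of the current run of bits, the literals of the current clause, the clauses
    and the literals of the current formula, and the finished formulas. A formula end keeps [cl],
    since [lits_of_clause] is reset at clause ends only. *)
Definition scan_step (st : scanned) (a : symbol) : scanned :=
  let: (run, cl, fo, li, ph) := st in
  match a with
  | inl b => (rcons run b, cl, fo, li, ph)
  | inr j => match val j with
    | 0 => ([::], rcons cl run, fo, rcons li run, ph)
    | 1 => ([::], [::], rcons fo cl, li, ph)
    | _ => ([::], cl, [::], [::], rcons ph (fo, li))
    end
  end.

Lemma scanE p : p <= size s ->
  (bits_before p, lits_of_clause p, clauses_of_cnf p, lits_of_cnf p,
   [seq (clauses_of_cnf e, lits_of_cnf e) | e <- iota 0 p & at_sep 2 e]) =
  foldl scan_step ([::], [::], [::], [::], [::]) (take p s).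
Proof.
elim: p => [|p IH] Hp; first by rewrite take0.
have [a Ha] : exists a, onth s p = Some a.
  by move: Hp; rewrite -onthTE; case: (onth s p) => // a _; exists a.
have Hn : nth a s p = a by exact: onth_nth.
rewrite (take_nth a) // Hn foldl_rcons -IH 1?ltnW //.
rewrite /bits_before /lits_of_clause /clauses_of_cnf /lits_of_cnf !collectS.
rewrite iotaSr filter_rcons add0n /at_sep /is_bit /at_bit Ha !(inj_eq Some_inj).
have [[b Ea]|[i Hi Ea]] := symbolP a; rewrite Ea.
  by rewrite /= !cats0; case: b {Ea}; rewrite /= cats1.
rewrite !sepE // /sep /= inordK //.
by case: i Hi Ea => [|[|[|]]] // _ _; rewrite /= ?cats0 ?cats1 ?map_rcons.
Qed.

End Scan.

Definition lit_code (l : literal) : seq bool := l.2 :: bin l.1.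

Lemma scan_literal l cl fo li ph :
  foldl scan_step ([::], cl, fo, li, ph) (encode_literal l) =
  ([::], rcons cl (lit_code l), fo, rcons li (lit_code l), ph).
Proof.
rewrite /encode_literal /encode_nat -rcons_cons foldl_rcons /=.
have E ds run : foldl scan_step (run, cl, fo, li, ph) [seq inl b | b <- ds] =
   (run ++ ds, cl, fo, li, ph).
  by elim: ds run => [|d ds IH] run /=; rewrite ?cats0 // IH -cats1 -catA.
by rewrite E /= inordK.
Qed.

Lemma scan_clause c fo li ph :
  foldl scan_step ([::], [::], fo, li, ph) (encode_clause c) =
  ([::], [::], rcons fo (map lit_code c), li ++ map lit_code c, ph).
Proof.
rewrite /encode_clause foldl_rcons.
suff -> : forall cl, foldl scan_step ([::], cl, fo, li, ph) (flatten [seq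
  encode_literal l | l <- c]) =
    ([::], cl ++ map lit_code c, fo, li ++ map lit_code c, ph).
  by rewrite /= inordK.
move: encode_literal scan_literal => enc Henc.
elim: c li => [|l c IH] li cl /=; first by rewrite !cats0.
by rewrite foldl_cat Henc IH -!cats1 -!catA.
Qed.

Definition cnf_code (phi : cnf) := [seq map lit_code c | c <- phi].

Lemma scan_cnf phi ph :
  foldl scan_step ([::], [::], [::], [::], ph) (encode_cnf phi) =
  ([::], [::], [::], [::], rcons ph (cnf_code phi, flatten (cnf_code phi))).
Proof.
rewrite /encode_cnf foldl_rcons.
suff -> : forall fo li, foldl scan_step ([::], [::], fo, li, ph) (flatten [seq
  encode_clause c | c <- phi]) =
    ([::], [::], fo ++ cnf_code phi, li ++ flatten (cnf_code phi), ph).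
  by rewrite /= inordK.
elim: phi => [|c phi IH] fo li; first by rewrite !cats0.
by rewrite [flatten _]/= foldl_cat scan_clause IH /= -!cats1 -!catA.
Qed.

Lemma scan_cnfs phis : let s := flatten [seq encode_cnf phi | phi <- phis] in
  [seq (clauses_of_cnf s e, lits_of_cnf s e) | e <- cnf_ends s] =
  [seq (cnf_code phi, flatten (cnf_code phi)) | phi <- phis].
Proof.
move=> s; have := scanE (leqnn (size s)); rewrite take_size.
suff -> : forall ph, foldl scan_step ([::], [::], [::], [::], ph) s =
    ([::], [::], [::], [::], ph ++ [seq (cnf_code phi, flatten (cnf_code phi)) | phi <-
      phis]).
  by case.
rewrite /s; elim: phis {s} => [|phi phis IH] ph; first by rewrite cats0.
by rewrite [flatten _]/= foldl_cat scan_cnf IH /= -!cats1 -!catA.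
Qed.

Section LastOccurrences.
Variables (T : eqType) (f : nat -> T).

Definition last_occ (Q : seq nat) q := ~~ has (fun q' => (q < q') && (f q' == f q)) Q.

Lemma last_occ_cons q0 Q : path ltn q0 Q ->
  last_occ (q0 :: Q) q0 = (f q0 \notin map f Q) /\
  {in Q, forall q, last_occ (q0 :: Q) q = last_occ Q q}.
Proof.
rewrite path_sortedE; last exact: ltn_trans.
case/andP=> /allP H0 _; split=> [|q Hq].
  rewrite /last_occ /= ltnn /=; congr negb; apply/hasP/mapP => [[q Hq /andP[_ /eqP
    E]]|[q Hq E]].
    by exists q.
  by exists q => //; rewrite E eqxx andbT; exact: H0.
by rewrite /last_occ /= ltnNge (ltnW (H0 q Hq)).
Qed.

(** [undup] keeps the last copy of each value, which is why last rather than first occurrences are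
    used. *)
Lemma undup_last_occ Q : sorted ltn Q ->
  undup (map f Q) = map f [seq q <- Q | last_occ Q q].
Proof.
elim: Q => [//|q0 Q IH] HQ; have [E0 E] := last_occ_cons HQ.
rewrite [filter _ _]/= E0 /= (eq_in_filter E) (IH (path_sorted HQ)).
by case: (f q0 \in _).
Qed.

Definition rank (names : seq T) v := if v \in names then index v (undup names) else 0.

(** The entries of [undup] before [v] are the last occurrences after which [v] still appears;
    counting them requires no list. If [v] does not occur, both sides are 0. *)
Lemma rank_last_occ Q v : sorted ltn Q ->
  rank (map f Q) v =
  count (fun q => last_occ Q q && has (fun q' => (q < q') && (f q' == v)) Q) Q.
Proof.
rewrite /rank; elim: Q => [//|q0 Q IH] HQ; have [E0 E] := last_occ_cons HQ.
have H0 : {in Q, forall q, q0 < q}.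
  move: HQ; rewrite /= path_sortedE; last exact: ltn_trans.
  by case/andP=> /allP.
rewrite [count _ _]/= E0 ltnn /= -(eq_in_count (a1 := fun q => last_occ Q q && has (fun
  q' => (q < q') && (f q' == v)) Q)); last first.
  by move=> q Hq; rewrite E // [q < q0]ltnNge (ltnW (H0 q Hq)).
rewrite -IH ?(path_sorted HQ) //.
have -> : has (fun q' => (q0 < q') && (f q' == v)) Q = (v \in map f Q).
  apply/hasP/mapP => [[q Hq /andP[_ /eqP <-]]|[q Hq ->]]; exists q => //.
  by rewrite eqxx andbT; exact: H0.
rewrite inE; case: (boolP (f q0 \in _)) => Hf /=.
  by case: eqVneq => [->|_]; rewrite /= ?Hf // add0n.
case: (eqVneq v (f q0)) => [->|Hv] /=; first by rewrite (negbTE Hf).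
by case: (v \in _).
Qed.
End LastOccurrences.

Lemma sorted_positions (P : pred nat) n : sorted ltn [seq q <- iota 0 n | P q].
Proof. by apply: sorted_filter (iota_ltn_sorted 0 n); exact: ltn_trans. Qed.

Lemma count_iota (P : pred nat) n : count P (iota 0 n) = \sum_(i < n) P i.
Proof.
rewrite -sum1_count -[n in iota 0 n]subn0 -/(index_iota 0 n) big_mkord big_mkcond.
by apply: eq_bigr => i _; case: (P i).
Qed.

(* A literal is read as its sign followed by the digits of its variable. *)
Definition key (r : seq bool) : seq bool := if r is _ :: t then false :: t else [::].

Lemma keyE r r' : (key r == key r') =
  (size r == size r') &&
  all (fun i => (i == 0) || (nth false r i == nth false r' i)) (iota 0 (size r)).
Proof.
case: r r' => [|c r] [|c' r'] //=; rewrite eqseq_cons eqxx /= eqSS.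
apply/eqP/andP => [->|[/eqP Es H]].
  by split=> //; apply/allP => i _; case: i => [|i] //=; rewrite eqxx ?orbT.
apply: (@eq_from_nth _ false) => // i Hi.
have := allP H i.+1; rewrite mem_iota /= => Hi'; apply/eqP; apply: Hi'; lia.
Qed.

(** The item number of a literal. The rank of the variable among those of its formula replaces its
    name, which is not bounded in [k]; with at most [k] variables the result is below [nlits k]. *)
Definition run_code names r := 2 * rank names (key r) + head false r.

(** * Ranks, triples and blocks in terms of input positions *)

Section Positions.
Variable s : seq symbol.
Local Notation at_sep := (at_sep s).
Local Notation at_bit := (at_bit s).
Local Notation is_bit := (is_bit s).
Local Notation bits_before := (bits_before s).

Definition run_len p :=
  count (fun q => is_bit q && unreset (fun q => ~~ is_bit q) q p) (iota 0 p).

Lemma run_lenE p : run_len p = size (bits_before p).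
Proof.
by rewrite size_map size_filter.
Qed.

Lemma bits_beforeE p : run_len p <= p /\
  bits_before p = [seq at_bit true r | r <- iota (p - run_len p) (run_len p)].
Proof.
elim: p => [|p [IH1 IH2]]; first by rewrite run_lenE.
rewrite run_lenE /bits_before collectS -/(bits_before p).
case: (boolP (is_bit p)) => //= _; rewrite size_cat addn1 -run_lenE ltnS; split=> //.
by rewrite IH2 subSS iotaSr map_rcons cats1 subnK.
Qed.

Lemma nth_bits_before p i : i < run_len p ->
  nth false (bits_before p) i = at_bit true (p - run_len p + i).
Proof.
by move=> Hi; rewrite (bits_beforeE p).2 (nth_map 0) ?size_iota // nth_iota.
Qed.

Definition same_key p p' := (run_len p == run_len p') &&
  all (fun i => (i == 0) || (at_bit true (p - run_len p + i) == at_bit true (p' -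
    run_len p' + i)))
      (iota 0 (run_len p)).

Lemma same_keyE p p' : same_key p p' = (key (bits_before p) == key (bits_before p')).
Proof.
rewrite /same_key keyE -!run_lenE; case: eqP => //= E.
by apply: eq_in_all => i; rewrite mem_iota => /andP[_ Hi]; rewrite !nth_bits_before -?E.
Qed.

Definition sign_at q := (0 < run_len q) && at_bit true (q - run_len q).

Lemma sign_atE q : sign_at q = head false (bits_before q).
Proof.
rewrite /sign_at -nth0; case: (posnP (run_len q)) => [E|H] /=.
  by rewrite nth_default // -run_lenE E.
by rewrite nth_bits_before // addn0.
Qed.

Definition lit_end e q := at_sep 0 q && unreset (at_sep 2) q e.

Definition var_rank e q :=
  count (fun q1 => [&& lit_end e q1,
     ~~ has (fun q2 => [&& q1 < q2, lit_end e q2 & same_key q2 q1]) (iota 0 e)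
   & has (fun q2 => [&& q1 < q2, lit_end e q2 & same_key q2 q]) (iota 0 e)]) (iota 0 e).

Definition names e := map key (lits_of_cnf s e).

Lemma namesE e : names e = [seq key (bits_before q) | q <- [seq q <- iota 0 e | lit_end
  e q]].
Proof. by rewrite /names /lits_of_cnf /collect -map_comp. Qed.

Lemma has_later e q1 q :
  has (fun q2 => (q1 < q2) && (key (bits_before q2) == key (bits_before q)))
      [seq q <- iota 0 e | lit_end e q] =
  has (fun q2 => [&& q1 < q2, lit_end e q2 & same_key q2 q]) (iota 0 e).
Proof.
rewrite has_filter -filter_predI -has_filter; apply: eq_has => q2 /=.
by rewrite same_keyE -andbA; congr andb; rewrite andbC.
Qed.

Lemma var_rankE e q : var_rank e q = rank (names e) (key (bits_before q)).
Proof.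
rewrite namesE (rank_last_occ (fun q => key (bits_before q))) ?sorted_positions //.
rewrite count_filter; apply: eq_count => q1 /=.
by rewrite /last_occ !has_later andbC.
Qed.

Lemma size_undup_names e : size (undup (names e)) =
  count (fun q1 => lit_end e q1 &&
    ~~ has (fun q2 => [&& q1 < q2, lit_end e q2 & same_key q2 q1]) (iota 0 e)) (iota 0
      e).
Proof.
rewrite namesE undup_last_occ ?sorted_positions // size_map size_filter count_filter.
by apply: eq_count => q /=; rewrite andbC /last_occ has_later.
Qed.

Definition lit_code_at e q := 2 * var_rank e q + sign_at q.

Lemma lit_code_atE e q : lit_code_at e q = run_code (names e) (bits_before q).
Proof. by rewrite /lit_code_at var_rankE sign_atE. Qed.

Variable k : nat.

(* Clauses have at most three literals, so requiring the clauses contained in a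
   triple to hold at the triple gives an equivalent formula. *)
Definition present e t :=
  has (fun p => [&& at_sep 1 p, unreset (at_sep 2) p e
    & all (fun q => (at_sep 0 q && unreset (at_sep 1) q p) ==> (lit_code_at e q \in
      triple k t))
          (iota 0 p)]) (iota 0 e).

Lemma presentE e t : present e t =
  has (all (fun r => run_code (names e) r \in triple k t)) (clauses_of_cnf s e).
Proof.
rewrite /clauses_of_cnf /collect has_map has_filter -filter_predI -has_filter.
apply: eq_has => p /=; rewrite andbA [RHS]andbC; congr andb.
rewrite /lits_of_clause /collect all_map all_filter; apply: eq_all => q /=.
by rewrite lit_code_atE.
Qed.

Definition same_triples e e' := all (fun t => present e t == present e' t) (iota 0
  (ntriples k)).

(** Of the formulas with the same triples the last is kept, again to match [undup]. *)
Definition block_end e := at_sep 2 e &&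
  ~~ has (fun e' => [&& e < e', at_sep 2 e' & same_triples e' e]) (iota 0 (size s)).

Definition block_ends := [seq e <- iota 0 (size s) | block_end e].

Definition presence e := [seq present e t | t <- iota 0 (ntriples k)].

Lemma presence_eq e e' : (presence e' == presence e) = same_triples e' e.
Proof.
apply/eqP/allP => [/eq_in_map H t Ht|H]; first by rewrite H.
by apply/eq_in_map => t /H /eqP.
Qed.

Lemma undup_presence : undup (map presence (cnf_ends s)) = map presence block_ends.
Proof.
rewrite undup_last_occ ?sorted_positions // -filter_predI; congr map;
  apply: eq_filter => e /=.
rewrite /block_end andbC; congr andb; rewrite /last_occ has_filter -filter_predI
  -has_filter.
by congr negb; apply: eq_has => e' /=; rewrite presence_eq -andbA; congr andb;
  rewrite andbC.
Qed.

(** The kept formulas have distinct presence vectors, which are boolean vectors of length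
    [ntriples k]. *)
Lemma size_block_ends : size block_ends <= 2 ^ ntriples k.
Proof.
rewrite -(size_map presence) -undup_presence.
set u := undup _; have Hu : uniq u by exact: undup_uniq.
have Hs : all (fun v => size v == ntriples k) u.
  by apply/allP => v; rewrite mem_undup => /mapP[e _ ->]; rewrite size_map size_iota.
pose w : seq ((ntriples k).-tuple bool) := pmap insub u.
have Sw : size w = size u by rewrite /w size_pmap_sub; apply/eqP; rewrite -all_count.
have Uw : uniq w by exact: pmap_sub_uniq.
rewrite -Sw -(card_uniqP Uw); apply: leq_trans (max_card _) _.
by rewrite card_tuple card_bool.
Qed.
End Positions.

(** * Satisfiability in terms of triples of literals *)

Definition vars (phi : cnf) := [seq l.1 | l <- flatten phi].
Definition var_name (v : nat) := false :: bin v.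
Definition cnf_names (phi : cnf) := map key (flatten (cnf_code phi)).

Lemma var_name_inj : injective var_name.
Proof. by move=> u v [/bin_inj]. Qed.

Lemma cnf_namesE phi : cnf_names phi = map var_name (vars phi).
Proof. by rewrite /cnf_names /cnf_code -map_flatten -!map_comp. Qed.

Lemma size_cnf_names phi : size (undup (cnf_names phi)) = num_vars phi.
Proof. by rewrite cnf_namesE undup_map_inj ?size_map //; exact: var_name_inj. Qed.

Lemma run_code_lit phi l : l.1 \in vars phi ->
  run_code (cnf_names phi) (lit_code l) = 2 * index l.1 (undup (vars phi)) + l.2.
Proof.
move=> Hl; rewrite /run_code [key _]/(var_name l.1) [head _ _]/(l.2) cnf_namesE /rank.
rewrite (mem_map var_name_inj) Hl undup_map_inj ?index_map //; exact: var_name_inj.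
Qed.

Definition cnf_present k (phi : cnf) t :=
  has (all (fun r => run_code (cnf_names phi) r \in triple k t)) (cnf_code phi).

Lemma mem_vars (phi : cnf) (c : clause) (l : literal) : c \in phi -> l \in c -> l.1 \in
  vars phi.
Proof. by move=> Hc Hl; apply: map_f; apply/flattenP; exists c. Qed.

Lemma double_bit_div2 n (c : bool) : (2 * n + c) %/ 2 = n.
Proof. by rewrite mulnC divnMDl //; case: c; rewrite addn0. Qed.

Lemma double_bit_odd n (c : bool) : odd (2 * n + c) = c.
Proof. by rewrite oddD oddM; case: c. Qed.

Lemma triple_surj k a b c : a < nlits k -> b < nlits k -> c < nlits k ->
  exists2 t, t < ntriples k & triple k t = [:: a; b; c].
Proof.
move=> Ha Hb Hc; have k0 : 0 < nlits k by exact: leq_ltn_trans Ha.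
exists ((a * nlits k + b) * nlits k + c).
  rewrite /ntriples.
  have : (a * nlits k + b).+1 * nlits k <= nlits k * nlits k * nlits k.
    rewrite leq_mul2r; apply/orP; right.
    have : a.+1 * nlits k <= nlits k * nlits k by rewrite leq_mul2r Ha orbT.
    by rewrite mulSn; lia.
  by rewrite mulSn; lia.
rewrite /triple divnMA divnMDl // (divn_small Hc) addn0 !modnMDl !modn_small //.
by rewrite divnMDl // (divn_small Hb) addn0.
Qed.

(** If a clause is contained in a triple, its true literal is in the triple. Conversely, a clause
    padded by repetition is itself a present triple, with no literals but those of the clause. At
    most [k] variables means that all literal numbers are below [nlits k]. *)
Lemma cnf_solvable k phi : good_cnf phi -> num_vars phi <= k ->
  satisfiable phi <-> solvable k (cnf_present k phi).
Proof.
move=> Hgood Hk.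
have Hcode c l : c \in phi -> l \in c -> run_code (cnf_names phi) (lit_code l) < nlits
  k.
  move=> Hc Hl; have Hv := mem_vars Hc Hl; rewrite run_code_lit // /nlits.
  have : index l.1 (undup (vars phi)) < num_vars phi by rewrite index_mem mem_undup.
  by move: (index _ _) => i Hi; case: (l.2); lia.
split=> [[a /allP Ha]|[v Hv]].
  exists (fun u => a (nth 0 (undup (vars phi)) u)) => t Ht.
  rewrite /cnf_present has_map => /hasP[c Hc Hp].
  have {Hp} /allP Hall : all (fun l => run_code (cnf_names phi) (lit_code l) \in triple
    k t) c.
    by rewrite -(all_map lit_code (fun r => run_code (cnf_names phi) r \in triple k t)).
  have /hasP[l Hl /eqP Hal] := Ha c Hc.
  apply/hasP; exists (run_code (cnf_names phi) (lit_code l)); first exact: Hall.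
  rewrite run_code_lit ?(mem_vars Hc Hl) // double_bit_div2 double_bit_odd.
  by rewrite nth_index ?Hal // mem_undup (mem_vars Hc Hl).
exists (fun x => v (index x (undup (vars phi)))); apply/allP => c Hc.
pose code l := run_code (cnf_names phi) (lit_code l).
have [x [y [z [Hx Hy Hz Hsub]]]] : exists x y z, [/\ x \in c, y \in c, z \in c &
  {subset c <= [:: x; y; z]}].
  have := allP Hgood c Hc; rewrite /good_clause.
  case: (c) => [|x [|y [|z []]]] // _.
  - by exists x, x, x; split; rewrite ?inE ?eqxx // => l; rewrite !inE => ->.
  - exists x, y, y; split; rewrite ?inE ?eqxx ?orbT // => l; rewrite !inE.
    by case/orP=> ->; rewrite ?orbT.
  - by exists x, y, z; split; rewrite ?inE ?eqxx ?orbT.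
have [t Ht Et] := triple_surj (Hcode c x Hc Hx) (Hcode c y Hc Hy) (Hcode c z Hc Hz).
have Hp : cnf_present k phi t.
  rewrite /cnf_present has_map; apply/hasP; exists c => //=; rewrite all_map.
  apply/allP => l Hl /=; rewrite Et -/(code x) -/(code y) -/(code z).
  by have := map_f code (Hsub l Hl).
have /hasP[d] := Hv t Ht Hp; rewrite Et => Hd Hvd.
have [l Hl Ed] : exists2 l, l \in c & d = code l.
  by move: Hd; rewrite !inE => /or3P[] /eqP ->; [exists x|exists y|exists z].
apply/hasP; exists l => //=.
by move: Hvd; rewrite Ed /code run_code_lit ?(mem_vars Hc Hl) // double_bit_div2
  double_bit_odd.
Qed.

Section Instance.
Variables (s : seq symbol) (k : nat).

Definition valid := (vrun s == 0) && all (fun e => size (undup (names s e)) <= k)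
  (cnf_ends s).

Lemma solvable_ext (P Q : pred nat) : (forall t, t < ntriples k -> P t = Q t) ->
  solvable k P -> solvable k Q.
Proof. by move=> E [v Hv]; exists v => t Ht Qt; apply: Hv; rewrite ?E. Qed.

(** Every formula has the same triples as a kept one, and [solvable] depends on nothing else. *)
Lemma block_ends_solvable :
  (forall i, i < size (block_ends s k) -> solvable k (present s k (nth 0 (block_ends s
    k) i))) <->
  (forall e, e \in cnf_ends s -> solvable k (present s k e)).
Proof.
split=> [H e He|H i Hi]; last first.
  apply: H; have := mem_nth 0 Hi; rewrite !mem_filter => /andP[/andP[-> _]].
  by rewrite mem_iota.
have : presence s k e \in map (presence s k) (block_ends s k).
  by rewrite -undup_presence mem_undup map_f.
case/mapP=> e' He' /eqP; rewrite presence_eq => /allP E.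
have := H (index e' (block_ends s k)); rewrite index_mem nth_index // => /(_ He').
by apply: solvable_ext => t Ht; apply/esym/eqP/E; rewrite mem_iota.
Qed.

Lemma and_3sat_solvable : and_3sat (s, k) <->
  valid /\ forall i, i < size (block_ends s k) ->
    solvable k (present s k (nth 0 (block_ends s k) i)).
Proof.
have Hpres e phi : (clauses_of_cnf s e, lits_of_cnf s e) = (cnf_code phi, flatten
  (cnf_code phi)) ->
    names s e = cnf_names phi /\ forall t, present s k e t = cnf_present k phi t.
  move=> [E1 E2]; have En : names s e = cnf_names phi by rewrite /names E2.
  by split=> // t; rewrite presentE En E1.
split=> [[phis [/= Es Hphis Hsat]]|[/andP[/vrunP[phis Es Hgood] Hk] Hsol]].
  (* A satisfiable formula has no empty clause. *)
  have Hgood : all good_cnf phis.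
    apply/allP => phi Hphi; apply/allP => c Hc; have [/allP H3 _] := Hphis phi Hphi.
    rewrite /good_clause H3 // andbT; have [a /allP Ha] := Hsat phi Hphi.
    by have := Ha c Hc; case: (c).
  have Hscan := scan_cnfs phis; rewrite -Es in Hscan.
  have Hcnf e : e \in cnf_ends s -> exists2 phi, phi \in phis &
      (clauses_of_cnf s e, lits_of_cnf s e) = (cnf_code phi, flatten (cnf_code phi)).
    move=> He; have := map_f (fun e => (clauses_of_cnf s e, lits_of_cnf s e)) He.
    by rewrite Hscan => /mapP[phi]; exists phi.
  split.
    apply/andP; split; first by apply/vrunP; exists phis.
    apply/allP => e /Hcnf[phi Hphi /Hpres[-> _]]; rewrite size_cnf_names.
    by have [] := Hphis phi Hphi.
  apply/block_ends_solvable => e /Hcnf[phi Hphi /Hpres[_ E]].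
  apply: (@solvable_ext (cnf_present k phi)) => [t _|]; first by rewrite E.
  apply/cnf_solvable; [exact: (allP Hgood)|by have [] := Hphis phi Hphi|exact: Hsat].
have Hscan := scan_cnfs phis; rewrite -Es in Hscan.
have Hend phi : phi \in phis -> exists2 e, e \in cnf_ends s &
    (clauses_of_cnf s e, lits_of_cnf s e) = (cnf_code phi, flatten (cnf_code phi)).
  move=> Hphi; have := map_f (fun phi => (cnf_code phi, flatten (cnf_code phi))) Hphi.
  by rewrite -Hscan => /mapP[e He E]; exists e.
have Hnum phi : phi \in phis -> num_vars phi <= k.
  move=> /Hend[e He /Hpres[En _]].
  by rewrite -size_cnf_names -En; exact: (allP Hk).
exists phis; split=> //= phi Hphi.
  split; last exact: Hnum.
  by apply/allP => c Hc; have /allP/(_ c Hc)/andP[] := allP Hgood phi Hphi.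
apply/(cnf_solvable (allP Hgood phi Hphi) (Hnum phi Hphi)).
have [e He /Hpres[_ E]] := Hend phi Hphi.
apply: (@solvable_ext (present s k e)) => [t _|]; first by rewrite E.
by move/block_ends_solvable: Hsol; apply.
Qed.
End Instance.

(** * Terms for the reduction *)

Section Macros.
Variable A : finType.
Local Notation term := (term A).
Local Notation "# n" := (TNat A n) (at level 1, format "# n").
Local Notation V := (TVar A).

(** A single round of [TDwn]; the two [TSh] discard its index and accumulator. Truncated subtraction
    then gives negation of truth values and comparison. *)
Definition tsub (a b : term) : term := TDwn #1 a (TSh (TSh b)).
Definition tmul (a b : term) : term := TSum a (TSh b).
Definition tnot a := tsub #1 a.
Definition tpos a := tnot (tnot a).
Definition tle a b := tnot (tsub a b).
Definition tlt a b := tle (TAdd a #1) b.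
Definition teq a b := tnot (TAdd (tsub a b) (tsub b a)).
Definition tor a b := tpos (TAdd a b).
Definition timp a b := tor (tnot a) b.
Definition tif c a b := TAdd (tmul c a) (tmul (tnot c) b).
Definition tex n p := tpos (TSum n p).
Definition tall n p := tnot (TSum n (tnot p)).
Definition call1 f (a : term) := TLet a f.
(** [a] is shifted because the value of [b] has been pushed before it; the body sees [a] as variable
    0 and [b] as variable 1. *)
Definition call2 f (a b : term) := TLet b (TLet (TSh a) f).
(** The quotient counts the positive multiples of the divisor up to the dividend. The first factor
    gives 0 for divisor 0, as [divn] does. *)
Definition tdiv_body : term :=
  TSum (V 0) (tmul (tlt #0 (V 2)) (tle (tmul (TAdd (V 0) #1) (V 2)) (V 1))).
Definition tdiv a b := call2 tdiv_body a b.
Definition tmod a b := tsub a (tmul (tdiv a b) b).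
(** Repeated halving, as a decrease by [v - v %/ 2]; the power [2 ^ i] would not be polynomially
    bounded. *)
Definition tshr_body : term := TDwn (V 0) (V 1) (tsub (V 1) (tdiv (V 1) #2)).
Definition tshr v i := call2 tshr_body i v.

Variable x : seq A.
Local Notation ev := (ev x).
Implicit Types (a b c f p t : term) (e : seq nat).

Lemma ev_sub a b e m n : ev a e = m -> ev b e = n -> ev (tsub a b) e = m - n.
Proof. by move=> <- <-. Qed.

Lemma ev_add a b e m n : ev a e = m -> ev b e = n -> ev (TAdd a b) e = m + n.
Proof. by move=> <- <-. Qed.

Lemma ev_mul a b e m n : ev a e = m -> ev b e = n -> ev (tmul a b) e = m * n.
Proof. by move=> <- <- /=; rewrite sum_nat_const card_ord. Qed.

Lemma ev_not a e (P : bool) : ev a e = P -> ev (tnot a) e = ~~ P.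
Proof. by move=> E; rewrite (ev_sub erefl E); case: P {E}. Qed.

Lemma ev_pos a e m : ev a e = m -> ev (tpos a) e = (0 < m).
Proof. by move=> E; rewrite (ev_sub erefl (ev_sub erefl E)) /=;
  case: m {E} => [|m]. Qed.

Lemma ev_le a b e m n : ev a e = m -> ev b e = n -> ev (tle a b) e = (m <= n).
Proof. by move=> Ea Eb; rewrite (ev_sub erefl (ev_sub Ea Eb)) /= -subn_eq0;
  case: (m - n). Qed.

Lemma ev_lt a b e m n : ev a e = m -> ev b e = n -> ev (tlt a b) e = (m < n).
Proof. by move=> Ea Eb; rewrite (ev_le (ev_add Ea erefl) Eb) addn1. Qed.

Lemma ev_eq a b e m n : ev a e = m -> ev b e = n -> ev (teq a b) e = (m == n).
Proof.
move=> Ea Eb; rewrite (ev_sub erefl (ev_add (ev_sub Ea Eb) (ev_sub Eb Ea))) eqn_leq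
  -!subn_eq0 /=.
by case: (m - n); case: (n - m).
Qed.

Lemma ev_eqb a b e (P Q : bool) : ev a e = P -> ev b e = Q -> ev (teq a b) e = (P == Q).
Proof. by move=> Ea Eb; rewrite (ev_eq Ea Eb); case: P {Ea}; case: Q {Eb}. Qed.

Lemma ev_and a b e (P Q : bool) : ev a e = P -> ev b e = Q -> ev (tmul a b) e = P && Q.
Proof. by move=> Ea Eb; rewrite (ev_mul Ea Eb) mulnb. Qed.

Lemma ev_or a b e (P Q : bool) : ev a e = P -> ev b e = Q -> ev (tor a b) e = P || Q.
Proof. by move=> Ea Eb; rewrite (ev_pos (ev_add Ea Eb)); case: P {Ea};
  case: Q {Eb}. Qed.

Lemma ev_imp a b e (P Q : bool) : ev a e = P -> ev b e = Q -> ev (timp a b) e = (P ==>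
  Q).
Proof. by move=> Ea Eb; rewrite (ev_or (ev_not Ea) Eb) implybE. Qed.

Lemma ev_if c a b e (P : bool) m n : ev c e = P -> ev a e = m -> ev b e = n ->
  ev (tif c a b) e = if P then m else n.
Proof.
move=> Ec Ea Eb; rewrite (ev_add (ev_mul Ec Ea) (ev_mul (ev_not Ec) Eb)).
by case: P {Ec}; rewrite /= ?mul1n ?mul0n ?addn0.
Qed.

Lemma ev_sum (n : term) p e N (F : nat -> nat) : ev n e = N ->
  (forall i, i < N -> ev p (i :: e) = F i) -> ev (TSum n p) e = \sum_(i < N) F i.
Proof. by move=> /= -> H; apply: eq_bigr => i _; exact: H. Qed.

Lemma ev_count (n : term) p e N (P : pred nat) : ev n e = N ->
  (forall i, i < N -> ev p (i :: e) = P i) -> ev (TSum n p) e = count P (iota 0 N).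
Proof. by move=> E H; rewrite (ev_sum E H) count_iota. Qed.

Lemma ev_ex (n : term) p e N (P : pred nat) : ev n e = N ->
  (forall i, i < N -> ev p (i :: e) = P i) -> ev (tex n p) e = has P (iota 0 N).
Proof. by move=> E H; rewrite (ev_pos (ev_count E H)) has_count. Qed.

Lemma ev_all (n : term) p e N (P : pred nat) : ev n e = N ->
  (forall i, i < N -> ev p (i :: e) = P i) -> ev (tall n p) e = all P (iota 0 N).
Proof.
move=> E H; have := ev_count E (fun i Hi => ev_not (H i Hi)).
move=> /(ev_sub (erefl (ev #1 e))) ->; rewrite -[all _ _]negbK -has_predC has_count.
by case: (count _ _).
Qed.

Lemma sum_div m d : 0 < d -> \sum_(i < m) (i.+1 * d <= m) = m %/ d.
Proof.
move=> d0; have H i : (i.+1 * d <= m) = (i < m %/ d) by rewrite leq_divRL.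
rewrite -(count_iota (fun i => i.+1 * d <= m)) (eq_count H) -size_filter.
have Hle : m %/ d <= m by exact: leq_div.
have -> : iota 0 m = iota 0 (m %/ d) ++ iota (m %/ d) (m - m %/ d).
  by rewrite -[X in iota X (_ - _)]add0n -iotaD subnKC.
rewrite filter_cat size_cat.
rewrite (eq_in_filter (a2 := predT)) => [|i]; last by rewrite mem_iota => /andP[_ ->].
rewrite [X in _ + size X](eq_in_filter (a2 := pred0)) => [|i]; last first.
  by rewrite mem_iota => /andP[Hi _]; rewrite ltnNge Hi.
by rewrite filter_predT filter_pred0 size_iota addn0.
Qed.

Lemma ev_div a b e m d : ev a e = m -> ev b e = d -> ev (tdiv a b) e = m %/ d.
Proof.
move=> Ea Eb; rewrite /tdiv /call2 /= -[LHS]/(ev tdiv_body [:: ev a e, ev b e & e]) Ea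
  Eb.
rewrite (ev_sum (N := m) (F := fun i => (0 < d) && (i.+1 * d <= m))) //; last first.
  by move=> i _; rewrite -[i.+1]addn1; apply: ev_and;
    [apply: ev_lt|apply: ev_le => //; apply: ev_mul].
case: (posnP d) => [->|d0] /=; last by rewrite sum_div.
by rewrite divn0 big1.
Qed.

Lemma ev_mod a b e m d : ev a e = m -> ev b e = d -> ev (tmod a b) e = m %% d.
Proof.
by move=> Ea Eb; rewrite (ev_sub Ea (ev_mul (ev_div Ea Eb) Eb)) {1}(divn_eq m d) addKn.
Qed.

Lemma ev_dwn (n : term) t0 t e N m (F : nat -> nat -> nat) : ev n e = N -> ev t0 e = m
  ->
  (forall i v, ev t [:: i, v & e] = F i v) ->
  ev (TDwn n t0 t) e = iteri N (fun i v => v - F i v) m.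
Proof. by move=> /= -> -> H; apply: eq_iteri => i v; rewrite H. Qed.

Lemma ev_shr v i e m j : ev v e = m -> ev i e = j -> ev (tshr v i) e = m %/ 2 ^ j.
Proof.
move=> Ev Ei; rewrite /tshr -[LHS]/(ev tshr_body [:: ev i e, ev v e & e]) Ev Ei.
rewrite (ev_dwn (N := j) (m := m) (F := fun _ v => v - v %/ 2)) //; last first.
  by move=> i' v'; apply: ev_sub => //; apply: ev_div.
elim: j {Ei} => [|j IH]; first by rewrite divn1.
by rewrite [iteri _ _ _]/= IH expnS mulnC divnMA subKn // leq_div.
Qed.

Lemma ev_call1 f a e m v : (forall r, ev f (m :: r) = v) -> ev a e = m ->
  ev (call1 f a) e = v.
Proof. by move=> H E; rewrite -[LHS]/(ev f (ev a e :: e)) E. Qed.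

Lemma ev_call2 f a b e m n v : (forall r, ev f [:: m, n & r] = v) ->
  ev a e = m -> ev b e = n -> ev (call2 f a b) e = v.
Proof. by move=> H Ea Eb; rewrite -[LHS]/(ev f [:: ev a e, ev b e & e]) Ea Eb. Qed.

Lemma ev_sym (y : A) t e m : ev t e = m -> ev (TSym y t) e = (onth x m == Some y).
Proof. by move=> <-. Qed.
End Macros.

Ltac ev_step := lazymatch goal with
  | |- ev _ (TVar _ _) _ = _ => reflexivity
  | |- ev _ (TNat _ _) _ = _ => reflexivity
  | |- ev _ (TAdd _ _) _ = _ => apply: ev_add
  | |- ev _ (tsub _ _) _ = _ => apply: ev_sub
  | |- ev _ (tmul _ _) _ = _ => apply: ev_and
  | |- ev _ (tlt _ _) _ = _ => apply: ev_lt
  | |- ev _ (teq _ _) _ = _ => apply: ev_eq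
  | |- ev _ (tor _ _) _ = _ => apply: ev_or
  | |- ev _ (tif _ _ _) _ = _ => apply: ev_if
  | |- ev _ (tmod _ _) _ = _ => apply: ev_mod
  end.

Local Notation symbol_term := (term (option symbol)).
Local Notation "# n" := (TNat (option symbol) n) (at level 1, format "# n").
Local Notation V := (TVar (option symbol)).

Definition t_sym (a : symbol) (t : symbol_term) : symbol_term := TSym (Some a) t.
Definition t_sep i t := t_sym (sep i) t.
Definition t_bit c t := t_sym (inl c) t.
Definition t_param : symbol_term := TSum (TLen _) (TSym None (V 0)).
Definition t_size : symbol_term := tsub (TLen _) t_param.
Definition t_is_bit t := tor (t_bit false t) (t_bit true t).
Definition t_unreset (r : symbol_term -> symbol_term) q p :=
  tnot (tex p (tmul (tlt (TSh q) (V 0)) (r (V 0)))).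

Definition f_run_len := TSum (V 0)
  (tmul (t_is_bit (V 0)) (t_unreset (fun t => tnot (t_is_bit t)) (V 0) (V 1))).
Definition t_run_len := call1 f_run_len.

Definition f_same_key := tmul (teq (t_run_len (V 0)) (t_run_len (V 1)))
  (tall (t_run_len (V 0)) (tor (teq (V 0) #0)
    (teq (t_bit true (TAdd (tsub (V 1) (t_run_len (V 1))) (V 0)))
         (t_bit true (TAdd (tsub (V 2) (t_run_len (V 2))) (V 0)))))).
Definition t_same_key := call2 f_same_key.

Definition f_sign_at := tmul (tlt #0 (t_run_len (V 0))) (t_bit true (tsub (V 0)
  (t_run_len (V 0)))).
Definition t_sign_at := call1 f_sign_at.

Definition f_lit_end := tmul (t_sep 0 (V 1)) (t_unreset (t_sep 2) (V 1) (V 0)).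
Definition t_lit_end := call2 f_lit_end.

(* In the context q1, e of a sum over q1 < e. *)
Definition t_has_later q := tex (V 1)
  (tmul (tlt (V 1) (V 0)) (tmul (t_lit_end (V 2) (V 0)) (t_same_key (V 0) (TSh q)))).

Definition f_var_rank := TSum (V 0) (tmul (t_lit_end (V 1) (V 0))
  (tmul (tnot (t_has_later (V 0))) (t_has_later (V 2)))).
Definition t_var_rank := call2 f_var_rank.

Definition f_num_names := TSum (V 0) (tmul (t_lit_end (V 1) (V 0)) (tnot (t_has_later
  (V 0)))).
Definition t_num_names := call1 f_num_names.

Definition t_lit_code e q := TAdd (tmul #2 (t_var_rank e q)) (t_sign_at q).

Definition t_nlits := tmul #2 t_param.
Definition t_ntriples := tmul (tmul t_nlits t_nlits) t_nlits.
Definition t_npos := TAdd t_param t_ntriples.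
Definition t_nitems := TAdd t_nlits (tmul #3 t_ntriples).
Definition t_width := TAdd (tmul #2 t_ntriples) #3.

Definition t_triple0 t := tdiv t (tmul t_nlits t_nlits).
Definition t_triple1 t := tmod (tdiv t t_nlits) t_nlits.
Definition t_triple2 t := tmod t t_nlits.

Definition f_in_triple := tor (teq (V 0) (t_triple0 (V 1)))
  (tor (teq (V 0) (t_triple1 (V 1))) (teq (V 0) (t_triple2 (V 1)))).
Definition t_in_triple := call2 f_in_triple.

Definition f_present := tex (V 0) (tmul (t_sep 1 (V 0))
  (tmul (t_unreset (t_sep 2) (V 0) (V 1))
  (tall (V 0) (timp (tmul (t_sep 0 (V 0)) (t_unreset (t_sep 1) (V 0) (V 1)))
     (t_in_triple (t_lit_code (V 2) (V 0)) (V 3)))))).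
Definition t_present := call2 f_present.

Definition f_same_triples := tall t_ntriples (teq (t_present (V 1) (V 0)) (t_present (V
  2) (V 0))).
Definition t_same_triples := call2 f_same_triples.

Definition f_block_end := tmul (t_sep 2 (V 0)) (tnot (tex t_size
  (tmul (tlt (V 1) (V 0)) (tmul (t_sep 2 (V 0)) (t_same_triples (V 0) (V 1)))))).
Definition t_block_end := call1 f_block_end.

Definition f_block_index := TSum (V 0) (t_block_end (V 0)).
Definition t_block_index := call1 f_block_index.
Definition t_nblocks := t_block_index t_size.

Section Evaluation.
Variables (s : seq symbol) (k : nat).
Local Notation ev := (ev (encode_pair (s, k))).
Implicit Types (t : symbol_term) (e : seq nat).

(** A position beyond [s] holds the letter [None] of the unary parameter or nothing, neither of
    which is a letter of [s]. *)
Lemma ev_t_sym a t e m : ev t e = m -> ev (t_sym a t) e = (onth s m == Some a).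
Proof.
move=> E; rewrite (ev_sym _ E) /encode_pair onth_cat size_map onth_map /=.
case: ltnP => H; last by rewrite onth_nseq onth_default //; case: ifP.
by case: (onth s m).
Qed.

Lemma ev_t_param e : ev t_param e = k.
Proof.
rewrite /t_param (ev_count (N := size s + k) (P := fun i => (size s <= i))).
- by rewrite iotaD count_cat (eq_in_count (a2 := pred0)) ?count_pred0;
    [rewrite (eq_in_count (a2 := predT)) ?count_predT ?size_iota // => i;
      rewrite mem_iota => /andP[->]
    |move=> i; rewrite mem_iota => /andP[_ Hi]; rewrite leqNgt Hi].
- by rewrite /= size_cat size_map size_nseq.
- move=> i Hi; rewrite (ev_sym (t := V 0) (e := i :: e) (m := i) _ erefl) /encode_pair
    onth_cat size_map onth_map /=.
  case: ltnP => H; first by case: (onth s i).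
  by rewrite onth_nseq ltn_subLR // Hi.
Qed.

Lemma ev_t_size e : ev t_size e = size s.
Proof.
rewrite (ev_sub (m := size s + k) _ (ev_t_param e)) ?addnK //.
by rewrite /= size_cat size_map size_nseq.
Qed.

Lemma ev_t_sep i t e m : ev t e = m -> ev (t_sep i t) e = at_sep s i m.
Proof. exact: ev_t_sym. Qed.

Lemma ev_t_bit c t e m : ev t e = m -> ev (t_bit c t) e = at_bit s c m.
Proof. exact: ev_t_sym. Qed.

Lemma ev_t_is_bit t e m : ev t e = m -> ev (t_is_bit t) e = is_bit s m.
Proof. by move=> E; apply: ev_or; apply: ev_t_bit. Qed.

Lemma ev_t_unreset r (P : pred nat) q p e m n :
  (forall t e m, ev t e = m -> ev (r t) e = P m) -> ev q e = m -> ev p e = n ->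
  ev (t_unreset r q p) e = unreset P m n.
Proof.
move=> Hr Hq Hp; apply: ev_not; apply: ev_ex => // i _.
by apply: ev_and; [apply: ev_lt|apply: Hr].
Qed.

Lemma ev_t_run_len t e m : ev t e = m -> ev (t_run_len t) e = run_len s m.
Proof.
move=> E; refine (ev_call1 _ E) => r; rewrite /run_len.
apply: ev_count => // i Hi; apply: ev_and; first exact: ev_t_is_bit.
by apply: ev_t_unreset => // t' e' m' H; apply/ev_not/ev_t_is_bit.
Qed.

Lemma ev_t_same_key t t' e m n : ev t e = m -> ev t' e = n ->
  ev (t_same_key t t') e = same_key s m n.
Proof.
move=> E E'; refine (ev_call2 _ E E') => r.
apply: ev_and; first by apply: ev_eq; apply: ev_t_run_len.
apply: ev_all; first exact: ev_t_run_len.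
move=> i _; apply: ev_or; first exact: ev_eq.
by apply: ev_eqb; apply: ev_t_bit; apply: ev_add => //; apply: ev_sub => //;
  apply: ev_t_run_len.
Qed.

Lemma ev_t_sign_at t e m : ev t e = m -> ev (t_sign_at t) e = sign_at s m.
Proof.
move=> E; refine (ev_call1 _ E) => r.
apply: ev_and; first by apply: ev_lt => //; apply: ev_t_run_len.
by apply: ev_t_bit; apply: ev_sub => //; apply: ev_t_run_len.
Qed.

Lemma ev_t_lit_end t t' e m n : ev t e = m -> ev t' e = n ->
  ev (t_lit_end t t') e = lit_end s m n.
Proof.
move=> E E'; refine (ev_call2 _ E E') => r.
apply: ev_and; first exact: ev_t_sep.
by apply: ev_t_unreset => // t0 e' m' H; exact: ev_t_sep.
Qed.

Lemma ev_t_has_later t q1 m r q : ev t [:: q1, m & r] = q ->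
  ev (t_has_later t) [:: q1, m & r] =
  has (fun q2 => [&& q1 < q2, lit_end s m q2 & same_key s q2 q]) (iota 0 m).
Proof.
move=> E; apply: ev_ex => // q2 _; apply: ev_and; first exact: ev_lt.
by apply: ev_and; [exact: ev_t_lit_end|apply: ev_t_same_key].
Qed.

Lemma ev_t_var_rank t t' e m n : ev t e = m -> ev t' e = n ->
  ev (t_var_rank t t') e = var_rank s m n.
Proof.
move=> E E'; refine (ev_call2 _ E E') => r.
apply: ev_count => // q _; apply: ev_and; first exact: ev_t_lit_end.
by apply: ev_and; [apply: ev_not|]; apply: ev_t_has_later.
Qed.

Lemma ev_t_num_names t e m : ev t e = m -> ev (t_num_names t) e = size (undup (names s
  m)).
Proof.
move=> E; refine (ev_call1 _ E) => r.
rewrite size_undup_names; apply: ev_count => // q _.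
by apply: ev_and; [exact: ev_t_lit_end|apply: ev_not; exact: ev_t_has_later].
Qed.

Lemma ev_t_lit_code t t' e m n : ev t e = m -> ev t' e = n ->
  ev (t_lit_code t t') e = lit_code_at s m n.
Proof.
move=> E E'; apply: ev_add; last exact: ev_t_sign_at.
by apply: ev_mul => //; apply: ev_t_var_rank.
Qed.

Lemma ev_t_nlits e : ev t_nlits e = nlits k.
Proof. exact: (ev_mul (a := #2) (erefl 2) (ev_t_param e)). Qed.

Lemma ev_t_ntriples e : ev t_ntriples e = ntriples k.
Proof. exact: ev_mul (ev_mul (ev_t_nlits e) (ev_t_nlits e)) (ev_t_nlits e). Qed.

Lemma ev_t_npos e : ev t_npos e = npos k.
Proof. exact: ev_add (ev_t_param e) (ev_t_ntriples e). Qed.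

Lemma ev_t_nitems e : ev t_nitems e = nitems k.
Proof. exact: ev_add (ev_t_nlits e) (ev_mul (a := #3) (erefl 3) (ev_t_ntriples e)). Qed.

Lemma ev_t_triple0 t e m : ev t e = m -> ev (t_triple0 t) e = m %/ (nlits k * nlits k).
Proof. by move=> E; exact: ev_div E (ev_mul (ev_t_nlits e) (ev_t_nlits e)). Qed.

Lemma ev_t_triple1 t e m : ev t e = m -> ev (t_triple1 t) e = (m %/ nlits k) %% nlits k.
Proof. by move=> E; exact: ev_mod (ev_div E (ev_t_nlits e)) (ev_t_nlits e). Qed.

Lemma ev_t_triple2 t e m : ev t e = m -> ev (t_triple2 t) e = m %% nlits k.
Proof. by move=> E; exact: ev_mod E (ev_t_nlits e). Qed.

Lemma ev_t_in_triple t t' e m n : ev t e = m -> ev t' e = n ->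
  ev (t_in_triple t t') e = (m \in triple k n).
Proof.
move=> E E'; refine (ev_call2 _ E E') => r; rewrite /triple !inE.
apply: ev_or; first by apply: ev_eq => //; apply: ev_t_triple0.
by apply: ev_or; apply: ev_eq => //; [apply: ev_t_triple1|apply: ev_t_triple2].
Qed.

Lemma ev_t_present t t' e m n : ev t e = m -> ev t' e = n ->
  ev (t_present t t') e = present s k m n.
Proof.
move=> E E'; refine (ev_call2 _ E E') => r.
apply: ev_ex => // p _; apply: ev_and; first exact: ev_t_sep.
apply: ev_and; first by apply: ev_t_unreset => // t0 e' m' H; exact: ev_t_sep.
apply: ev_all => // q _; apply: ev_imp.
  apply: ev_and; first exact: ev_t_sep.
  by apply: ev_t_unreset => // t0 e' m' H; exact: ev_t_sep.
by apply: ev_t_in_triple => //; apply: ev_t_lit_code.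
Qed.

Lemma ev_t_same_triples t t' e m n : ev t e = m -> ev t' e = n ->
  ev (t_same_triples t t') e = same_triples s k m n.
Proof.
move=> E E'; refine (ev_call2 _ E E') => r.
apply: ev_all; first exact: ev_t_ntriples.
by move=> i _; apply: ev_eqb; apply: ev_t_present.
Qed.

Lemma ev_t_block_end t e m : ev t e = m -> ev (t_block_end t) e = block_end s k m.
Proof.
move=> E; refine (ev_call1 _ E) => r; apply: ev_and; first exact: ev_t_sep.
apply: ev_not; apply: ev_ex; first exact: ev_t_size.
move=> e' _; apply: ev_and; first exact: ev_lt.
by apply: ev_and; [exact: ev_t_sep|exact: ev_t_same_triples].
Qed.

Lemma ev_t_block_index t e m : ev t e = m ->
  ev (t_block_index t) e = count (block_end s k) (iota 0 m).
Proof.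
by move=> E; refine (ev_call1 _ E) => r; apply: ev_count => // e' _;
  exact: ev_t_block_end.
Qed.

Lemma ev_t_nblocks e : ev t_nblocks e = size (block_ends s k).
Proof. by rewrite size_filter; apply: ev_t_block_index; exact: ev_t_size. Qed.
End Evaluation.

Local Notation symbol_gen := (gen (option symbol)).

Definition f_vnext : symbol_term :=
  let f := t_bit false (V 1) in let t := t_bit true (V 1) in let q := V 0 in
  tif (tlt q #2) (tif (tor f t) #5 (tif (t_sep 2 (V 1)) #0 #2))
  (tif (teq q #2) #2
  (tif (teq (tmod q #4) #0)
     (tif (tmul (tor f t) (tlt q #12)) (TAdd q #5) (tif (t_sep 1 (V 1)) #1 #2))
  (tif (teq (tmod q #4) #1) (tif t (TAdd q #2) (tif f (TAdd q #1) #2))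
  (tif (teq (tmod q #4) #2) (tif (t_sep 0 (V 1)) (tsub q #2) #2)
     (tif (tor f t) q (tif (t_sep 0 (V 1)) (tsub q #3) #2)))))).

(* The accumulator may only decrease, so the state q of the automaton after i
   symbols is stored as 16 (|s| - i) + q. *)
Definition t_vrun : symbol_term :=
  TDwn t_size (tmul #16 t_size)
    (tsub (V 1) (TAdd (tmul #16 (tsub t_size (TAdd (V 0) #1)))
       (call2 f_vnext (tsub (V 1) (tmul #16 (tsub t_size (V 0)))) (V 0)))).

Definition t_valid : symbol_term := tmul (teq t_vrun #0)
  (tall t_size (timp (t_sep 2 (V 0)) (tle (t_num_names (V 0)) t_param))).

Definition f_occurrences : symbol_term := TAdd (teq (t_triple0 (V 1)) (V 0))
  (TAdd (teq (t_triple1 (V 1)) (V 0)) (teq (t_triple2 (V 1)) (V 0))).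

Definition f_digit : symbol_term :=
  tif (tlt (V 0) t_nlits)
    (tif (tlt (V 1) t_param) (teq (tdiv (V 0) #2) (V 1))
       (tif (tlt (V 1) t_npos) (call2 f_occurrences (V 0) (tsub (V 1) t_param)) #0))
    (teq (V 1) (TAdd t_param (tdiv (tsub (V 0) t_nlits) #3))).
Definition t_digit := call2 f_digit.

Definition t_target p : symbol_term := tif (tlt p t_param) #1 (tif (tlt p t_npos) #3
  #0).

Definition t_disabled e a : symbol_term :=
  tmul (tle t_nlits a) (tmul (teq (tmod (tsub a t_nlits) #3) #2)
    (t_present e (tdiv (tsub a t_nlits) #3))).

Definition t_odd t : symbol_term := tmod t #2.

(** The term form of [num_bit]; [d] finds the digit index in variable 0. *)
Definition t_digit_bit (d r : symbol_term) : symbol_term :=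
  TLet (tdiv r t_width) (t_odd (tshr d (TSh (tmod r t_width)))).

Definition t_numbits : symbol_term := tmul (TAdd t_npos #1) t_width.

Definition g_sym (a : symbol) : symbol_gen := GEmit (Some a).
Definition g_if (c : symbol_term) (g : symbol_gen) : symbol_gen := GFor c (GSh g).

(* [d j] computes the digit of index p in the contexts [p :: junk ++ ctx] with
   [size junk = j]. *)
Definition g_bits (d : nat -> symbol_term) : symbol_gen :=
  let r := tsub (tsub t_numbits #1) (V 0) in
  let shown := TLet r (tor (teq (V 0) #0)
     (tex t_numbits (tmul (tle (V 1) (V 0)) (t_digit_bit (d 3) (V 0))))) in
  let bit := t_digit_bit (d 1) r in
  GFor t_numbits (GSeq (g_if (tmul shown bit) (g_sym (inl true)))
                       (g_if (tmul shown (tnot bit)) (g_sym (inl false)))).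

Definition g_nat d : symbol_gen := GSeq (g_bits d) (g_sym (sep 0)).

Lemma flatten_if (T S : Type) (h : T -> S) (P : pred T) l :
  flatten [seq if P i then [:: h i] else [::] | i <- l] = [seq h i | i <- l & P i].
Proof. by elim: l => //= i l ->; case: (P i). Qed.

Section Evaluation.
Variables (s : seq symbol) (k : nat).
Local Notation x := (encode_pair (s, k)).
Local Notation ev := (ev x).
Local Notation gev := (gev x).
Implicit Types (t : symbol_term) (e : seq nat).

Lemma ev_f_vnext q i e :
  ev f_vnext [:: q, i & e] =
  vnext q (at_bit s false i) (at_bit s true i) (at_sep s 0 i) (at_sep s 1 i) (at_sep s
    2 i).
Proof.
have Ef : ev (t_bit false (V 1)) [:: q, i & e] = at_bit s false i by exact: ev_t_bit.
have Et : ev (t_bit true (V 1)) [:: q, i & e] = at_bit s true i by exact: ev_t_bit.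
have E0 : ev (t_sep 0 (V 1)) [:: q, i & e] = at_sep s 0 i by exact: ev_t_sep.
have E1 : ev (t_sep 1 (V 1)) [:: q, i & e] = at_sep s 1 i by exact: ev_t_sep.
have E2 : ev (t_sep 2 (V 1)) [:: q, i & e] = at_sep s 2 i by exact: ev_t_sep.
rewrite /vnext /f_vnext.
by do ?[exact: Ef|exact: Et|exact: E0|exact: E1|exact: E2|ev_step].
Qed.

(** The largest state is [4 * 3 + 3]. This justifies the radix 16 in [t_vrun]: when a symbol is
    read, the loss of 16 outweighs any change of state, so the accumulator never increases. *)
Lemma vnext_lt q (c0 c1 b0 b1 b2 : bool) : q < 16 -> vnext q c0 c1 b0 b1 b2 < 16.
Proof.
rewrite /vnext => Hq.
have : q %/ 4 < 4 by rewrite ltn_divLR.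
have : q %% 4 < 4 by rewrite ltn_mod.
rewrite {3 5 6 7 8 9 10 11}(divn_eq q 4).
by do 20?[case: ifP => [?|?]] => //; lia.
Qed.

Lemma ev_t_vrun e : ev t_vrun e = vrun s.
Proof.
pose q i v := v - 16 * (size s - i).
pose next i v := 16 * (size s - i.+1) +
  vnext (q i v) (at_bit s false i) (at_bit s true i) (at_sep s 0 i) (at_sep s 1 i)
    (at_sep s 2 i).
rewrite /t_vrun (ev_dwn (N := size s) (m := 16 * size s) (F := fun i v => v - next i
  v)).
- suff H j : j <= size s -> foldl vstep 0 (take j s) < 16 /\
      iteri j (fun i v => v - (v - next i v)) (16 * size s) =
      16 * (size s - j) + foldl vstep 0 (take j s).
    by have [_ ->] := H _ (leqnn _); rewrite take_size subnn.
  elim: j => [|j IH] Hj; first by rewrite take0 /= subn0 addn0.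
  have [Hlt E] := IH (ltnW Hj); rewrite [iteri _ _ _]/= E.
  have [a Ha] : exists a, onth s j = Some a.
    by move: Hj; rewrite -onthTE; case: (onth s j) => // a _; exists a.
  have Hn : nth a s j = a by exact: onth_nth.
  rewrite (take_nth a) // Hn foldl_rcons.
  have Eq : q j (16 * (size s - j) + foldl vstep 0 (take j s)) = foldl vstep 0 (take j
    s).
    by rewrite /q addKn.
  move: (foldl vstep 0 _) Hlt Eq {E} => u Hu Eq.
  have Ev : next j (16 * (size s - j) + u) = 16 * (size s - j.+1) + vstep u a.
    by rewrite /next Eq /vstep /at_bit /at_sep Ha.
  have Hv : vstep u a < 16 by exact: vnext_lt.
  by split=> //; rewrite Ev; lia.
- exact: ev_t_size.
- exact: (ev_mul (a := #16) (erefl 16) (ev_t_size s k e)).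
- move=> i v; apply: ev_sub => //; rewrite /next -[i.+1]addn1.
  apply: ev_add.
    apply: (ev_mul (a := #16) (erefl 16)); apply: ev_sub; first exact: ev_t_size.
    exact: (ev_add (a := V 0) (b := #1)).
  refine (ev_call2 (m := q i v) (n := i) _ _ _) => [r||//]; first exact: ev_f_vnext.
  apply: ev_sub => //; apply: (ev_mul (a := #16) (erefl 16)).
  by apply: (ev_sub (b := V 0)); first exact: ev_t_size.
Qed.

Lemma ev_t_valid e : ev t_valid e = valid s k.
Proof.
apply: ev_and; first exact: ev_eq (ev_t_vrun e) (erefl (ev #0 e)).
rewrite all_filter; apply: ev_all; first exact: ev_t_size.
move=> i _; apply: ev_imp; first exact: ev_t_sep.
by apply: ev_le; [exact: ev_t_num_names|exact: ev_t_param].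
Qed.

Lemma ev_f_occurrences a n e : ev f_occurrences [:: a, n & e] = count_mem a (triple k
  n).
Proof.
rewrite /triple [count _ _]/= addn0; apply: ev_add.
  by apply: ev_eq => //; apply: ev_t_triple0.
apply: ev_add; first by apply: ev_eq => //; apply: ev_t_triple1.
by apply: ev_eq => //; apply: ev_t_triple2.
Qed.

Lemma ev_t_digit t t' e a p : ev t e = a -> ev t' e = p -> ev (t_digit t t') e = digit
  k a p.
Proof.
move=> E E'; refine (ev_call2 _ E E') => r; rewrite /digit.
apply: ev_if; first exact: ev_lt (erefl _) (ev_t_nlits _ _ _).
  apply: ev_if; first exact: ev_lt (erefl _) (ev_t_param _ _ _).
    by apply: ev_eq => //; apply: (ev_div (b := #2)).
  apply: ev_if => //; first exact: ev_lt (erefl _) (ev_t_npos _ _ _).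
  refine (ev_call2 (n := p - k) _ _ _) => [r'||]; first exact: ev_f_occurrences.
    by [].
  by apply: ev_sub => //; exact: ev_t_param.
apply: ev_eq => //; apply: ev_add; first exact: ev_t_param.
apply: (ev_div (b := #3)) => //; apply: ev_sub => //; exact: ev_t_nlits.
Qed.

Lemma ev_t_target t e p : ev t e = p -> ev (t_target t) e = target k p.
Proof.
move=> E; apply: ev_if => //; first exact: ev_lt E (ev_t_param _ _ _).
by apply: ev_if => //; exact: ev_lt E (ev_t_npos _ _ _).
Qed.

Lemma ev_t_disabled t t' e m a (pr : nat -> nat -> bool) i :
  ev t e = m -> ev t' e = a -> pr i = present s k m -> ev (t_disabled t t') e =
    disabled k pr i a.
Proof.
move=> E E' Ep; rewrite /disabled Ep.
have Es : ev (tsub t' t_nlits) e = a - nlits k by exact: ev_sub E' (ev_t_nlits _ _ _).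
apply: ev_and; first exact: ev_le (ev_t_nlits _ _ _) E'.
apply: ev_and; first by apply: ev_eq => //; apply: (ev_mod (b := #3)).
by apply: ev_t_present => //; apply: (ev_div (b := #3)).
Qed.

(** The largest digits are those of the threshold, at most $3n^2$ with [n] at most [2 ^ ntriples k],
    and 3 is below [2 ^ 3]. *)
Definition width := 2 * ntriples k + 3.

Lemma ev_t_width e : ev t_width e = width.
Proof.
exact: ev_add (ev_mul (a := #2) (erefl 2) (ev_t_ntriples s k e)) (erefl (ev #3 e)).
Qed.

Lemma ev_t_numbits e : ev t_numbits e = (npos k).+1 * width.
Proof.
apply: ev_mul; last exact: ev_t_width.
by rewrite (ev_add (ev_t_npos s k e) (erefl (ev #1 e))) addn1.
Qed.

Lemma ev_t_digit_bit d t e m v : ev t e = m -> ev d (m %/ width :: e) = v ->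
  ev (t_digit_bit d t) e = odd (v %/ 2 ^ (m %% width)).
Proof.
move=> E Ed; rewrite -[LHS]/(ev (t_odd (tshr d (TSh (tmod t t_width)))) (ev (tdiv t
  t_width) e :: e)).
rewrite (ev_div E (ev_t_width e)) -modn2; apply: (ev_mod (b := #2)) => //.
by apply: ev_shr => //; exact: ev_mod E (ev_t_width e).
Qed.

Lemma ev_let t t' e : ev (TLet t t') e = ev t' (ev t e :: e).
Proof. by []. Qed.

Lemma gev_for n g e : gev (GFor n g) e = flatten [seq gev g (i :: e) | i <- iota 0 (ev
  n e)].
Proof. by []. Qed.

Lemma gev_seq g1 g2 e : gev (GSeq g1 g2) e = gev g1 e ++ gev g2 e.
Proof. by []. Qed.

Lemma gev_if c g e (P : bool) : ev c e = P -> gev (g_if c g) e = if P then gev g e else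
  [::].
Proof. by move=> E; rewrite /= E; case: P {E}; rewrite //= cats0. Qed.

(** A nonzero number keeps its leading 1 until it is shifted to 0. Leading zeros are thus recognized
    from single bits, without storing the number. *)
Lemma divpow_gt0 N R r : N < 2 ^ R ->
  (0 < N %/ 2 ^ r) = has (fun r' => (r <= r') && odd (N %/ 2 ^ r')) (iota 0 R).
Proof.
move=> HN; apply/idP/hasP => [H|[r' _ /andP[Hr Ho]]]; last first.
  rewrite divn_gt0 ?expn_gt0 //; apply: (@leq_trans (2 ^ r'));
    first by rewrite leq_exp2l.
  by rewrite -divn_gt0 ?expn_gt0 //; case: (_ %/ _) Ho.
have N0 : 0 < N by rewrite lt0n; apply: contraTneq H => ->; rewrite div0n.
have /andP[H1 H2] := trunc_log_bounds (isT : 1 < 2) N0.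
exists (trunc_log 2 N).
  by rewrite mem_iota /= add0n -(ltn_exp2l _ _ (isT : 1 < 2)); exact: leq_ltn_trans HN.
rewrite trunc_log_max //=; last by move: H; rewrite divn_gt0 ?expn_gt0.
suff -> : N %/ 2 ^ trunc_log 2 N = 1 by [].
apply/eqP; rewrite eqn_leq divn_gt0 ?expn_gt0 // H1 andbT -ltnS ltn_divLR ?expn_gt0 //.
by rewrite -expnS.
Qed.

Lemma gev_bits d ctx (g : nat -> nat) :
  (forall p r, ev (d 1) [:: p, r & ctx] = g p) ->
  (forall p r1 r2 r3, ev (d 3) [:: p, r1, r2, r3 & ctx] = g p) ->
  (forall p, p < (npos k).+1 -> g p < 2 ^ width) ->
  gev (g_bits d) ctx = [seq Some (inl c) | c <- bin (num width (npos k).+1 g)].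
Proof.
move=> H1 H3 Hg; set N := num _ _ _; set R := (npos k).+1 * width.
have w0 : 0 < width by rewrite /width addn3.
have HN : N < 2 ^ R by rewrite /R mulnC expnM; exact: num_lt.
have R0 : 0 < R by rewrite /R muln_gt0 w0.
have Hbit r : r < R -> odd (g (r %/ width) %/ 2 ^ (r %% width)) = odd (N %/ 2 ^ r).
  by move=> Hr; rewrite num_bit.
rewrite (bin_bits (K := R.-1)) ?prednK //.
rewrite filter_map -!map_comp -flatten_if.
rewrite /g_bits gev_for ev_t_numbits -/R; congr flatten; apply/eq_in_map => i;
  rewrite mem_iota => /andP[_ Hi].
set r := R.-1 - i; have Hr : r < R by rewrite /r; lia.
have Er : ev (tsub (tsub t_numbits #1) (V 0)) (i :: ctx) = r.
  rewrite /r -subn1; apply: ev_sub => //; apply: (ev_sub (b := #1)) => //.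
  exact: ev_t_numbits.
have Eb : ev (t_digit_bit (d 1) (tsub (tsub t_numbits #1) (V 0))) (i :: ctx) = odd (N
  %/ 2 ^ r).
  by rewrite (ev_t_digit_bit Er (H1 _ _)) Hbit.
have Es : ev (TLet (tsub (tsub t_numbits #1) (V 0)) (tor (teq (V 0) #0)
     (tex t_numbits (tmul (tle (V 1) (V 0)) (t_digit_bit (d 3) (V 0)))))) (i :: ctx) =
     (r == 0) || (0 < N %/ 2 ^ r).
  rewrite ev_let Er (divpow_gt0 _ HN).
  apply: ev_or; first exact: (ev_eq (b := #0)).
  apply: ev_ex; first exact: ev_t_numbits.
  move=> j Hj; apply: ev_and; first exact: ev_le.
  by rewrite (ev_t_digit_bit (m := j) _ (H3 _ _ _ _)) // Hbit.
rewrite gev_seq (gev_if _ (ev_and Es Eb)) (gev_if _ (ev_and Es (ev_not Eb))) /= -/r.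
by case: ((r == 0) || _); case: (odd _).
Qed.

Lemma gev_nat d ctx (g : nat -> nat) :
  (forall p r, ev (d 1) [:: p, r & ctx] = g p) ->
  (forall p r1 r2 r3, ev (d 3) [:: p, r1, r2, r3 & ctx] = g p) ->
  (forall p, p < (npos k).+1 -> g p < 2 ^ width) ->
  gev (g_nat d) ctx = map Some (encode_nat (num width (npos k).+1 g)).
Proof.
move=> H1 H3 Hg; rewrite gev_seq (gev_bits H1 H3 Hg) /encode_nat map_rcons -cats1.
by rewrite -[map Some (map _ _)]map_comp.
Qed.
End Evaluation.

(** In the context, the digit index and [j] auxiliary values are followed by the item and the
    formula end. The block number is the number of block ends before that position. *)
Definition d_ptime j : symbol_term :=
  tif (t_disabled (V j.+2) (V j.+1)) (teq (V 0) t_npos) (t_digit (V j.+1) (V 0)).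
Definition d_weight j : symbol_term :=
  tmul (tsub t_nblocks (t_block_index (V j.+2))) (t_digit (V j.+1) (V 0)).
Definition d_due j : symbol_term := tmul (TAdd (t_block_index (V j.+2)) #1) (t_target
  (V 0)).
Definition d_threshold (j : nat) : symbol_term :=
  tmul (TSum t_nblocks (tsub t_nblocks (V 0))) (t_target (V 0)).
Definition d_one (j : nat) : symbol_term := teq (V 0) #0.
Definition d_top (j : nat) : symbol_term := teq (V 0) t_npos.

Definition g_job dp dw dd : symbol_gen := GSeq (g_nat dp) (GSeq (g_nat dw) (g_nat dd)).

Definition g_instance : symbol_gen :=
  GSeq (GSeq (g_sym (inl false)) (g_nat d_threshold))
 (GSeq (GFor t_size (g_if (t_block_end (V 0)) (GFor t_nitems (g_job d_ptime d_weight
   d_due))))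
 (GSeq (g_job d_one d_top d_top)
       (GFor (TAdd (tmul t_width t_npos) #1) (GEmit None)))).

Definition g_reduction : symbol_gen := g_if t_valid g_instance.

Lemma map_iota_blocks (T : Type) (F : nat -> T) n m :
  [seq F j | j <- iota 0 (n * m)] =
  flatten [seq [seq F (i * m + a) | a <- iota 0 m] | i <- iota 0 n].
Proof.
elim: n => [//|n IH]; rewrite iotaSr map_rcons flatten_rcons -IH mulSn addnC iotaD
  map_cat.
congr cat; rewrite add0n -{1}[n * m]addn0 iotaDl -map_comp.
by apply: eq_map => a.
Qed.

(** A position satisfying [P] with [i] such positions before it is entry [i] of the filtered list;
    so the loop over input positions runs through the blocks in order. *)
Lemma flatten_positions (T : Type) (P : pred nat) (h : nat -> nat -> seq T) n :
  flatten [seq if P e then h (count P (iota 0 e)) e else [::] | e <- iota 0 n] =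
  flatten [seq h i (nth 0 [seq e <- iota 0 n | P e] i) | i <- iota 0 (count P (iota 0
    n))].
Proof.
rewrite -size_filter; elim: n => [//|n IH]; rewrite iotaSr map_rcons flatten_rcons IH
  filter_rcons add0n.
case HP: (P n); last by rewrite cats0.
rewrite size_rcons iotaSr map_rcons flatten_rcons add0n nth_rcons ltnn eqxx
  -size_filter.
congr (flatten _ ++ _); apply/eq_in_map => i; rewrite mem_iota => /andP[_ Hi].
by rewrite nth_rcons Hi.
Qed.

Lemma flatten_map_flatten (T S : Type) (h : T -> seq S) ll :
  flatten [seq h j | j <- flatten ll] = flatten [seq flatten [seq h j | j <- l] | l <-
    ll].
Proof. by elim: ll => //= l ll <-; rewrite map_cat flatten_cat. Qed.

Section Reduction.
Variables (s : seq symbol) (k : nat).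
Local Notation x := (encode_pair (s, k)).
Local Notation ev := (ev x).
Local Notation gev := (gev x).

Definition nblocks := size (block_ends s k).
Definition block_present i := present s k (nth 0 (block_ends s k) i).
Definition instance_jobs := job_list k (width k) nblocks block_present.
Definition instance_threshold := threshold k (width k) nblocks.

Lemma width_gt2 : 2 < width k. Proof. by rewrite /width addn3. Qed.

Lemma sum_sub n : \sum_(i < n) (n - i) <= n * n.
Proof.
apply: (@leq_trans (\sum_(i < n) n)); last by rewrite sum_nat_const card_ord.
by apply: leq_sum => i _; exact: leq_subr.
Qed.

Lemma nblocks_square : 3 * (nblocks * nblocks) < 2 ^ width k.
Proof.
have H := size_block_ends s k; rewrite -/nblocks in H.
rewrite /width expnD mul2n -addnn expnD.
apply: (@leq_ltn_trans (3 * (2 ^ ntriples k * 2 ^ ntriples k))).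
  by rewrite leq_mul2l leq_mul.
by rewrite [_ * 2 ^ 3]mulnC ltn_mul2r muln_gt0 !expn_gt0.
Qed.

Lemma nblocks_small : 3 * nblocks < 2 ^ width k.
Proof.
apply: leq_ltn_trans nblocks_square; rewrite leq_mul2l /=.
by case: (nblocks) => // n; rewrite leq_pmulr.
Qed.

Lemma gev_job dp dw dd ctx (p w d : nat -> nat) :
  (forall q r, ev (dp 1) [:: q, r & ctx] = p q) ->
  (forall q r1 r2 r3, ev (dp 3) [:: q, r1, r2, r3 & ctx] = p q) ->
  (forall q r, ev (dw 1) [:: q, r & ctx] = w q) ->
  (forall q r1 r2 r3, ev (dw 3) [:: q, r1, r2, r3 & ctx] = w q) ->
  (forall q r, ev (dd 1) [:: q, r & ctx] = d q) ->
  (forall q r1 r2 r3, ev (dd 3) [:: q, r1, r2, r3 & ctx] = d q) ->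
  (forall q, p q < 2 ^ width k) -> (forall q, w q < 2 ^ width k) ->
  (forall q, d q < 2 ^ width k) ->
  gev (g_job dp dw dd) ctx = map Some (encode_job
    (Job (num (width k) (npos k).+1 p) (num (width k) (npos k).+1 w) (num (width k)
      (npos k).+1 d))).
Proof.
move=> P1 P3 W1 W3 D1 D3 Hp Hw Hd; rewrite /encode_job !map_cat.
rewrite -[LHS]/(gev (g_nat dp) ctx ++ gev (g_nat dw) ctx ++ gev (g_nat dd) ctx).
by rewrite (gev_nat P1 P3) // (gev_nat W1 W3) // (gev_nat D1 D3).
Qed.

Lemma gev_item e a : block_end s k e -> a < nitems k -> e < size s ->
  gev (g_job d_ptime d_weight d_due) [:: a; e] =
  map Some (encode_job (item_job k (width k) nblocks block_present
    (count (block_end s k) (iota 0 e)) a)).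
Proof.
move=> He Ha Hes; set i := count _ _.
have Q : block_present i = present s k e.
  rewrite /block_present /block_ends /i -size_filter.
  have -> : iota 0 (size s) = iota 0 e ++ e :: iota e.+1 (size s - e.+1).
    by rewrite -[e :: _]/(iota e (size s - e.+1).+1) -{2}[e]add0n -iotaD; congr iota;
      lia.
  by rewrite filter_cat /= He nth_cat ltnn subnn.
have Hi : i < nblocks.
  rewrite /i /nblocks /block_ends size_filter.
  have -> : iota 0 (size s) = iota 0 e ++ e :: iota e.+1 (size s - e.+1).
    by rewrite -[e :: _]/(iota e (size s - e.+1).+1) -{2}[e]add0n -iotaD; congr iota;
      lia.
  by rewrite count_cat /= He -[X in X < _]addn0 ltn_add2l.
have B8 : 3 < 2 ^ width k by apply: (@leq_trans (2 ^ 3)) => //;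
  rewrite leq_exp2l // width_gt2.
have Hn := nblocks_small.
rewrite (gev_job (p := fun q => if disabled k block_present i a then nat_of_bool (q ==
  npos k) else digit k a q)
   (w := fun q => (nblocks - i) * digit k a q) (d := fun q => i.+1 * target k q)).
- rewrite /item_job; case: (disabled _ _ _ _) => //.
- move=> q r; apply: ev_if; first exact: ev_t_disabled.
    by apply: ev_eq; [|exact: ev_t_npos].
  exact: ev_t_digit.
- move=> q r1 r2 r3; apply: ev_if; first exact: ev_t_disabled.
    by apply: ev_eq; [|exact: ev_t_npos].
  exact: ev_t_digit.
- move=> q r; apply: ev_mul; last exact: ev_t_digit.
  by apply: ev_sub; [exact: ev_t_nblocks|exact: ev_t_block_index].
- move=> q r1 r2 r3; apply: ev_mul; last exact: ev_t_digit.
  by apply: ev_sub; [exact: ev_t_nblocks|exact: ev_t_block_index].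
- move=> q r; apply: ev_mul; last exact: ev_t_target.
  by rewrite -[i.+1]addn1; apply: ev_add; first exact: ev_t_block_index.
- move=> q r1 r2 r3; apply: ev_mul; last exact: ev_t_target.
  by rewrite -[i.+1]addn1; apply: ev_add; first exact: ev_t_block_index.
- move=> q; case: ifP => _; first by apply: leq_ltn_trans B8; case: eqP.
  by apply: leq_ltn_trans B8; exact: digit_le.
- move=> q; apply: leq_ltn_trans Hn; rewrite mulnC leq_mul ?digit_le //;
    exact: leq_subr.
- by move=> q; apply: leq_ltn_trans Hn; rewrite mulnC leq_mul ?target_le.
Qed.

Lemma gev_last e : gev (g_job d_one d_top d_top) e = map Some (encode_job (last_job k
  (width k))).
Proof.
have H1 q r : ev (d_one 1) (q :: r) = (q == 0) by exact: (ev_eq (b := #0)).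
have H2 q r : ev (d_top 1) (q :: r) = (q == npos k).
  by apply: ev_eq; [|exact: ev_t_npos].
have L (c : bool) : c < 2 ^ width k 
    by case: c; rewrite ?expn_gt0 //; apply: (@leq_trans (2 ^ 3)) => //;
      rewrite leq_exp2l // width_gt2.
by rewrite (gev_job (p := fun q => nat_of_bool (q == 0)) (w := fun q => nat_of_bool (q
  == npos k)) (d := fun q => nat_of_bool (q == npos k))).
Qed.

Lemma gev_threshold e : gev (g_nat d_threshold) e = map Some (encode_nat
  instance_threshold).
Proof.
have H q r : ev (d_threshold 1) (q :: r) = (\sum_(i < nblocks) (nblocks - i)) * target
  k q.
  apply: ev_mul; last exact: ev_t_target.
  apply: (ev_sum (F := fun i => nblocks - i)); first exact: ev_t_nblocks.
  by move=> i _; apply: ev_sub; first exact: ev_t_nblocks.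
rewrite (gev_nat (g := fun q => (\sum_(i < nblocks) (nblocks - i)) * target k q)) //.
move=> q _; apply: leq_ltn_trans nblocks_square; rewrite mulnC.
by rewrite leq_mul ?target_le ?sum_sub.
Qed.

Definition reduction_string : seq symbol :=
  encode_int (instance_threshold)%:Z ++ flatten [seq encode_job j | j <- instance_jobs].

Lemma gev_jobs :
  gev (GFor t_size (g_if (t_block_end (V 0)) (GFor t_nitems (g_job d_ptime d_weight
    d_due)))) [::] ++
  gev (g_job d_one d_top d_top) [::] =
  map Some (flatten [seq encode_job j | j <- instance_jobs]).
Proof.
rewrite gev_last /instance_jobs /job_list iotaSr add0n map_rcons map_rcons
  flatten_rcons map_cat.
rewrite job_at_last; congr cat.
rewrite map_iota_blocks gev_for ev_t_size.
pose h i (e : nat) := map Some (flatten [seq encode_job (item_job k (width k) nblocks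
  block_present i a)
  | a <- iota 0 (nitems k)]).
transitivity (flatten [seq if block_end s k e then h (count (block_end s k) (iota 0 e))
  e else [::]
  | e <- iota 0 (size s)]).
  congr flatten; apply/eq_in_map => e; rewrite mem_iota add0n => /andP[_ Hes].
  rewrite (gev_if _ (P := block_end s k e)); last exact: ev_t_block_end.
  case: ifP => // He; rewrite gev_for ev_t_nitems /h map_flatten -map_comp.
  congr flatten; apply/eq_in_map => a; rewrite mem_iota add0n => /andP[_ Ha].
  exact: gev_item.
rewrite flatten_positions -size_filter -/(block_ends s k) -/nblocks.
rewrite flatten_map_flatten -map_comp map_flatten -map_comp.
congr flatten; apply/eq_in_map => i; rewrite mem_iota add0n => /andP[_ Hi].
rewrite /h /comp -map_comp; congr (map _ (flatten _)).
apply/eq_in_map => a; rewrite mem_iota add0n => /andP[_ Ha].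
by rewrite /comp job_at_item.
Qed.

Lemma gev_param : gev (GFor (TAdd (tmul t_width t_npos) #1) (GEmit None)) [::] =
  nseq (width k * npos k).+1 None.
Proof.
rewrite gev_for.
rewrite (ev_add (ev_mul (ev_t_width s k _) (ev_t_npos s k _)) (erefl (ev #1 [::])))
  addn1.
by rewrite -[in RHS](size_iota 0 (width k * npos k).+1); elim: (iota _ _) => //= i l ->.
Qed.

Lemma gev_reduction : gev g_reduction [::] =
  encode_pair (if valid s k then (reduction_string, (width k * npos k).+1) else ([::],
    0)).
Proof.
rewrite (gev_if _ (ev_t_valid s k [::])); case: ifP => // _.
rewrite -[RHS]/(map Some reduction_string ++ nseq (width k * npos k).+1 None)
  -gev_param /reduction_string.
have -> : map Some (encode_int instance_threshold%:Z ++ flatten [seq encode_job j | j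
  <- instance_jobs]) =
    Some (inl false) :: map Some (encode_nat instance_threshold) ++
    map Some (flatten [seq encode_job j | j <- instance_jobs]).
  by rewrite map_cat.
rewrite -(gev_threshold [::]) -gev_jobs /g_instance.
set N := gev (g_nat d_threshold) [::]; set F := gev (GFor t_size _) [::].
set L := gev (g_job _ _ _) [::]; set Q := gev (GFor (TAdd _ _) _) [::].
rewrite -[LHS]/((Some (inl false) :: N) ++ (F ++ (L ++ Q))).
by move: N F L Q => N F L Q; rewrite !cat_cons !catA.
Qed.
End Reduction.

(** Every encoding of a scheduling instance begins with a sign bit, so the empty word is a
    no-instance. *)
Definition reduction (y : seq symbol * nat) : seq symbol * nat :=
  if valid y.1 y.2 then (reduction_string y.1 y.2, (width y.2 * npos y.2).+1) else
    ([::], 0).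

Lemma polytime_reduction : polytime reduction.
Proof.
apply: (polytime_gen (g := g_reduction)) => -[s k]; exact: gev_reduction.
Qed.

(** The terminator is not a digit, so numerals are prefix-free. As the target problem asks for some
    jobs and some bound encoded by the word, the word must determine them. *)
Lemma encode_nat_inj m n u v : encode_nat m ++ u = encode_nat n ++ v -> m = n /\ u = v.
Proof.
rewrite /encode_nat !cat_rcons => E.
suff [Eb ->] : bin m = bin n /\ u = v by rewrite (bin_inj Eb).
move: (bin m) (bin n) E; elim=> [|a ds IH] [|c ds'] //= [].
  by move=> ->.
by move=> -> /IH[-> ->].
Qed.

Lemma encode_int_inj v w t u : encode_int v ++ t = encode_int w ++ u -> v = w /\ t = u.
Proof.
rewrite /encode_int !cat_cons => -[Es /encode_nat_inj[En ->]]; split=> //.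
by case: v w Es En => [m|m] [n|n] //= _ => [->|[->]].
Qed.

Lemma encode_jobs_inj J J' : flatten [seq encode_job j | j <- J] = flatten [seq
  encode_job j | j <- J'] -> J = J'.
Proof.
have Ecat j u : encode_job j ++ u =
    encode_nat (ptime j) ++ encode_nat (weight j) ++ encode_nat (due j) ++ u.
  by rewrite /encode_job -!catA.
have Ne j u : encode_job j ++ u <> [::] by case: j => p w d;
  rewrite Ecat /encode_nat cat_rcons; case: (map _ _).
elim: J J' => [|j J IH] [|j' J'] //=; try by [move/esym/Ne|move/Ne].
rewrite !Ecat => /encode_nat_inj[E1 /encode_nat_inj[E2 /encode_nat_inj[E3 /IH ->]]].
by case: j j' E1 E2 E3 => [p w d] [p' w' d'] /= -> -> ->.
Qed.

Theorem theorem4 : ppt and_3sat weighted_tardy_jobs.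
Proof.
exists reduction; split; first exact: polytime_reduction.
- move=> [s k]; rewrite /reduction [fst _]/= [snd _]/=; split.
    case/and_3sat_solvable => -> Hsol.
    exists (instance_jobs s k), (Posz (instance_threshold s k)); split.
    + by [].
    + exact: job_list_positive.
    + by rewrite (job_list_parameter _ _ (nblocks_small s k)).
    + exact: (solvable_schedule (width_gt2 k) (nblocks_small s k) Hsol).
  case: ifP => [Hv|_]; last by case=> J [w [] /esym]; case: w.
  case=> J [w [E _ _ [rho Hrho]]]; apply/and_3sat_solvable; split=> //.
  have [Ew EJ] := encode_int_inj E; subst w.
  have EJ' := encode_jobs_inj EJ; subst J.
  exact: (schedule_solvable (width_gt2 k) (nblocks_small s k) Hrho).
(* The polynomial is the new parameter itself, [width k * npos k + 1], with [t] standing for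
   $(2k)^3$. *)
- pose l : {poly nat} := ('X + 'X)%R; pose t : {poly nat} := (l * l * l)%R.
  exists ((t + t + 3%N%:P) * ('X + t) + 1%N%:P)%R => -[s k].
  rewrite /reduction [fst _]/= [snd _]/=; case: ifP => // _.
  have Et : t.[k]%R = ntriples k.
    by rewrite /t /l !hornerM !hornerD hornerX /ntriples /nlits mul2n -addnn.
  rewrite hornerD hornerM !hornerD Et hornerX !hornerC /width /npos mul2n -addnn.
  exact: eq_leq (esym (addn1 _)).
Qed.
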